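(* Let $b>0$, let $q:[0,b]\to\mathbb{C}$ be continuous, let $f$ be a non-vanishing solution of $f''-qf=0$ on $[0,b]$ with $f(0)=1$, $h:=f'(0)$, and let $K$, $\beta_j$, $K_N$ be as defined in the context. The solutions $$c(\omega,x):=\cos\omega x+\int_{-x}^xK(x,t)\cos\omega t\,dt,\qquad s(\omega,x):=\sin\omega x+\int_{-x}^xK(x,t)\sin\omega t\,dt$$ of the equation $-y''+q(x)y=\omega^2y$ on $(0,b)$ admit the representations $$c(\omega,x)=\cos\omega x+\sqrt{\frac{2\pi}{\omega x}}\sum_{n=0}^\infty(-1)^n\beta_{2n}(x)J_{2n+1/2}(\omega x)=\cos\omega x+2\sum_{n=0}^\infty(-1)^n\beta_{2n}(x)j_{2n}(\omega x)$$ and $$s(\omega,x)=\sin\omega x+\sqrt{\frac{2\pi}{\omega x}}\sum_{n=0}^\infty(-1)^n\beta_{2n+1}(x)J_{2n+3/2}(\omega x)=\sin\omega x+2\sum_{n=0}^\infty(-1)^n\beta_{2n+1}(x)j_{2n+1}(\omega x),$$ where the series converge uniformly with respect to $x$ on $[0,b]$ and converge uniformly with respect to $\omega$ on any compact subset of the complex plane. Moreover, let $$c_N(\omega,x)=\cos\omega x+2\sum_{n=0}^{[N/2]}(-1)^n\beta_{2n}(x)j_{2n}(\omega x),\qquad s_N(\omega,x)=\sin\omega x+2\sum_{n=0}^{[(N-1)/2]}(-1)^n\beta_{2n+1}(x)j_{2n+1}(\omega x),$$ and let $\varepsilon_N$ be a nonnegative function such that $|K(x,t)-K_N(x,t)|\le\varepsilon_N(x)$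 for $0<x\le b$, $|t|\le x$ (such functions exist with $\varepsilon_N(x)\to0$ as $N\to\infty$ for each $x$). Then $$|c(\omega,x)-c_N(\omega,x)|\le2|x|\varepsilon_N(x)\quad\text{and}\quad|s(\omega,x)-s_N(\omega,x)|\le2|x|\varepsilon_N(x)$$ for any $\omega\in\mathbb{R}$, $\omega\ne0$, and $$|c(\omega,x)-c_N(\omega,x)|\le\frac{2\varepsilon_N(x)\sinh(Cx)}{C}\quad\text{and}\quad|s(\omega,x)-s_N(\omega,x)|\le\frac{2\varepsilon_N(x)\sinh(Cx)}{C}$$ for any $\omega\in\mathbb{C}$, $\omega\ne0$, belonging to the strip $|\operatorname{Im}\omega|\le C$, $C\ge0$ (for $C=0$ the quotient $\sinh(Cx)/C$ is understood as its limit $x$).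
   Context: $P_n$ is the Legendre polynomial of degree $n$; $J_\nu$ is the Bessel function of the first kind; $j_k(z)=\sqrt{\pi/(2z)}\,J_{k+1/2}(z)$ is the spherical Bessel function of order $k$ (an entire function of $z$); the expressions $\sqrt{2\pi/(\omega x)}\,J_{k+1/2}(\omega x)$ are understood as $2j_k(\omega x)$, with their limiting values when $\omega x=0$. $[a]$ is the largest integer $\le a$. Transmutation kernel: $K$ is the (unique continuous) function on $\{(x,t):0\le x\le b,\ |t|\le x\}$ satisfying $$K(x,t)=\frac h2+\frac12\int_0^{\frac{x+t}{2}}q(s)\,ds+\int_0^{\frac{x+t}{2}}\int_0^{\frac{x-t}{2}}q(\alpha+\beta)K(\alpha+\beta,\alpha-\beta)\,d\beta\,d\alpha .$$ It is the $C^1$ kernel of the transmutation operator $Tu(x)=u(x)+\int_{-x}^{x}K(x,t)u(t)\,dt$, which satisfies $\left(-\frac{d^2}{dx^2}+q\right)T[u]=T[-u'']$ for $u\in C^2$ and $T[1]=f$; thus $c(\omega,\cdot)=T[\cos\omega x]$ and $s(\omega,\cdot)=T[\sin\omega x]$. Formal powers: $X^{(0)}\equiv\widetilde X^{(0)}\equiv1$ and, for $n\ge1$, $$X^{(n)}(x)=n\int_0^xX^{(n-1)}(s)\,(f^2(s))^{(-1)^n}ds,\qquad \widetilde X^{(n)}(x)=n\int_0^x\widetilde X^{(n-1)}(s)\,(f^2(s))^{(-1)^{n-1}}ds;$$ $\varphi_k=fX^{(k)}$ for odd $k$ and $\varphi_k=f\widetilde X^{(k)}$ for even $k$. Coefficients: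 let $p_{j,k}:=\int_{-1}^1P_j(y)y^k\,dy$. For $x\in(0,b]$ define recursively $$\beta_0(x)=\frac{f(x)-1}{2},\qquad \beta_1(x)=\frac32\left(\frac{\varphi_1(x)}{x}-1\right),$$ and for $k\ge2$ $$\beta_k(x)=\frac1{p_{k,k}}\Bigl(\frac{\varphi_k(x)}{x^k}-1-\sum_{j}p_{j,k}\beta_j(x)\Bigr),$$ where the sum runs over all $j$ with $0\le j\le k-2$ having the same parity as $k$; at $x=0$ the $\beta_k$ are defined by continuity. Finally $K_N(x,t):=\sum_{j=0}^N\frac{\beta_j(x)}{x}P_j\!\left(\frac tx\right)$. *)

(* Defs.v *)
From Stdlib Require Import Lia List Bool Factorial.
From Stdlib Require Export Reals.
From Coquelicot Require Export Coquelicot.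
Open Scope R_scope.

Definition Icc (a b : R) : R -> Prop := fun x => a <= x <= b.
Definition Ioo (a b : R) : R -> Prop := fun x => a < x < b.

Definition CInt (g : R -> C) (a b : R) : C :=
  RInt (V := C_R_CompleteNormedModule) g a b.

(* Derivative relative to [D]: one-sided at the endpoints of a closed interval,
   and insensitive to the values of [y] outside [D]. *)
Definition is_derive_within (D : R -> Prop) (y : R -> C) (x : R) (l : C) : Prop :=
  filterdiff (K := R_AbsRing) (U := R_NormedModule) (V := C_R_NormedModule)
    y (within D (locally x)) (fun t => scal t (l : C_R_NormedModule)).

Definition schrodinger_solution (D : R -> Prop) (q : R -> C) (lam : C)
    (y : R -> C) : Prop :=
  exists y1 y2 : R -> C, forall x, D x ->
    is_derive_within D y x (y1 x) /\
    is_derive_within D y1 x (y2 x) /\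
    (- y2 x + q x * y x = lam * y x)%C.

Definition Ccontinuous_on (D : R -> Prop) (g : R -> C) : Prop :=
  continuous_on (T := R_UniformSpace) (U := C_UniformSpace) D g.

Definition Ccompact (S : C -> Prop) : Prop :=
  forall (I : Type) (U : I -> C -> Prop),
    (forall i, open (T := C_UniformSpace) (U i)) ->
    (forall z, S z -> exists i, U i z) ->
    exists l : list I, forall z, S z -> exists i, In i l /\ U i z.

Definition Csum (a : nat -> C) (n : nat) : C := sum_n (G := C_AbelianGroup) a n.

Definition Cis_series (a : nat -> C) (l : C) : Prop :=
  is_series (K := R_AbsRing) (V := C_R_NormedModule) a l.

Definition CSeries (a : nat -> C) : C :=
  (Series (fun n => Re (a n)), Series (fun n => Im (a n))).

Definition series_converges_uniformly {A : Type} (D : A -> Prop)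
    (u : nat -> A -> C) (l : A -> C) : Prop :=
  forall eps : R, 0 < eps -> exists N : nat, forall n, (N <= n)%nat ->
    forall p, D p -> Cmod (Csum (fun k => u k p) n - l p)%C < eps.

Definition Cexp (z : C) : C := (exp (Re z) * cos (Im z), exp (Re z) * sin (Im z)).
Definition Ccos (z : C) : C := ((Cexp (Ci * z) + Cexp (- (Ci * z))) / 2)%C.
Definition Csin (z : C) : C := ((Cexp (Ci * z) - Cexp (- (Ci * z))) / (2 * Ci))%C.

(* Principal argument, in (-PI, PI]; only meaningful for [z <> 0]. *)
Definition Carg (z : C) : R :=
  if Rlt_dec (Im z) 0 then - acos (Re z / Cmod z) else acos (Re z / Cmod z).
Definition Clog (z : C) : C := (ln (Cmod z), Carg z).
(* Principal branch of [z ^ a]; only meaningful for [z <> 0]. *)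
Definition Cpower (z : C) (a : R) : C := Cexp (a * Clog z)%C.

(* Bonnet's recursion  m P_m = (2m - 1) x P_{m-1} - (m - 1) P_{m-2}. *)
Fixpoint legendre (n : nat) (x : R) : R :=
  match n with
  | O => 1
  | S m =>
      match m with
      | O => x
      | S k => ((2 * INR m + 1) * x * legendre m x - INR m * legendre k x) / INR n
      end
  end.

(* Euler's integral, convergent for [0 < s]. *)
Definition Gamma (s : R) : R :=
  RInt_gen (V := R_CompleteNormedModule)
    (fun t => Rpower t (s - 1) * exp (- t)) (at_right 0) (Rbar_locally p_infty).

(* J_nu(z) for real [nu > -1] and [z <> 0], principal branch. *)
Definition bessel_J (nu : R) (z : C) : C :=
  (Cpower (z / 2) nu *
   CSeries (fun m => RtoC ((-1) ^ m / (INR (fact m) * Gamma (INR m + nu + 1)))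
                     * ((z / 2) * (z / 2)) ^ m))%C.

(* sqrt (c / z) for real [c > 0] and [z <> 0], read as sqrt c * z^(-1/2) with the
   same branch of arg z as in [bessel_J]: the product
   sqrt (c / z) * J_{k+1/2}(z) is then holomorphic across the negative half-line.
   (The principal square root of the quotient c / z would change its sign
   there.) *)
Definition sqrt_quot (c : R) (z : C) : C := (sqrt c * Cpower z (- (1 / 2)))%C.

(* j_k(z) = sqrt (PI / (2 z)) J_{k+1/2}(z), with its limiting value at z = 0. *)
Definition sph_bessel (k : nat) (z : C) : C :=
  if Req_EM_T (Cmod z) 0
  then (if Nat.eqb k 0 then RtoC 1 else RtoC 0)
  else (sqrt_quot (PI / 2) z * bessel_J (INR k + 1 / 2) z)%C.

Definition triangle (b : R) (p : R * R) : Prop :=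
  0 <= fst p <= b /\ Rabs (snd p) <= fst p.

Definition is_transmutation_kernel (b : R) (q : R -> C) (h : C)
    (K : R -> R -> C) : Prop :=
  continuous_on (T := prod_UniformSpace R_UniformSpace R_UniformSpace)
    (U := C_UniformSpace) (triangle b) (fun p => K (fst p) (snd p)) /\
  forall x t : R, triangle b (x, t) ->
    (K x t = h / 2 + / 2 * CInt q 0 ((x + t) / 2)%R
      + CInt (fun al =>
          CInt (fun be => q (al + be)%R * K (al + be)%R (al - be)%R)
            0 ((x - t) / 2)%R) 0 ((x + t) / 2)%R)%C.

Definition c_sol (K : R -> R -> C) (om : C) (x : R) : C :=
  (Ccos (om * x) + CInt (fun t => K x t * Ccos (om * t)) (- x)%R x)%C.
Definition s_sol (K : R -> R -> C) (om : C) (x : R) : C :=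
  (Csin (om * x) + CInt (fun t => K x t * Csin (om * t)) (- x)%R x)%C.

(* (f^2)^((-1)^n) *)
Definition f2_alt (f : R -> C) (n : nat) (s : R) : C :=
  if Nat.even n then (f s ^ 2)%C else (/ (f s ^ 2))%C.

Fixpoint formal_X (f : R -> C) (n : nat) (x : R) : C :=
  match n with
  | O => RtoC 1
  | S m => (INR n * CInt (fun s => formal_X f m s * f2_alt f n s) 0 x)%C
  end.
Fixpoint formal_Xt (f : R -> C) (n : nat) (x : R) : C :=
  match n with
  | O => RtoC 1
  | S m => (INR n * CInt (fun s => formal_Xt f m s * f2_alt f m s) 0 x)%C
  end.

Definition phi (f : R -> C) (k : nat) (x : R) : C :=
  (f x * (if Nat.odd k then formal_X f k x else formal_Xt f k x))%C.

Definition p_coef (j k : nat) : R := RInt (fun y => legendre j y * y ^ k) (-1) 1.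

(* Right-hand side of the recursion for the k-th coefficient at x > 0, the
   previous coefficients being given by [B]. *)
Definition beta_step (f : R -> C) (B : nat -> R -> C) (k : nat) (x : R) : C :=
  match k with
  | O => ((f x - 1) / 2)%C
  | S O => (3 / 2 * (phi f 1 x / x - 1))%C
  | S (S m) =>
      (/ p_coef k k *
       (phi f k x / x ^ k - 1
        - Csum (fun j => if Bool.eqb (Nat.even j) (Nat.even k)
                         then p_coef j k * B j x else 0) m))%C
  end.

(* [beta_table f n] lists the coefficients of index < n. *)
Fixpoint beta_table (f : R -> C) (n : nat) : nat -> R -> C :=
  match n with
  | O => fun _ _ => RtoC 0
  | S m => fun k x =>
      if Nat.eqb k m then beta_step f (beta_table f m) m x else beta_table f m k x
  end.

Definition beta_pos (f : R -> C) (k : nat) (x : R) : C := beta_table f (S k) k x.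

(* At x = 0 the value is the limit from the right. *)
Definition beta (f : R -> C) (k : nat) (x : R) : C :=
  if Req_EM_T x 0
  then iota (T := C_R_CompleteNormedModule)
         (fun l => filterlim (beta_pos f k) (at_right 0)
                     (locally (T := C_UniformSpace) l))
  else beta_pos f k x.

Lemma beta_table_lt f n k x :
  (k < n)%nat -> beta_table f n k x = beta_pos f k x.
Proof.
  induction n as [|n IH]; intros H; [lia|].
  destruct (Nat.eq_dec k n) as [->|E]; [reflexivity|].
  simpl. rewrite (proj2 (Nat.eqb_neq k n) E). apply IH; lia.
Qed.

Lemma beta_rec f k x : x <> 0 -> beta f k x = beta_step f (beta f) k x.
Proof.
  intros Hx.
  assert (E : forall j, beta f j x = beta_pos f j x).
  { intros j; unfold beta; destruct (Req_EM_T x 0); tauto. }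
  rewrite E. unfold beta_pos at 1.
  change (beta_table f (S k) k x) with
    (if Nat.eqb k k then beta_step f (beta_table f k) k x else beta_table f k k x).
  rewrite Nat.eqb_refl.
  destruct k as [|[|m]]; try reflexivity.
  unfold beta_step.
  apply (f_equal (fun s : C =>
    (/ p_coef (S (S m)) (S (S m)) *
     (phi f (S (S m)) x / x ^ (S (S m)) - 1 - s))%C)).
  apply sum_n_ext_loc; intros j Hj.
  destruct (Bool.eqb _ _); [|reflexivity].
  rewrite E, beta_table_lt by lia. reflexivity.
Qed.

Definition K_trunc (f : R -> C) (N : nat) (x t : R) : C :=
  Csum (fun j => beta f j x / x * legendre j (t / x)%R)%C N.

Definition c_term_J (f : R -> C) (om : C) (x : R) (n : nat) : C :=
  ((-1) ^ n * beta f (2 * n) x * bessel_J (INR (2 * n) + 1 / 2) (om * x))%C.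
Definition s_term_J (f : R -> C) (om : C) (x : R) (n : nat) : C :=
  ((-1) ^ n * beta f (2 * n + 1) x * bessel_J (INR (2 * n) + 3 / 2) (om * x))%C.
Definition c_term (f : R -> C) (om : C) (x : R) (n : nat) : C :=
  ((-1) ^ n * beta f (2 * n) x * sph_bessel (2 * n) (om * x))%C.
Definition s_term (f : R -> C) (om : C) (x : R) (n : nat) : C :=
  ((-1) ^ n * beta f (2 * n + 1) x * sph_bessel (2 * n + 1) (om * x))%C.

Definition c_trunc (f : R -> C) (N : nat) (om : C) (x : R) : C :=
  (Ccos (om * x) + 2 * Csum (c_term f om x) (N / 2))%C.
(* For N = 0 the upper limit [(N-1)/2] is -1 and the sum is empty. *)
Definition s_trunc (f : R -> C) (N : nat) (om : C) (x : R) : C :=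
  (Csin (om * x) +
   2 * match N with O => 0 | S M => Csum (s_term f om x) (M / 2) end)%C.

Definition kernel_error_bound (b : R) (f : R -> C) (K : R -> R -> C) (N : nat)
    (eps : R -> R) : Prop :=
  forall x, 0 < x <= b ->
    0 <= eps x /\
    forall t, Rabs t <= x -> Cmod (K x t - K_trunc f N x t)%C <= eps x.

(* sinh (c x) / c, with its limit x at c = 0. *)
Definition sinh_quot (c x : R) : R :=
  if Req_EM_T c 0 then x else sinh (c * x) / c.

(* Main.v *)
Require Import Defs.
From Stdlib Require Import Lra Lia Factorial Compare_dec Wf_nat List.
Open Scope R_scope.

(** The integral [int_(-x)^x K(x,t) T(om t) dt], for [T] the cosine or the sine, is computed by
    expanding the kernel in Legendre polynomials of [t/x]. Three facts make this work.

    The coefficients of the expansion are the [beta_k]. The operator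
    [T u (x) = u(x) + int_(-x)^x K(x,t) u(t) dt] intertwines [- d^2/dx^2] with [- d^2/dx^2 + q]
    ([Cder_Tr']). Hence [T(t^k)] solves an inhomogeneous equation whose right-hand side is a multiple
    of [T(t^(k-2))], and reduction of order by the solution [f] integrates it exactly as the recursion
    of the formal powers does: [T(t^k) = phi_k] ([Tr_pow]). The moments of [K(x,.)] are therefore
    explicit. Expressed through its Legendre coefficients they form a triangular system, which is
    the recursion of the [beta_k]; so [beta_k(x)] is [x] times the [k]-th Legendre coefficient of the
    slice [y |-> K(x, x y)] of the kernel ([beta_eq]). As [q] is only continuous, [K] need not
    have second derivatives; in characteristic coordinates the computation of [(T u)''] needs none, because the
    terms with a first derivative of the kernel cancel ([Cder_transmute']).

    The expansion converges uniformly in [t]. A slice is continuously differentiable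
    ([Cder_kslice]), and the Legendre series of such a function converges uniformly
    ([lsum_uniform]): the series of the derivative converges in the mean, by polynomial
    approximation ([weierstrass]) and the best approximation property ([lsum_best]), and the
    derivatives of the partial sums of a function are, up to small terms, the partial sums of its
    derivative ([is_derive_lsum]).

    Each term integrates to a spherical Bessel function:
    [int_(-1)^1 P_n(y) e^(i z y) dy = 2 i^n j_n(z)] ([CInt_legendre_Cexp]). Both sides are power
    series in [z], equal by the moments of [P_n] ([p_coef_eval]) and by the values of Gamma at the
    half-integers ([Gamma_half]), which come from the Gaussian integral ([gauss_lim]).

    It follows that [c_N] and [s_N] are the solutions with [K] replaced by [K_N], so their errors
    are the integrals of [K - K_N] against the cosine or sine; the bound [|T(w)| <= cosh (Im w)] turns
    [|K - K_N| <= eps] into the stated estimates ([trunc_error]), which also give the pointwise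
    convergence of the two series. The convergence is uniform because the [beta_k] grow at most
    linearly in [k], uniformly in [x], while [j_k] decays factorially on compact sets
    ([uniform_series]). *)

(** * Continuity, derivatives and integrals of complex-valued functions *)

Definition cont {T V : UniformSpace} (F : T -> V) : Prop :=
  forall p, continuous F p.

Notation contC := (cont (V := C_UniformSpace)).
Notation contR := (cont (V := R_UniformSpace)).
Notation R2 := (prod_UniformSpace R_UniformSpace R_UniformSpace).

Definition cont2 (F : R -> R -> C) : Prop :=
  cont (T := R2)
    (V := C_UniformSpace) (fun p => F (fst p) (snd p)).

Lemma cont_const {T V : UniformSpace} (c : V) : cont (fun _ : T => c).
Proof. intros p; apply continuous_const. Qed.

Lemma cont_id {T : UniformSpace} : cont (fun x : T => x).
Proof. intros p; apply continuous_id. Qed.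

Lemma cont_fst {U V : UniformSpace} : cont (fun p : prod_UniformSpace U V => fst p).
Proof. intros [x y]; apply continuous_fst. Qed.

Lemma cont_snd {U V : UniformSpace} : cont (fun p : prod_UniformSpace U V => snd p).
Proof. intros [x y]; apply continuous_snd. Qed.

Lemma cont_comp {T U V : UniformSpace} (F : U -> V) (a : T -> U) :
  cont F -> cont a -> cont (fun p => F (a p)).
Proof. intros HF Ha p; apply (continuous_comp a F); [apply Ha | apply HF]. Qed.

Lemma cont_comp2 {T U V W : UniformSpace} (F : U -> V -> W) (a : T -> U) (b : T -> V) :
  cont (T := prod_UniformSpace U V) (fun p => F (fst p) (snd p)) ->
  cont a -> cont b -> cont (fun p => F (a p) (b p)).
Proof.
intros HF Ha Hb p.
apply (continuous_comp_2 a b F); [apply Ha | apply Hb | apply (HF (a p, b p))].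
Qed.

Lemma cont2_comp {T : UniformSpace} (F : R -> R -> C) (a b : T -> R) :
  cont2 F -> contR a -> contR b ->
  contC (fun p => F (a p) (b p)).
Proof. intros HF Ha Hb; now apply (cont_comp2 F a b). Qed.

Lemma cont_ext {T V : UniformSpace} (F G : T -> V) : (forall p, F p = G p) -> cont F -> cont G.
Proof. intros E H p; apply (continuous_ext F); [exact E | apply H]. Qed.

Lemma cont_Rplus {T : UniformSpace} (a b : T -> R) :
  contR a -> contR b ->
  contR (fun p => a p + b p).
Proof. intros Ha Hb p; apply (continuous_plus (V := R_NormedModule) a b p); [apply Ha | apply Hb]. Qed.

Lemma cont_Ropp {T : UniformSpace} (a : T -> R) :
  contR a -> contR (fun p => - a p).
Proof. intros Ha p; apply (continuous_opp (V := R_NormedModule) a p); apply Ha. Qed.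

Lemma cont_Rminus {T : UniformSpace} (a b : T -> R) :
  contR a -> contR b ->
  contR (fun p => a p - b p).
Proof. intros Ha Hb p; apply (continuous_minus (V := R_NormedModule) a b p); [apply Ha | apply Hb]. Qed.

Lemma cont_Rmult {T : UniformSpace} (a b : T -> R) :
  contR a -> contR b ->
  contR (fun p => a p * b p).
Proof. intros Ha Hb p; apply (continuous_mult (K := R_AbsRing) a b p); [apply Ha | apply Hb]. Qed.

Lemma cont_of_Re_Im {T : UniformSpace} (F : T -> C) :
  contR (fun p => Re (F p)) ->
  contR (fun p => Im (F p)) ->
  contC F.
Proof.
intros H1 H2 p.
apply (continuous_ext (T := T) (U := C_UniformSpace) (fun p => (Re (F p), Im (F p)))).
{ now intros x; destruct (F x). }
apply (continuous_comp_2 (V := R_UniformSpace) (W := R_UniformSpace) (X := C_UniformSpace)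
  (fun p => Re (F p)) (fun p => Im (F p)) (fun a b => (a, b))).
apply H1. apply H2.
apply (continuous_ext (fun x : R * R => x)).
now intros []. apply continuous_id.
Qed.

Lemma cont_Re {T : UniformSpace} (F : T -> C) :
  contC F -> contR (fun p => Re (F p)).
Proof.
intros H p. apply (continuous_comp (U := T) (V := C_UniformSpace) F (fun z : C => fst z)).
apply H. apply (cont_fst (U := R_UniformSpace) (V := R_UniformSpace)).
Qed.

Lemma cont_Im {T : UniformSpace} (F : T -> C) :
  contC F -> contR (fun p => Im (F p)).
Proof.
intros H p. apply (continuous_comp (U := T) (V := C_UniformSpace) F (fun z : C => snd z)).
apply H. apply (cont_snd (U := R_UniformSpace) (V := R_UniformSpace)).
Qed.

Lemma cont_RtoC {T : UniformSpace} (a : T -> R) :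
  contR a -> contC (fun p => RtoC (a p)).
Proof. intros H; apply cont_of_Re_Im; simpl; [exact H | apply cont_const]. Qed.

Lemma cont_Cplus {T : UniformSpace} (F G : T -> C) :
  contC F -> contC G ->
  contC (fun p => F p + G p)%C.
Proof.
intros HF HG; apply cont_of_Re_Im; simpl; apply cont_Rplus;
  (apply cont_Re || apply cont_Im); assumption.
Qed.

Lemma cont_Copp {T : UniformSpace} (F : T -> C) :
  contC F -> contC (fun p => - F p)%C.
Proof.
intros HF; apply cont_of_Re_Im; simpl; apply cont_Ropp;
  (apply cont_Re || apply cont_Im); assumption.
Qed.

Lemma cont_Cminus {T : UniformSpace} (F G : T -> C) :
  contC F -> contC G ->
  contC (fun p => F p - G p)%C.
Proof. intros HF HG; apply cont_Cplus; [|apply cont_Copp]; assumption. Qed.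

Lemma cont_Cmult {T : UniformSpace} (F G : T -> C) :
  contC F -> contC G ->
  contC (fun p => F p * G p)%C.
Proof.
intros HF HG; apply cont_of_Re_Im; simpl; [apply cont_Rminus | apply cont_Rplus];
  apply cont_Rmult; (apply cont_Re || apply cont_Im); assumption.
Qed.

Lemma cont_Cpow {T : UniformSpace} (F : T -> C) n :
  contC F -> contC (fun p => F p ^ n)%C.
Proof.
intros HF; induction n as [|n IH]; simpl; [apply cont_const | now apply cont_Cmult].
Qed.

Lemma cont_Cinv {T : UniformSpace} (F : T -> C) :
  contC F -> (forall p, F p <> RtoC 0) ->
  contC (fun p => / F p)%C.
Proof.
intros HF Hz.
assert (Hn : forall p, Re (F p) ^ 2 + Im (F p) ^ 2 <> 0).
{ intros p E. apply (Hz p). apply injective_projections; simpl; unfold Re, Im in E; nra. }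
assert (Hi : contR (fun p => / (Re (F p) ^ 2 + Im (F p) ^ 2))).
{ intros p. apply (continuous_comp (fun p => Re (F p) ^ 2 + Im (F p) ^ 2) Rinv).
  - apply (cont_Rplus (fun p => Re (F p) ^ 2) (fun p => Im (F p) ^ 2));
    repeat apply cont_Rmult; try apply cont_const; (apply cont_Re || apply cont_Im); exact HF.
  - apply continuous_Rinv, Hn. }
apply cont_of_Re_Im.
- apply (cont_Rmult (fun p => Re (F p)) (fun p => / (Re (F p) ^ 2 + Im (F p) ^ 2)));
  [now apply cont_Re | exact Hi].
- apply (cont_Rmult (fun p => - Im (F p)) (fun p => / (Re (F p) ^ 2 + Im (F p) ^ 2)));
  [now apply cont_Ropp, cont_Im | exact Hi].
Qed.

(** ** Derivatives *)

Definition Cder (F : R -> C) (x : R) (l : C) : Prop :=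
  is_derive (K := R_AbsRing) (V := C_R_NormedModule) F x l.

Lemma Cder_intro (F : R -> C) x l :
  is_derive (fun t => Re (F t)) x (Re l) -> is_derive (fun t => Im (F t)) x (Im l) ->
  Cder F x l.
Proof.
intros H1 H2. 
apply (filterdiff_ext_lin (K := R_AbsRing) (U := R_NormedModule) (V := C_R_NormedModule) F
  (fun y => (scal y (Re l), scal y (Im l)))).
2: { intros y; now destruct l. }
apply (filterdiff_ext (K := R_AbsRing) (U := R_NormedModule) (V := C_R_NormedModule) (fun t => (Re (F t), Im (F t)))).
{ now intros y; destruct (F y). }
apply (filterdiff_comp_2 (K := R_AbsRing) (T := R_NormedModule) (U := R_NormedModule) (V := R_NormedModule) (W := C_R_NormedModule) 
  (fun t => Re (F t)) (fun t => Im (F t)) (fun a b => (a, b))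
   (fun y => scal y (Re l)) (fun y => scal y (Im l)) (fun a b => (a, b)) H1 H2).
apply (filterdiff_ext_lin _ (fun p => p)).
- apply (filterdiff_ext (fun p => p)). now intros []. apply filterdiff_id.
- now intros [].
Qed.

Lemma Cder_Re (F : R -> C) x l : Cder F x l -> is_derive (fun t => Re (F t)) x (Re l).
Proof.
intros H.
apply (filterdiff_ext_lin (K := R_AbsRing) (U := R_NormedModule) (V := R_NormedModule) _
  (fun y => Re (scal y (l : C_R_NormedModule)))).
2: { intros y; now destruct l. }
apply (filterdiff_comp (K := R_AbsRing) (U := R_NormedModule) (V := C_R_NormedModule)
  (W := R_NormedModule) F (fun z => Re z) _ (fun z => Re z) H).
apply filterdiff_linear, is_linear_fst.
Qed.

Lemma Cder_Im (F : R -> C) x l : Cder F x l -> is_derive (fun t => Im (F t)) x (Im l).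
Proof.
intros H.
apply (filterdiff_ext_lin (K := R_AbsRing) (U := R_NormedModule) (V := R_NormedModule) _
  (fun y => Im (scal y (l : C_R_NormedModule)))).
2: { intros y; now destruct l. }
apply (filterdiff_comp (K := R_AbsRing) (U := R_NormedModule) (V := C_R_NormedModule)
  (W := R_NormedModule) F (fun z => Im z) _ (fun z => Im z) H).
apply filterdiff_linear, is_linear_snd.
Qed.

Lemma Cder_eq (F : R -> C) x l l' : Cder F x l -> l = l' -> Cder F x l'.
Proof. now intros H <-. Qed.

Lemma Cder_ext (F G : R -> C) x l : (forall t, F t = G t) -> Cder F x l -> Cder G x l.
Proof. intros E H; now apply (is_derive_ext F). Qed.

Lemma Cder_const (c : C) x : Cder (fun _ => c) x (RtoC 0).
Proof. apply (is_derive_const (K := R_AbsRing) (V := C_R_NormedModule)). Qed.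

Lemma Cder_plus F G x l m :
  Cder F x l -> Cder G x m -> Cder (fun t => F t + G t)%C x (l + m)%C.
Proof. apply (is_derive_plus (K := R_AbsRing) (V := C_R_NormedModule)). Qed.

Lemma Cder_minus F G x l m :
  Cder F x l -> Cder G x m -> Cder (fun t => F t - G t)%C x (l - m)%C.
Proof. apply (is_derive_minus (K := R_AbsRing) (V := C_R_NormedModule)). Qed.

Lemma Cder_mult F G x l m :
  Cder F x l -> Cder G x m -> Cder (fun t => F t * G t)%C x (l * G x + F x * m)%C.
Proof.
intros HF HG.
pose proof (Cder_Re _ _ _ HF); pose proof (Cder_Im _ _ _ HF).
pose proof (Cder_Re _ _ _ HG); pose proof (Cder_Im _ _ _ HG).
apply Cder_intro; simpl.
- evar_last.
  apply (is_derive_minus (fun t => Re (F t) * Re (G t)) (fun t => Im (F t) * Im (G t)));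
  apply (is_derive_mult (K := R_AbsRing) (fun t => _ (F t)) (fun t => _ (G t)));
  first [eassumption | exact Rmult_comm | idtac].
  unfold minus, plus, opp, mult; simpl; unfold mult, Re, Im; simpl; ring.
- evar_last.
  apply (is_derive_plus (fun t => Re (F t) * Im (G t)) (fun t => Im (F t) * Re (G t)));
  apply (is_derive_mult (K := R_AbsRing) (fun t => _ (F t)) (fun t => _ (G t)));
  first [eassumption | exact Rmult_comm | idtac].
  unfold plus, mult; simpl; unfold mult, Re, Im; simpl; ring.
Qed.

Lemma Cder_scal (c : C) F x l : Cder F x l -> Cder (fun t => c * F t)%C x (c * l)%C.
Proof.
intros H. eapply Cder_eq. apply (Cder_mult (fun _ => c) F); [apply Cder_const | exact H]. ring.
Qed.

Lemma Cder_comp (F : R -> C) (g : R -> R) x l dg :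
  Cder F (g x) l -> is_derive g x dg -> Cder (fun t => F (g t)) x (dg * l)%C.
Proof.
intros HF Hg. eapply Cder_eq.
apply (is_derive_comp (K := R_AbsRing) (V := C_R_NormedModule) F g); eassumption.
unfold scal; simpl; unfold prod_scal, scal; simpl; unfold mult; simpl.
apply injective_projections; simpl; ring.
Qed.

Lemma Cder_continuous (F : R -> C) x l : Cder F x l -> continuous (U := C_UniformSpace) F x.
Proof.
intros H.
apply (ex_derive_continuous (K := R_AbsRing) (V := C_R_NormedModule)). now exists l.
Qed.

Lemma Cder_inv F x l :
  F x <> RtoC 0 -> Cder F x l -> Cder (fun t => / F t)%C x (- l / (F x * F x))%C.
Proof.
intros Hz H.
assert (L : forall (u v : R -> R) (l1 l2 : R), u x * u x + v x * v x <> 0 ->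
  is_derive u x l1 -> is_derive v x l2 ->
  Cder (fun t => / (u t, v t))%C x (- (l1, l2) / ((u x, v x) * (u x, v x)))%C).
{ intros u v l1 l2 Hn H1 H2.
  assert (E1 : Derive (fun y => u y) x = l1) by exact (is_derive_unique _ _ _ H1).
  assert (E2 : Derive (fun y => v y) x = l2) by exact (is_derive_unique _ _ _ H2).
  apply Cder_intro; unfold Cinv; simpl;
    [ apply (is_derive_ext (fun t => u t / (u t * u t + v t * v t)))
    | apply (is_derive_ext (fun t => - v t / (u t * u t + v t * v t))) ];
    try (intros t; now rewrite !Rmult_1_r);
    (auto_derive; [ repeat split; try (eexists; eassumption); exact Hn | ]);
    rewrite E1, E2; field; (split; [|exact Hn]);
    apply Rgt_not_eq;
    (apply Rlt_le_trans with ((u x * u x + v x * v x) * (u x * u x + v x * v x));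
     [nra | right; ring]). }
apply (Cder_ext (fun t => / (Re (F t), Im (F t)))%C); [intros t; now destruct (F t) |].
eapply Cder_eq.
- apply (L (fun t => Re (F t)) (fun t => Im (F t))).
  + intros E. apply Hz. apply injective_projections; simpl; unfold Re, Im in E; nra.
  + exact (Cder_Re _ _ _ H).
  + exact (Cder_Im _ _ _ H).
- now destruct l, (F x).
Qed.

Lemma Cder_pow (k : nat) (x : R) :
  Cder (fun t : R => (RtoC t) ^ k)%C x (INR k * RtoC x ^ pred k)%C.
Proof.
apply (Cder_ext (fun t => RtoC (t ^ k))); [intros t; now rewrite RtoC_pow |].
apply Cder_intro.
- rewrite <- RtoC_pow, <- RtoC_mult. simpl. auto_derive; [trivial | ring].
- rewrite <- RtoC_pow, <- RtoC_mult. simpl. apply (is_derive_const (K := R_AbsRing) (V := R_NormedModule)).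
Qed.

Lemma cont_pow k : contC (fun t : R => (RtoC t) ^ k)%C.
Proof. apply (cont_Cpow (T := R_UniformSpace) (fun t : R_UniformSpace => RtoC t)), cont_RtoC, cont_id. Qed.

Lemma cont_Rdiv_const {T : UniformSpace} (a : T -> R) c : contR a -> contR (fun p => a p / c).
Proof. intros H; apply cont_Rmult; [exact H | apply cont_const]. Qed.

Lemma cont_Cdiv_const {T : UniformSpace} (F : T -> C) c : contC F -> contC (fun p => F p / c)%C.
Proof. intros H; apply cont_Cmult; [exact H | apply cont_const]. Qed.

Lemma cont_Rpow {T : UniformSpace} (a : T -> R) n : contR a -> contR (fun p => a p ^ n).
Proof. intros H; induction n as [|n IH]; simpl; [apply cont_const | now apply cont_Rmult]. Qed.

Lemma Cder_cont (F dF : R -> C) : (forall x, Cder F x (dF x)) -> contC F.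
Proof. intros H x. eapply Cder_continuous, H. Qed.

Lemma cont_of_ex_derive (f : R -> R) : (forall x, ex_derive f x) -> contR f.
Proof. intros H x. apply (ex_derive_continuous (K := R_AbsRing) (V := R_NormedModule)), H. Qed.

Lemma cont_of_derive (f df : R -> R) : (forall x, is_derive f x (df x)) -> contR f.
Proof. intros H. apply cont_of_ex_derive. intros x. eexists; apply H. Qed.

Create HintDb cont discriminated.
#[global] Hint Constants Opaque : cont.
#[global] Hint Resolve cont_const cont_id cont_fst cont_snd cont_Rplus cont_Ropp cont_Rminus
  cont_Rmult cont_Rpow cont_Rdiv_const cont_Re cont_Im cont_RtoC cont_Cplus cont_Copp cont_Cminus
  cont_Cmult cont_Cpow cont_Cdiv_const cont_pow : cont.

(** Syntax-directed: the constants are opaque to the hints, so that a complex operation is never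
    unfolded into a pair of real ones. *)
Ltac prove_cont := intros; auto 20 with cont.

(** ** Integrals *)

Lemma ex_CInt (F : R -> C) a b :
  contC F -> ex_RInt (V := C_R_NormedModule) F a b.
Proof.
intros H. apply (ex_RInt_continuous (V := C_R_CompleteNormedModule)). intros z _; apply H.
Qed.

Lemma is_CInt (F : R -> C) a b :
  contC F -> is_RInt (V := C_R_NormedModule) F a b (CInt F a b).
Proof.
intros H. apply (RInt_correct (V := C_R_CompleteNormedModule)). now apply ex_CInt.
Qed.

Lemma ex_RInt_cont (F : R -> R) a b : cont F -> ex_RInt F a b.
Proof. intros H. apply (ex_RInt_continuous (V := R_CompleteNormedModule)). intros z _; apply H. Qed.

Lemma is_RInt_FTC (F f : R -> R) a b :
  (forall x, is_derive F x (f x)) -> contR f -> is_RInt f a b (F b - F a).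
Proof. intros Hd Hf. apply (is_RInt_derive (V := R_CompleteNormedModule) F f); intros x _; auto. Qed.

Lemma RInt_FTC (F f : R -> R) a b :
  (forall x, is_derive F x (f x)) -> contR f -> RInt f a b = F b - F a.
Proof. intros Hd Hf. now apply is_RInt_unique, is_RInt_FTC. Qed.

Lemma CInt_pair (F : R -> C) a b :
  contC F ->
  CInt F a b = (RInt (fun t => Re (F t)) a b, RInt (fun t => Im (F t)) a b).
Proof.
intros H. symmetry.
apply (RInt_fct_extend_pair (U := R_NormedModule) (V := R_NormedModule)
  (RInt (V := R_CompleteNormedModule)) (RInt (V := R_CompleteNormedModule))).
- intros; now apply is_RInt_unique.
- intros; now apply is_RInt_unique.
- now apply is_CInt.
Qed.

Lemma CInt_ext (F G : R -> C) a b :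
  (forall x, Rmin a b < x < Rmax a b -> F x = G x) -> CInt F a b = CInt G a b.
Proof. intros H; now apply (RInt_ext (V := C_R_CompleteNormedModule)). Qed.

Lemma CInt_point F a : CInt F a a = RtoC 0.
Proof. apply (RInt_point (V := C_R_CompleteNormedModule)). Qed.

Lemma CInt_plus F G a b :
  contC F -> contC G ->
  CInt (fun t => F t + G t)%C a b = (CInt F a b + CInt G a b)%C.
Proof.
intros HF HG.
apply (RInt_plus (V := C_R_CompleteNormedModule)); now apply ex_CInt.
Qed.

Lemma CInt_minus F G a b :
  contC F -> contC G ->
  CInt (fun t => F t - G t)%C a b = (CInt F a b - CInt G a b)%C.
Proof.
intros HF HG.
apply (RInt_minus (V := C_R_CompleteNormedModule)); now apply ex_CInt.
Qed.

Lemma CInt_scal c F a b :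
  contC F -> CInt (fun t => c * F t)%C a b = (c * CInt F a b)%C.
Proof.
intros HF.
assert (H1 := ex_RInt_cont _ a b (cont_Re _ HF)).
assert (H2 := ex_RInt_cont _ a b (cont_Im _ HF)).
rewrite !CInt_pair by (try apply cont_Cmult; try apply cont_const; exact HF).
apply injective_projections; simpl.
- rewrite (RInt_minus (fun t => fst c * Re (F t)) (fun t => snd c * Im (F t)))
    by now apply (ex_RInt_scal (V := R_NormedModule)).
  rewrite 2!(RInt_scal (V := R_CompleteNormedModule)) by assumption. reflexivity.
- rewrite (RInt_plus (fun t => fst c * Im (F t)) (fun t => snd c * Re (F t)))
    by now apply (ex_RInt_scal (V := R_NormedModule)).
  rewrite 2!(RInt_scal (V := R_CompleteNormedModule)) by assumption. reflexivity.
Qed.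

Lemma CInt_const c a b : CInt (fun _ => c) a b = ((b - a)%R * c)%C.
Proof.
unfold CInt. rewrite (RInt_const (V := C_R_CompleteNormedModule)).
apply injective_projections; simpl; unfold scal; simpl; unfold mult; simpl; ring.
Qed.

Lemma CInt_swap F a b : contC F -> CInt F b a = (- CInt F a b)%C.
Proof.
intros H. symmetry. apply (opp_RInt_swap (V := C_R_CompleteNormedModule)). now apply ex_CInt.
Qed.

Lemma CInt_comp_lin F u v a b :
  contC F ->
  CInt F (u * a + v) (u * b + v) = (u * CInt (fun s => F (u * s + v)%R) a b)%C.
Proof.
intros H. unfold CInt at 1.
rewrite <- (RInt_comp_lin (V := C_R_CompleteNormedModule)) by now apply ex_CInt.
rewrite <- CInt_scal.
- apply CInt_ext; intros x _.
  unfold scal; simpl; unfold prod_scal, scal; simpl; unfold mult; simpl.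
  apply injective_projections; simpl; ring.
- apply (cont_comp F); [exact H |].
  prove_cont.
Qed.

Lemma norm_Cmod (z : C) : norm (z : C_R_NormedModule) = Cmod z.
Proof.
unfold norm; simpl; unfold prod_norm, norm; simpl; unfold abs; simpl.
unfold Cmod. rewrite <- (pow2_abs (fst z)), <- (pow2_abs (snd z)). reflexivity.
Qed.

Lemma CInt_rescale (F : R -> C) x : contC F ->
  CInt F (- x) x = (x * CInt (fun y => F (x * y)%R) (-1) 1)%C.
Proof.
intros HF. assert (E := CInt_comp_lin F x 0 (-1) 1 HF).
replace (x * -1 + 0) with (- x) in E by ring. replace (x * 1 + 0) with x in E by ring.
rewrite E. f_equal. apply CInt_ext. intros y _. f_equal; ring.
Qed.

Lemma CInt_norm_le (F : R -> C) (g : R -> R) a b :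
  a <= b -> contC F -> ex_RInt g a b ->
  (forall x, a <= x <= b -> Cmod (F x) <= g x) -> Cmod (CInt F a b) <= RInt g a b.
Proof.
intros Hab HF Hg H.
rewrite <- norm_Cmod. apply (norm_RInt_le (V := C_R_NormedModule) F g a b); auto.
intros; rewrite norm_Cmod; auto.
now apply is_CInt. now apply (RInt_correct (V := R_CompleteNormedModule)).
Qed.

Lemma CInt_norm_le_const (F : R -> C) a b M :
  contC F ->
  (forall x, Rmin a b <= x <= Rmax a b -> Cmod (F x) <= M) ->
  Cmod (CInt F a b) <= Rabs (b - a) * M.
Proof.
intros HF H.
rewrite <- norm_Cmod. apply (norm_RInt_le_const_abs (V := C_R_NormedModule) F a b); auto.
intros; rewrite norm_Cmod; auto.
now apply is_CInt.
Qed.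

Lemma Cder_CInt F a x :
  contC F -> Cder (fun y => CInt F a y) x (F x).
Proof.
intros H.
apply (is_derive_RInt (V := C_R_NormedModule) F (fun y => CInt F a y) a x).
- exists (mkposreal 1 Rlt_0_1); intros y _. now apply is_CInt.
- apply H.
Qed.

Lemma cont_CInt F a : contC F -> contC (fun y => CInt F a y).
Proof. intros H x. eapply Cder_continuous, Cder_CInt, H. Qed.

Lemma constant_of_derive_R b (F : R -> R) :
  cont F -> (forall x, 0 < x < b -> is_derive F x 0) -> forall x, 0 <= x <= b -> F x = F 0.
Proof.
intros HF Hd x Hx.
destruct (MVT_gen F 0 x (fun _ => 0)) as [c [_ E]]; [| | lra].
- intros t Ht. apply Hd. rewrite Rmin_left, Rmax_right in Ht by lra. lra.
- intros t _. apply continuity_pt_filterlim. apply HF.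
Qed.

Lemma constant_of_derive b (F : R -> C) :
  contC F -> (forall x, 0 < x < b -> Cder F x (RtoC 0)) ->
  forall x, 0 <= x <= b -> F x = F 0.
Proof.
intros HF Hd x Hx. apply injective_projections.
- apply (constant_of_derive_R b (fun t => Re (F t))); [now apply cont_Re | | exact Hx].
  intros t Ht. now apply (Cder_Re F t (RtoC 0)), Hd.
- apply (constant_of_derive_R b (fun t => Im (F t))); [now apply cont_Im | | exact Hx].
  intros t Ht. now apply (Cder_Im F t (RtoC 0)), Hd.
Qed.

(** ** Integrals depending on a parameter *)

Lemma cont_2d (f : R -> R -> R) :
  cont (T := R2) (V := R_UniformSpace)
    (fun p => f (fst p) (snd p)) <-> forall x y, continuity_2d_pt f x y.
Proof.
split.
- intros H x y. apply continuity_2d_pt_filterlim. apply (H (x, y)).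
- intros H [x y]. apply (proj1 (continuity_2d_pt_filterlim f x y)), H.
Qed.

Lemma leibniz_R (f df : R -> R -> R) (a : R) (b : R -> R) (x db : R) :
  (forall y t, is_derive (fun s => f s t) y (df y t)) ->
  (forall x y, continuity_2d_pt f x y) -> (forall x y, continuity_2d_pt df x y) ->
  is_derive b x db ->
  is_derive (fun y => RInt (f y) a (b y)) x (RInt (df x) a (b x) + f x (b x) * db).
Proof.
intros Hd Hf Hdf Hb.
assert (Hc : forall y, cont (f y)).
{ intros y. apply (cont_comp2 (U := R_UniformSpace) (V := R_UniformSpace) (T := R_UniformSpace) (W := R_UniformSpace) f (fun _ => y) (fun t => t)).
  now apply cont_2d. apply cont_const. prove_cont. }
assert (He : forall y u v, ex_RInt (fun t => f y t) u v).
{ intros; now apply ex_RInt_cont. }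
assert (HD : forall u v, Derive (fun z => f z v) u = df u v).
{ intros; apply is_derive_unique, Hd. }
assert (HD2 : forall u v, continuity_2d_pt (fun u v => Derive (fun z => f z v) u) u v).
{ intros. apply (continuity_2d_pt_ext df); [intros; now rewrite HD | apply Hdf]. }
rewrite (RInt_ext (df x) (fun t => Derive (fun u => f u t) x)) by (intros; now rewrite HD).
apply is_derive_RInt_param_bound_comp_aux3; trivial.
- apply filter_forall; auto.
- exists (mkposreal 1 Rlt_0_1). apply filter_forall; auto.
- exists (mkposreal 1 Rlt_0_1). apply filter_forall. intros y t _. eexists; apply Hd.
- exists (mkposreal 1 Rlt_0_1). auto.
- apply continuity_pt_filterlim. apply Hc.
Qed.

(** A change of [y] is controlled by uniform continuity over a compact range of [t], a change of
    the end point [x] by the continuity of a primitive. *)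
Lemma cont_RInt_param (f : R -> R -> R) :
  (forall x y, continuity_2d_pt f x y) ->
  forall x y, continuity_2d_pt (fun x y => RInt (fun t => f t y) 0 x) x y.
Proof.
intros Hf x y eps.
assert (Hc : forall y, cont (fun t => f t y)).
{ intros z. apply (cont_comp2 (U := R_UniformSpace) (V := R_UniformSpace) (T := R_UniformSpace) (W := R_UniformSpace) f (fun t => t) (fun _ => z)).
  now apply cont_2d. apply cont_id. prove_cont. }
assert (He : forall y u v, ex_RInt (fun t => f t y) u v).
{ intros; now apply ex_RInt_cont. }
pose (M := Rabs x + 1).
assert (HM : 0 < M) by (unfold M; pose proof (Rabs_pos x); lra).
assert (He1 : 0 < eps / (2 * M)).
{ apply Rdiv_lt_0_compat; [apply cond_pos | lra]. }
destruct (uniform_continuity_2d f (- M) M (y - 1) (y + 1)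
  (fun u v _ _ => Hf u v) (mkposreal _ He1)) as [d1 H1].
assert (Hcx : continuous (fun u => RInt (fun t => f t y) 0 u) x).
{ apply (ex_derive_continuous (K := R_AbsRing) (V := R_NormedModule)). eexists.
  apply (is_derive_RInt (V := R_NormedModule) (fun t => f t y) _ 0 x).
  - apply filter_forall; intros. now apply (RInt_correct (V := R_CompleteNormedModule)).
  - apply Hc. }
destruct (proj1 (filterlim_locally _ _) Hcx (pos_div_2 eps)) as [d2 H2].
assert (Hd : 0 < Rmin (Rmin d1 d2) 1).
{ repeat apply Rmin_glb_lt; try apply cond_pos; lra. }
exists (mkposreal _ Hd); simpl; intros u v Hu Hv.
assert (Hd1 := Rmin_l (Rmin d1 d2) 1). assert (Hd2 := Rmin_r (Rmin d1 d2) 1).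
assert (Hd3 := Rmin_l d1 d2). assert (Hd4 := Rmin_r d1 d2).
assert (H3 : Rabs (RInt (fun t => f t y) 0 u - RInt (fun t => f t y) 0 x) < eps / 2).
{ apply (H2 u). apply Rlt_le_trans with (1 := Hu). lra. }
assert (Hum : Rabs u <= M).
{ unfold M. replace u with (x + (u - x)) by ring.
  eapply Rle_trans; [apply Rabs_triang | lra]. }
assert (H4 : Rabs (RInt (fun t => f t v) 0 u - RInt (fun t => f t y) 0 u) <= eps / 2).
{ rewrite <- (RInt_minus (fun t => f t v) (fun t => f t y)) by apply He.
  apply Rle_trans with (Rabs (u - 0) * (eps / (2 * M))).
  - apply (norm_RInt_le_const_abs (V := R_NormedModule) (fun t => minus (f t v) (f t y)) 0 u).
    + intros t Ht. apply Rlt_le.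
      assert (- M <= t <= M).
      { apply Rabs_le_between in Hum. revert Ht; unfold Rmin, Rmax; destruct Rle_dec; lra. }
      assert (Rabs (v - y) <= 1) by lra. apply Rabs_le_between in H0.
      apply (H1 t y t v); try lra. rewrite Rminus_diag, Rabs_R0. apply cond_pos.
    + apply (RInt_correct (V := R_CompleteNormedModule)).
      apply (ex_RInt_minus (fun t => f t v) (fun t => f t y)); apply He.
  - rewrite Rminus_0_r. apply Rle_trans with (M * (eps / (2 * M))).
    + apply Rmult_le_compat_r; lra.
    + right; field; lra. }
replace (_ - _) with ((RInt (fun t => f t v) 0 u - RInt (fun t => f t y) 0 u) +
  (RInt (fun t => f t y) 0 u - RInt (fun t => f t y) 0 x)) by ring.
eapply Rle_lt_trans; [apply Rabs_triang | lra].
Qed.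

Lemma cont2_CInt_param (F : R -> R -> C) :
  cont2 F -> cont2 (fun x y => CInt (fun t => F t y) 0 x).
Proof.
intros H.
assert (Hc : forall y, contC (fun t => F t y)).
{ intros y; apply (cont2_comp F (fun t : R_UniformSpace => t) (fun _ => y) H);
  [apply cont_id | apply cont_const]. }
apply cont_of_Re_Im.
- intros p. apply (continuous_ext (fun p => RInt (fun t => Re (F t (snd p))) 0 (fst p))).
  { intros q. now rewrite CInt_pair by apply Hc. }
  revert p. apply (cont_2d (fun x y => RInt (fun t => Re (F t y)) 0 x)).
  apply (cont_RInt_param (fun t y => Re (F t y))). apply cont_2d. prove_cont.
- intros p. apply (continuous_ext (fun p => RInt (fun t => Im (F t (snd p))) 0 (fst p))).
  { intros q. now rewrite CInt_pair by apply Hc. }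
  revert p. apply (cont_2d (fun x y => RInt (fun t => Im (F t y)) 0 x)).
  apply (cont_RInt_param (fun t y => Im (F t y))). apply cont_2d. prove_cont.
Qed.

Lemma leibniz (F dF : R -> R -> C) (a : R) (b : R -> R) (x db : R) :
  (forall y t, Cder (fun s => F s t) y (dF y t)) -> cont2 F -> cont2 dF ->
  is_derive b x db ->
  Cder (fun y => CInt (F y) a (b y)) x (CInt (dF x) a (b x) + db * F x (b x))%C.
Proof.
intros Hd HF HdF Hb.
assert (Hc : forall G, cont2 G -> forall y, contC (fun t => G y t)).
{ intros G HG y; apply (cont2_comp G (fun _ => y) (fun t : R_UniformSpace => t) HG);
  [apply cont_const | apply cont_id]. }
apply (Cder_ext (fun y => (RInt (fun t => Re (F y t)) a (b y), RInt (fun t => Im (F y t)) a (b y)))).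
{ intros t. symmetry. apply CInt_pair, Hc, HF. }
rewrite CInt_pair by apply Hc, HdF.
apply Cder_intro; simpl.
- eapply is_derive_ext; [intros; reflexivity|]. evar_last.
  apply (leibniz_R (fun y t => Re (F y t)) (fun y t => Re (dF y t)) a b x db).
  + intros; now apply (Cder_Re (fun s => F s t)).
  + apply cont_2d. prove_cont.
  + apply cont_2d. prove_cont.
  + exact Hb.
  + simpl; unfold Re; ring.
- eapply is_derive_ext; [intros; reflexivity|]. evar_last.
  apply (leibniz_R (fun y t => Im (F y t)) (fun y t => Im (dF y t)) a b x db).
  + intros; now apply (Cder_Im (fun s => F s t)).
  + apply cont_2d. prove_cont.
  + apply cont_2d. prove_cont.
  + exact Hb.
  + simpl; unfold Im; ring.
Qed.

(** On the way from the origin, in steps shorter than a modulus of uniform continuity for the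
    tolerance 1, the function changes by at most 1 at each step. *)
Lemma bounded_2d (f : R -> R -> R) b : 0 < b -> (forall x y, continuity_2d_pt f x y) ->
  exists M, forall x y, - b <= x <= b -> - b <= y <= b -> Rabs (f x y) <= M.
Proof.
intros Hb Hf.
destruct (uniform_continuity_2d f (- b) b (- b) b (fun x y _ _ => Hf x y) (mkposreal 1 Rlt_0_1)) as [d Hd].
assert (Hd0 := cond_pos d).
destruct (nfloor_ex (b / d + 1)) as [n [_ Hn]].
{ assert (0 <= b / d) by (apply Rdiv_le_0_compat; lra). lra. }
rewrite <- S_INR in Hn. set (N := INR (S n)) in *.
assert (HN : 0 < N) by (apply lt_0_INR; lia).
assert (Hst : b / N < d).
{ apply Rlt_div_l; [exact HN |]. assert (b / d < N) by lra. apply Rlt_div_l in H; lra. }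
exists (Rabs (f 0 0) + N). intros x y Hx Hy.
assert (P : forall k, (k <= S n)%nat -> Rabs (f (INR k / N * x) (INR k / N * y)) <= Rabs (f 0 0) + INR k).
{ induction k as [|k IH]; intros Hk.
  - simpl INR. unfold Rdiv. rewrite !Rmult_0_l. lra.
  - specialize (IH ltac:(lia)).
    assert (Hkn : INR (S k) <= N) by (apply le_INR; exact Hk). rewrite S_INR in *.
    assert (Hk0 := pos_INR k).
    assert (R0 : 0 <= INR k / N <= 1) by (split; [apply Rdiv_le_0_compat | apply Rle_div_l]; lra).
    assert (R1 : 0 <= (INR k + 1) / N <= 1) by (split; [apply Rdiv_le_0_compat | apply Rle_div_l]; lra).
    assert (In : forall r u, 0 <= r <= 1 -> - b <= u <= b -> - b <= r * u <= b) by (intros; nra).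
    assert (St : forall u, - b <= u <= b -> Rabs ((INR k + 1) / N * u - INR k / N * u) < d).
    { intros u Hu. replace ((INR k + 1) / N * u - INR k / N * u) with (u / N) by (field; lra).
      unfold Rdiv. rewrite Rabs_mult, (Rabs_pos_eq (/ N)) by (apply Rlt_le, Rinv_0_lt_compat, HN).
      apply Rle_lt_trans with (2 := Hst). apply Rmult_le_compat_r; [apply Rlt_le, Rinv_0_lt_compat, HN |].
      apply Rabs_le; lra. }
    assert (L := Hd _ _ _ _ (In _ x R0 Hx) (In _ y R0 Hy) (In _ x R1 Hx) (In _ y R1 Hy) (St x Hx) (St y Hy)).
    simpl in L.
    replace (f ((INR k + 1) / N * x) ((INR k + 1) / N * y)) with
     (f (INR k / N * x) (INR k / N * y) + (f ((INR k + 1) / N * x) ((INR k + 1) / N * y) - f (INR k / N * x) (INR k / N * y))) by ring.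
    eapply Rle_trans; [apply Rabs_triang |]. lra. }
specialize (P (S n) ltac:(lia)). fold N in P.
replace (N / N) with 1 in P by (field; lra). now rewrite 2!Rmult_1_l in P.
Qed.

(** * Legendre polynomials *)

Lemma bonnet n x :
  INR (S (S n)) * legendre (S (S n)) x
  = (2 * INR (S n) + 1) * x * legendre (S n) x - INR (S n) * legendre n x.
Proof.
change (legendre (S (S n)) x) with
  (((2 * INR (S n) + 1) * x * legendre (S n) x - INR (S n) * legendre n x) / INR (S (S n))).
field. apply not_0_INR; lia.
Qed.

(** The derivative of [legendre n], by differentiation of Bonnet's recursion. *)
Fixpoint dlegendre (n : nat) (x : R) : R :=
  match n with
  | O => 0
  | S m =>
      match m with
      | O => 1
      | S k => ((2 * INR m + 1) * (legendre m x + x * dlegendre m x)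
                - INR m * dlegendre k x) / INR n
      end
  end.

Lemma pair_ind (P : nat -> Prop) :
  P 0%nat -> P 1%nat -> (forall n, P n -> P (S n) -> P (S (S n))) -> forall n, P n.
Proof.
intros H0 H1 H n. enough (P n /\ P (S n)) by tauto.
induction n as [|n [IH1 IH2]]; auto.
Qed.

Lemma is_derive_legendre n x : is_derive (legendre n) x (dlegendre n x).
Proof.
induction n as [| |n IH1 IH2] using pair_ind.
- apply (is_derive_const (K := R_AbsRing) (V := R_NormedModule)).
- apply (is_derive_id (K := R_AbsRing)).
- apply (is_derive_ext (fun x => ((2 * INR (S n) + 1) * x * legendre (S n) x - INR (S n) * legendre n x) / INR (S (S n)))).
  { intros; reflexivity. }
  evar_last.
  + apply (is_derive_scal_l (V := R_NormedModule)
     (fun x => (2 * INR (S n) + 1) * x * legendre (S n) x - INR (S n) * legendre n x)).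
    apply (is_derive_minus (V := R_NormedModule)).
    * apply (is_derive_mult (K := R_AbsRing) (fun x => (2 * INR (S n) + 1) * x)); [| exact IH2 | exact Rmult_comm].
      apply (is_derive_scal (fun x => x)), (is_derive_id (K := R_AbsRing)).
    * apply (is_derive_scal (legendre n)). exact IH1.
  + change (dlegendre (S (S n)) x) with (((2 * INR (S n) + 1) * (legendre (S n) x + x * dlegendre (S n) x)
                - INR (S n) * dlegendre n x) / INR (S (S n))).
    unfold scal, minus, plus, opp, one; simpl; unfold mult; simpl. unfold Rdiv. f_equal.
    cbv [Ring.one]. simpl. ring.
Qed.

Lemma cont_legendre n : contR (legendre n).
Proof. exact (cont_of_derive _ _ (is_derive_legendre n)). Qed.
#[global] Hint Resolve cont_legendre : cont.

(** Neither of the two relations is inductive alone; together they are, by Bonnet's recursion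
    and its derivative. *)
Lemma dlegendre_rec n x :
  dlegendre (S n) x = x * dlegendre n x + INR (S n) * legendre n x /\
  x * dlegendre (S n) x - dlegendre n x = INR (S n) * legendre (S n) x.
Proof.
induction n as [|n [IH1 IH2]].
- simpl; lra.
- assert (HN : INR (S (S n)) <> 0) by (apply not_0_INR; lia).
  assert (HD : INR (S (S n)) * dlegendre (S (S n)) x =
    (2 * INR (S n) + 1) * (legendre (S n) x + x * dlegendre (S n) x) - INR (S n) * dlegendre n x).
  { change (dlegendre (S (S n)) x) with (((2 * INR (S n) + 1) * (legendre (S n) x + x * dlegendre (S n) x)
                - INR (S n) * dlegendre n x) / INR (S (S n))). field. exact HN. }
  assert (HB := bonnet n x).
  revert HN HD HB. generalize (dlegendre (S (S n)) x) (legendre (S (S n)) x).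
  rewrite !(S_INR (S n)). rewrite S_INR in *. pose proof (pos_INR n).
  set (N := INR n) in *. intros D2 P2 HN HD HB.
  assert (E : D2 = x * dlegendre (S n) x + (N + 1 + 1) * legendre (S n) x).
  { apply (Rmult_eq_reg_l (N + 1 + 1)); [rewrite HD | exact HN].
    replace (dlegendre n x) with (x * dlegendre (S n) x - (N + 1) * legendre (S n) x) by lra. ring. }
  split; [exact E |].
  rewrite E. rewrite HB.
  assert (E3 : x * (x * dlegendre (S n) x) = x * (dlegendre n x + (N + 1) * legendre (S n) x)) by (rewrite <- IH2; ring).
  rewrite IH1 in *. nra.
Qed.

Lemma dlegendre_diff n x :
  dlegendre (S (S n)) x - dlegendre n x = (2 * INR (S n) + 1) * legendre (S n) x.
Proof.
destruct (dlegendre_rec n x) as [_ H2]. destruct (dlegendre_rec (S n) x) as [H1 _].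
rewrite H1, (S_INR (S n)). lra.
Qed.

(** With [D] the derivative of [P], the quantity [n^2 P_n^2 + (1 - x^2) D_n^2] equals
    [n^2 P_{n-1}^2 + (1 - x^2) D_{n-1}^2], so [P_n^2 + (1 - x^2) D_n^2 / n^2] decreases in [n]. *)
Lemma legendre_energy n x : -1 <= x <= 1 ->
  INR (S n) ^ 2 * legendre (S n) x ^ 2 + (1 - x ^ 2) * dlegendre (S n) x ^ 2 <= INR (S n) ^ 2.
Proof.
intros Hx. assert (Hx2 : 0 <= 1 - x ^ 2) by nra.
induction n as [|n IH].
- simpl; nra.
- assert (E : INR (S (S n)) ^ 2 * legendre (S (S n)) x ^ 2 + (1 - x ^ 2) * dlegendre (S (S n)) x ^ 2
     = INR (S (S n)) ^ 2 * legendre (S n) x ^ 2 + (1 - x ^ 2) * dlegendre (S n) x ^ 2).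
  { destruct (dlegendre_rec (S n) x) as [H1 H2].
    replace (INR (S (S n)) ^ 2 * legendre (S (S n)) x ^ 2) with ((INR (S (S n)) * legendre (S (S n)) x) ^ 2) by ring.
    rewrite <- H2, H1. ring. }
  rewrite E. rewrite (S_INR (S n)).
  assert (HN : 1 <= INR (S n)) by (rewrite S_INR; pose proof (pos_INR n); lra).
  set (N := INR (S n)) in *. set (P := legendre (S n) x) in *. set (D := dlegendre (S n) x) in *.
  assert (0 <= (1 - x ^ 2) * D ^ 2) by (apply Rmult_le_pos; nra).
  assert (P ^ 2 <= 1).
  { apply (Rmult_le_reg_l (N ^ 2)); [nra | lra]. }
  nra.
Qed.

Lemma legendre_bound n x : -1 <= x <= 1 -> Rabs (legendre n x) <= 1.
Proof.
intros Hx. destruct n as [|n]; [simpl; rewrite Rabs_R1; lra |].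
assert (H := legendre_energy n x Hx).
assert (HN : 1 <= INR (S n)) by (rewrite S_INR; pose proof (pos_INR n); lra).
assert (0 <= (1 - x ^ 2) * dlegendre (S n) x ^ 2) by (apply Rmult_le_pos; nra).
rewrite <- (sqrt_Rsqr_abs). rewrite <- sqrt_1. apply sqrt_le_1_alt. unfold Rsqr.
assert (INR (S n) ^ 2 * (legendre (S n) x ^ 2) <= INR (S n) ^ 2 * 1) by lra.
apply Rmult_le_reg_l in H1; nra.
Qed.

Lemma legendre_1 n : legendre n 1 = 1.
Proof.
induction n as [| |n IH1 IH2] using pair_ind; [reflexivity | reflexivity |].
apply (Rmult_eq_reg_l (INR (S (S n)))); [| apply not_0_INR; lia].
rewrite bonnet, IH1, IH2, (S_INR (S n)). ring.
Qed.

Lemma legendre_m1 n : legendre n (-1) = (-1) ^ n.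
Proof.
induction n as [| |n IH1 IH2] using pair_ind; [reflexivity | simpl; ring |].
apply (Rmult_eq_reg_l (INR (S (S n)))); [| apply not_0_INR; lia].
rewrite bonnet, IH1, IH2, (S_INR (S n)). simpl. ring.
Qed.

(** ** Inner products on [-1,1] *)

Lemma RInt_ext_R (f g : R -> R) a b :
  (forall x, Rmin a b < x < Rmax a b -> f x = g x) -> RInt f a b = RInt g a b.
Proof. intros H; now apply (RInt_ext (V := R_CompleteNormedModule)). Qed.

Definition ip (f g : R -> R) : R := RInt (fun y => f y * g y) (-1) 1.

Lemma ip_comm f g : ip f g = ip g f.
Proof. apply RInt_ext_R; intros; ring. Qed.

Lemma ip_ext f f' g g' :
  (forall y, -1 < y < 1 -> f y = f' y) -> (forall y, -1 < y < 1 -> g y = g' y) -> ip f g = ip f' g'.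
Proof.
intros Hf Hg. apply RInt_ext_R; intros y Hy. rewrite Rmin_left, Rmax_right in Hy by lra.
now rewrite Hf, Hg.
Qed.

Lemma ip_plus f1 f2 g : cont f1 -> cont f2 -> cont g ->
  ip (fun y => f1 y + f2 y) g = ip f1 g + ip f2 g.
Proof.
intros H1 H2 H3. unfold ip.
rewrite <- (RInt_plus (fun y => f1 y * g y) (fun y => f2 y * g y)) by
  now apply ex_RInt_cont, cont_Rmult.
apply RInt_ext_R; intros. unfold plus; simpl; ring.
Qed.

Lemma ip_scal c f g : cont f -> cont g -> ip (fun y => c * f y) g = c * ip f g.
Proof.
intros H1 H2. unfold ip.
rewrite <- (RInt_scal (V := R_CompleteNormedModule) (fun y => f y * g y)) by
  now apply ex_RInt_cont, cont_Rmult.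
apply RInt_ext_R; intros. unfold scal; simpl; unfold mult; simpl; ring.
Qed.

Lemma ip_bonnet n g : cont g ->
  INR (S (S n)) * ip (legendre (S (S n))) g
  = (2 * INR (S n) + 1) * ip (legendre (S n)) (fun y => y * g y) - INR (S n) * ip (legendre n) g.
Proof.
intros Hg.
assert (C : contR (fun y : R => y * g y)) by prove_cont.
pose proof cont_legendre as CL.
transitivity (ip (fun y => (2 * INR (S n) + 1) * (y * legendre (S n) y) + - INR (S n) * legendre n y) g).
- rewrite <- ip_scal by auto. apply ip_ext; [| reflexivity]. intros y _. rewrite bonnet; ring.
- rewrite ip_plus.
  + rewrite 2!ip_scal by prove_cont.
    replace (ip (fun y => y * legendre (S n) y) g) with (ip (legendre (S n)) (fun y => y * g y)); [ring |].
    apply RInt_ext_R; intros; ring.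
  + prove_cont.
  + prove_cont.
  + exact Hg.
Qed.

(** ** Moments *)

Lemma p_coef_rec n m :
  INR (S (S n)) * p_coef (S (S n)) m = (2 * INR (S n) + 1) * p_coef (S n) (S m) - INR (S n) * p_coef n m.
Proof. apply (ip_bonnet n (fun y => y ^ m)). prove_cont. Qed.

Lemma p_coef_0 m : p_coef 0 m = (1 - (-1) ^ (S m)) / INR (S m).
Proof.
transitivity (RInt (fun y => y ^ m) (-1) 1); [apply RInt_ext_R; intros; simpl; ring |].
assert (H0 : INR (S m) <> 0) by (apply not_0_INR; lia).
rewrite (RInt_FTC (fun y => y ^ (S m) / INR (S m))); [| | prove_cont].
- rewrite pow1. field. exact H0.
- intros x. auto_derive; [trivial |]. change (pred (S m)) with m. field. exact H0.
Qed.

Lemma p_coef_1 m : p_coef 1 m = p_coef 0 (S m).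
Proof. apply RInt_ext_R; intros; simpl; ring. Qed.

(** The odd double factorial [(2n+1)!!]. *)
Fixpoint dfact (n : nat) : R :=
  match n with O => 1 | S k => (2 * INR k + 3) * dfact k end.

Lemma dfact_pos n : 0 < dfact n.
Proof.
induction n as [|n IH]; simpl; [lra |]. apply Rmult_lt_0_compat; [pose proof (pos_INR n); lra | exact IH].
Qed.

Lemma fact_odd l : INR (fact (2 * l + 1)) = 2 ^ l * INR (fact l) * dfact l.
Proof.
induction l as [|l IH]; [simpl; ring |].
replace (2 * S l + 1)%nat with (S (S (2 * l + 1))) by lia.
change (fact (S l)) with (S l * fact l)%nat.
rewrite 2!fact_simpl, !mult_INR, IH. change (dfact (S l)) with ((2 * INR l + 3) * dfact l).
rewrite !S_INR, plus_INR, mult_INR. simpl. ring.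
Qed.

Definition moment (n l : nat) : R :=
  2 * INR (fact (n + 2 * l)) / (2 ^ l * INR (fact l) * dfact (n + l)).

(** Bonnet's recursion multiplies by [y], so it links the moments of three consecutive
    polynomials, and the closed form follows by induction. The vanishing moments belong to the same
    induction; the moment of order [n] against [P_(n+2)] is the one where two nonzero terms
    cancel. *)
Lemma p_coef_eval n :
  (forall l, p_coef n (n + 2 * l) = moment n l) /\
  (forall l, p_coef n (n + 2 * l + 1) = 0) /\
  (forall m, (m < n)%nat -> p_coef n m = 0).
Proof.
assert (Hsq : forall l, (-1) ^ (2 * l) = 1).
{ intros l. rewrite pow_mult. replace ((-1) ^ 2) with 1 by ring. apply pow1. }
assert (Z : forall l, 2 / INR (2 * l + 1) = 2 * INR (fact (2 * l)) / (2 ^ l * INR (fact l) * dfact l)).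
{ intros l. rewrite <- fact_odd. replace (2 * l + 1)%nat with (S (2 * l)) by lia.
  rewrite fact_simpl, mult_INR. field. split; [apply INR_fact_neq_0 | apply not_0_INR; lia]. }
induction n as [| |n (A1 & B1 & C1) (A2 & B2 & C2)] using pair_ind.
- repeat split; intros; try lia; rewrite p_coef_0.
  + unfold moment. change (0 + l)%nat with l. change (0 + 2 * l)%nat with (2 * l)%nat. rewrite <- Z. replace (S (2 * l)) with (2 * l + 1)%nat by lia.
    rewrite pow_add, Hsq. f_equal. simpl; ring.
  + replace (S (0 + 2 * l + 1)) with (2 * (l + 1))%nat by lia. rewrite Hsq. unfold Rdiv; ring.
- repeat split; intros; rewrite p_coef_1, p_coef_0.
  + replace (S (S (1 + 2 * l))) with (2 * S l + 1)%nat by lia. rewrite pow_add, Hsq.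
    transitivity (2 / INR (2 * S l + 1)); [f_equal; simpl; ring |].
    unfold moment. replace (1 + 2 * l)%nat with (2 * l + 1)%nat by lia. rewrite fact_odd.
    simpl (dfact (1 + l)).
    replace (INR (2 * S l + 1)) with (2 * INR l + 3) by (rewrite plus_INR, mult_INR, (S_INR l); simpl; ring).
    assert (P := dfact_pos l). assert (P2 := pow_lt 2 l ltac:(lra)).
    pose proof (pos_INR l). field. repeat split; try lra. apply INR_fact_neq_0.
  + replace (S (S (1 + 2 * l + 1))) with (2 * (l + 2))%nat by lia. rewrite Hsq. unfold Rdiv; ring.
  + replace m with 0%nat by lia. simpl; field.
- assert (HN : INR (S (S n)) <> 0) by (apply not_0_INR; lia).
  repeat split; intros; apply (Rmult_eq_reg_l (INR (S (S n)))); trivial; rewrite p_coef_rec.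
  + replace (S (S (S n) + 2 * l)) with (S n + 2 * S l)%nat by lia.
    replace (S (S n) + 2 * l)%nat with (n + 2 * S l)%nat at 1 by lia.
    rewrite A1, A2. unfold moment.
    replace (S (S n) + 2 * l)%nat with (n + 2 * S l)%nat by lia.
    replace (S n + 2 * S l)%nat with (S (n + 2 * S l)) by lia.
    replace (S (S n) + l)%nat with (S (n + S l)) by lia.
    replace (S n + S l)%nat with (S (n + S l)) by lia.
    change (fact (S l)) with (S l * fact l)%nat.
    change (dfact (S (n + S l))) with ((2 * INR (n + S l) + 3) * dfact (n + S l)).
    rewrite fact_simpl, !mult_INR, !S_INR, !plus_INR, !mult_INR, !S_INR. simpl INR. simpl pow.
    assert (P := dfact_pos (n + S l)). assert (P2 := pow_lt 2 l ltac:(lra)).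
    pose proof (pos_INR l). pose proof (pos_INR n). field.
    repeat split; try lra. apply INR_fact_neq_0.
  + replace (S (S (S n) + 2 * l + 1)) with (S n + 2 * S l + 1)%nat by lia.
    replace (S (S n) + 2 * l + 1)%nat with (n + 2 * S l + 1)%nat by lia.
    rewrite B1, B2; ring.
  + destruct (Compare_dec.lt_eq_lt_dec m n) as [[Hm | ->] | Hm].
    * rewrite C1, C2 by lia. ring.
    * assert (E1 := A2 0%nat). assert (E2 := A1 0%nat).
      replace (S n + 2 * 0)%nat with (S n) in E1 by lia. replace (n + 2 * 0)%nat with n in E2 by lia.
      rewrite E1, E2. unfold moment.
      replace (n + 2 * 0)%nat with n by lia. replace (S n + 2 * 0)%nat with (S n) by lia.
      replace (n + 0)%nat with n by lia. replace (S n + 0)%nat with (S n) by lia.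
      change (dfact (S n)) with ((2 * INR n + 3) * dfact n).
      rewrite fact_simpl, mult_INR, !S_INR. simpl.
      assert (P := dfact_pos n). pose proof (pos_INR n). field. repeat split; lra.
    * replace m with (S n) by lia.
      assert (E1 := B2 0%nat). assert (E2 := B1 0%nat).
      replace (S n + 2 * 0 + 1)%nat with (S (S n)) in E1 by lia.
      replace (n + 2 * 0 + 1)%nat with (S n) in E2 by lia.
      rewrite E1, E2; ring.
Qed.

Lemma p_coef_parity j k : (j <= k)%nat -> Bool.eqb (Nat.even j) (Nat.even k) = false -> p_coef j k = 0.
Proof.
intros Hjk E. assert (Hd : Nat.odd (k - j) = true).
{ rewrite Nat.odd_sub by exact Hjk. rewrite <- 2!Nat.negb_even.
  destruct (Nat.even j), (Nat.even k); simpl in *; congruence. }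
apply Nat.odd_spec in Hd. destruct Hd as [l Hl].
replace k with (j + 2 * l + 1)%nat by lia. exact (proj1 (proj2 (p_coef_eval j)) l).
Qed.

Lemma p_coef_diag k : p_coef k k <> 0.
Proof.
replace k with (k + 2 * 0)%nat at 2 by lia. rewrite (proj1 (p_coef_eval k)). unfold moment.
assert (P := dfact_pos (k + 0)). assert (Q := INR_fact_lt_0 (k + 2 * 0)). simpl pow.
apply Rgt_not_eq, Rdiv_lt_0_compat; [lra |]. simpl (fact 0). simpl INR. lra.
Qed.

(** The gain over [j!] pays for the factor [2 j + 1] of the Legendre coefficients. *)
Lemma dfact_ge j : (2 * INR j + 1) / dfact j <= / INR (fact j).
Proof.
assert (G : forall k, INR (fact (S k)) <= dfact k).
{ induction k as [|k IH]; [simpl; lra |].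
  rewrite fact_simpl, mult_INR. change (dfact (S k)) with ((2 * INR k + 3) * dfact k).
  apply Rmult_le_compat; [apply pos_INR | apply pos_INR | | exact IH].
  rewrite !S_INR. pose proof (pos_INR k); lra. }
destruct j as [|j].
- simpl. lra.
- change (dfact (S j)) with ((2 * INR j + 3) * dfact j). rewrite S_INR.
  assert (P := dfact_pos j). assert (Q := pos_INR j).
  replace ((2 * (INR j + 1) + 1) / ((2 * INR j + 3) * dfact j)) with (/ dfact j) by (field; lra).
  apply Rinv_le_contravar; [apply INR_fact_lt_0 | apply G].
Qed.

Lemma pow_m1_even n : (-1) ^ (2 * n) = 1.
Proof. rewrite pow_mult. replace ((-1) ^ 2) with 1 by ring. apply pow1. Qed.

(** ** Orthogonality and expansions *)

Lemma ip_plus_r f g1 g2 : cont f -> cont g1 -> cont g2 ->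
  ip f (fun y => g1 y + g2 y) = ip f g1 + ip f g2.
Proof. intros; rewrite ip_comm, ip_plus by assumption. now rewrite (ip_comm g1), (ip_comm g2). Qed.

Lemma ip_scal_r c f g : cont f -> cont g -> ip f (fun y => c * g y) = c * ip f g.
Proof. intros; rewrite ip_comm, ip_scal by assumption. now rewrite (ip_comm g). Qed.

(** Bonnet's recursion lowers the degree of the second factor until only vanishing moments
    remain; the power [y^k] absorbs the multiplications by [y]. *)
Lemma ip_legendre_lower n m k : (m + k < n)%nat -> ip (legendre n) (fun y => y ^ k * legendre m y) = 0.
Proof.
revert k; induction m as [| |m IH1 IH2] using pair_ind; intros k Hk.
- rewrite <- (proj2 (proj2 (p_coef_eval n)) k) by lia. apply RInt_ext_R; intros; simpl; ring.
- rewrite <- (proj2 (proj2 (p_coef_eval n)) (S k)) by lia. apply RInt_ext_R; intros; simpl; ring.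
- apply (Rmult_eq_reg_l (INR (S (S m)))); [| apply not_0_INR; lia].
  assert (C1 : forall i j, contR (fun y : R => y ^ i * legendre j y)).
  { intros i j; prove_cont. }
  rewrite <- ip_scal_r by prove_cont.
  transitivity (ip (legendre n) (fun y => (2 * INR (S m) + 1) * (y ^ S k * legendre (S m) y) + (- INR (S m)) * (y ^ k * legendre m y))).
  + apply ip_ext; [reflexivity |]. intros y _.
    replace (INR (S (S m)) * (y ^ k * legendre (S (S m)) y)) with (y ^ k * (INR (S (S m)) * legendre (S (S m)) y)) by ring.
    rewrite bonnet. simpl pow. ring.
  + rewrite ip_plus_r by prove_cont.
    rewrite 2!ip_scal_r by prove_cont.
    rewrite IH1, IH2 by lia. ring.
Qed.

Lemma ip_legendre_neq n m : n <> m -> ip (legendre n) (legendre m) = 0.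
Proof.
assert (H : forall n m, (m < n)%nat -> ip (legendre n) (legendre m) = 0).
{ intros i j Hij. rewrite <- (ip_legendre_lower i j 0) by lia. apply ip_ext; [reflexivity |]. intros; simpl; ring. }
intros E. destruct (Compare_dec.lt_eq_lt_dec n m) as [[L | L] | L].
- rewrite ip_comm; now apply H.
- contradiction.
- now apply H.
Qed.

(** Bonnet's recursion for [P_(n+2)] and for [P_(n+3)], paired with [P_(n+2)] and [P_(n+1)],
    evaluates the integral of [y P_(n+1) P_(n+2)] in two ways and so yields a recursion for the
    norms. *)
Lemma ip_legendre_eq n : ip (legendre n) (legendre n) = 2 / (2 * INR n + 1).
Proof.
induction n as [| |n _ IH] using pair_ind.
- transitivity (p_coef 0 0); [apply RInt_ext_R; intros; simpl; ring |].
  rewrite p_coef_0. simpl. field.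
- transitivity (p_coef 1 (1 + 2 * 0)); [apply RInt_ext_R; intros; simpl; ring |].
  rewrite (proj1 (p_coef_eval 1)). unfold moment; simpl. field.
- assert (C := cont_legendre).
  assert (E1 := ip_bonnet n (legendre (S (S n))) (C _)).
  rewrite (ip_legendre_neq n) in E1 by lia.
  assert (E2 := ip_bonnet (S n) (legendre (S n)) (C _)).
  rewrite (ip_legendre_neq (S (S (S n)))), IH in E2 by lia.
  replace (ip (legendre (S (S n))) (fun y => y * legendre (S n) y)) with
   (ip (legendre (S n)) (fun y => y * legendre (S (S n)) y)) in E2 by (apply RInt_ext_R; intros; ring).
  revert E1 E2. rewrite !S_INR. pose proof (pos_INR n). set (N := INR n) in *.
  generalize (ip (legendre (S n)) (fun y => y * legendre (S (S n)) y)) (ip (legendre (S (S n))) (legendre (S (S n)))).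
  intros u v E1 E2.
  assert (Eu : u = (N + 1 + 1) * (2 / (2 * (N + 1) + 1)) / (2 * (N + 1 + 1) + 1)).
  { apply (Rmult_eq_reg_l (2 * (N + 1 + 1) + 1)); [| lra].
    transitivity ((N + 1 + 1) * (2 / (2 * (N + 1) + 1))); [lra | field; lra]. }
  apply (Rmult_eq_reg_l (N + 1 + 1)); [| lra]. rewrite E1, Eu. field; lra.
Qed.

Definition lcoef (g : R -> R) (n : nat) : R := (2 * INR n + 1) / 2 * ip g (legendre n).

Definition lsum (g : R -> R) (N : nat) (y : R) : R :=
  sum_f_R0 (fun n => lcoef g n * legendre n y) N.

(** The span of the Legendre polynomials of degree at most [N], presented by its closure properties:
    what holds for the polynomials passes to the span by induction. *)
Inductive in_span (N : nat) : (R -> R) -> Prop :=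
| span_leg j : (j <= N)%nat -> in_span N (legendre j)
| span_plus f g : in_span N f -> in_span N g -> in_span N (fun y => f y + g y)
| span_scal c f : in_span N f -> in_span N (fun y => c * f y)
| span_ext f g : (forall y, f y = g y) -> in_span N f -> in_span N g.

Lemma in_span_cont N f : in_span N f -> contR f.
Proof.
induction 1 as [j _ | f g _ Hf _ Hg | c f _ Hf | f g E _ Hf].
- prove_cont.
- prove_cont.
- prove_cont.
- intros x. apply (continuous_ext f); [exact E | apply Hf].
Qed.

Lemma in_span_mono N M f : (N <= M)%nat -> in_span N f -> in_span M f.
Proof.
intros HNM; induction 1.
- apply span_leg; lia.
- now apply span_plus.
- now apply span_scal.
- now apply (span_ext M f).
Qed.

Lemma in_span_mult_id N f : in_span N f -> in_span (S N) (fun y => y * f y).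
Proof.
induction 1 as [j Hj | f g _ Hf _ Hg | c f _ Hf | f g E _ Hf].
- destruct j as [|j].
  + apply (span_ext _ (legendre 1)); [intros; simpl; ring | apply span_leg; lia].
  + assert (HN : 2 * INR (S j) + 1 <> 0) by (pose proof (pos_INR (S j)); lra).
    apply (span_ext _ (fun y => INR (S (S j)) / (2 * INR (S j) + 1) * legendre (S (S j)) y
        + INR (S j) / (2 * INR (S j) + 1) * legendre j y)).
    * intros y. unfold Rdiv. rewrite 2!(Rmult_comm (INR _) (/ _)), 2!Rmult_assoc, bonnet. field. exact HN.
    * apply span_plus; apply span_scal, span_leg; lia.
- apply (span_ext _ (fun y => y * f y + y * g y)); [intros; ring | now apply span_plus].
- apply (span_ext _ (fun y => c * (y * f y))); [intros; ring | now apply span_scal].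
- apply (span_ext _ (fun y => y * f y)); [intros; now rewrite E | exact Hf].
Qed.

Lemma in_span_monomial k : in_span k (fun y => y ^ k).
Proof.
induction k as [|k IH]; simpl.
- now apply (span_leg 0 0).
- now apply in_span_mult_id.
Qed.

Lemma in_span_lsum g N : in_span N (lsum g N).
Proof.
induction N as [|N IH]; unfold lsum; simpl.
- apply span_scal. now apply (span_leg 0 0).
- apply (span_plus (S N) (lsum g N) (fun y => lcoef g (S N) * legendre (S N) y)).
  + now apply (in_span_mono N); [lia |].
  + apply span_scal, span_leg; lia.
Qed.

Lemma in_span_orth N f g : cont g -> in_span N f ->
  (forall j, (j <= N)%nat -> ip g (legendre j) = 0) -> ip g f = 0.
Proof.
intros Cg H Hj. induction H as [j HjN | f1 f2 H1 IH1 H2 IH2 | c f1 H1 IH1 | f1 f2 E H1 IH1].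
- now apply Hj.
- rewrite ip_plus_r, IH1, IH2; try ring; try assumption; now apply (in_span_cont N).
- rewrite ip_scal_r, IH1; try ring; try assumption; now apply (in_span_cont N).
- rewrite <- IH1. apply ip_ext; auto.
Qed.

Lemma ip_lsum_gt g N j : (N < j)%nat -> ip (lsum g N) (legendre j) = 0.
Proof.
intros Hj. rewrite ip_comm. apply (in_span_orth N); [apply cont_legendre | apply in_span_lsum |].
intros i Hi. apply ip_legendre_neq; lia.
Qed.

Lemma ip_lsum_le g N j : (j <= N)%nat -> ip (lsum g N) (legendre j) = ip g (legendre j).
Proof.
assert (C := cont_legendre).
assert (HS : forall N, contR (lsum g N)).
{ intros M; apply (in_span_cont M), in_span_lsum. }
assert (D : forall n, lcoef g n * ip (legendre n) (legendre n) = ip g (legendre n)).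
{ intros n. rewrite ip_legendre_eq. unfold lcoef. pose proof (pos_INR n). field; lra. }
induction N as [|N IH]; intros Hj.
- replace j with 0%nat by lia. change (lsum g 0) with (fun y => lcoef g 0 * legendre 0 y).
  rewrite ip_scal by apply C. apply D.
- transitivity (ip (fun y => lsum g N y + lcoef g (S N) * legendre (S N) y) (legendre j)).
  { apply ip_ext; reflexivity. }
  rewrite ip_plus by prove_cont.
  rewrite ip_scal by apply C.
  destruct (Nat.eq_dec j (S N)) as [-> | E].
  + rewrite ip_lsum_gt by lia. rewrite D. ring.
  + rewrite IH by lia. rewrite ip_legendre_neq by lia. ring.
Qed.

Lemma cont_lsum g N : contR (lsum g N).
Proof. apply (in_span_cont N), in_span_lsum. Qed.
#[global] Hint Resolve cont_lsum : cont.

Lemma lcoef_ext f g n : (forall y, f y = g y) -> lcoef f n = lcoef g n.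
Proof. intros E. unfold lcoef. f_equal. apply ip_ext; auto. Qed.

Lemma in_span_lsum_id N f y : in_span N f -> lsum f N y = f y.
Proof.
assert (C := cont_legendre).
intros H. induction H as [j HjN | f1 f2 H1 IH1 H2 IH2 | c f1 H1 IH1 | f1 f2 E H1 IH1].
- unfold lsum.
  assert (Z : forall n, n <> j -> lcoef (legendre j) n = 0).
  { intros n Hn. unfold lcoef. rewrite ip_legendre_neq by auto. ring. }
  assert (O : lcoef (legendre j) j = 1).
  { unfold lcoef. rewrite ip_legendre_eq. pose proof (pos_INR j). field; lra. }
  assert (L : forall M, (M < j)%nat -> sum_f_R0 (fun n => lcoef (legendre j) n * legendre n y) M = 0).
  { induction M as [|M IHM]; intros HM; simpl; [rewrite Z by lia; ring |].
    rewrite IHM, Z by lia; ring. }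
  induction HjN as [|M HM IHM].
  + destruct j as [|j]; cbn [sum_f_R0]; rewrite O; [simpl; ring |]. rewrite L by lia. ring.
  + cbn [sum_f_R0]. rewrite IHM, Z by lia. ring.
- rewrite <- IH1, <- IH2. unfold lsum. rewrite <- plus_sum. apply sum_eq. intros i _.
  unfold lcoef. rewrite ip_plus by (try apply C; now apply (in_span_cont N)). ring.
- rewrite <- IH1. unfold lsum. rewrite scal_sum. apply sum_eq. intros i _.
  unfold lcoef. rewrite ip_scal by (try apply C; now apply (in_span_cont N)). ring.
- rewrite <- E, <- IH1. unfold lsum. apply sum_eq. intros i _. now rewrite (lcoef_ext f2 f1).
Qed.

Lemma ip_self_nonneg f : cont f -> 0 <= ip f f.
Proof.
intros Hf. apply RInt_ge_0; [lra | now apply ex_RInt_cont, cont_Rmult |].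
intros; apply Rle_0_sqr.
Qed.

Lemma ip_minus_self f g : cont f -> cont g ->
  ip (fun y => f y - g y) (fun y => f y - g y) = ip f f - 2 * ip f g + ip g g.
Proof.
intros Hf Hg.
assert (Hg' : contR (fun y : R => -1 * g y)) by prove_cont.
transitivity (ip (fun y => f y + -1 * g y) (fun y => f y + -1 * g y)).
- apply ip_ext; intros; ring.
- rewrite ip_plus by (try assumption; now apply cont_Rplus).
  rewrite 2!ip_plus_r by assumption.
  rewrite !ip_scal_r by assumption. rewrite !ip_scal by assumption.
  rewrite (ip_comm g f). ring.
Qed.

Lemma ip_resid g N j : cont g -> (j <= N)%nat -> ip (fun y => g y - lsum g N y) (legendre j) = 0.
Proof.
intros Hg Hj. assert (C := cont_legendre). assert (HS := cont_lsum g N).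
transitivity (ip (fun y => g y + -1 * lsum g N y) (legendre j)).
- apply ip_ext; intros; ring.
- rewrite ip_plus by prove_cont.
  rewrite ip_scal by (try assumption; apply C). rewrite ip_lsum_le by exact Hj. ring.
Qed.

(** Pythagoras: the residual of [lsum] is orthogonal to the span, in particular to
    [p - lsum g N]. *)
Lemma lsum_best g N p : cont g -> in_span N p ->
  ip (fun y => g y - lsum g N y) (fun y => g y - lsum g N y)
  <= ip (fun y => g y - p y) (fun y => g y - p y).
Proof.
intros Hg Hp.
assert (HS := cont_lsum g N). assert (Cp := in_span_cont N p Hp).
set (r := fun y => g y - lsum g N y).
assert (Cr : contR r) by now apply cont_Rminus.
set (w := fun y => p y + -1 * lsum g N y).
assert (Hw : in_span N w).
{ apply span_plus; [exact Hp |]. apply span_scal, in_span_lsum. }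
assert (Cw := in_span_cont N w Hw).
assert (O : ip r w = 0).
{ apply (in_span_orth N); auto. intros j Hj. now apply ip_resid. }
assert (E : ip (fun y => g y - p y) (fun y => g y - p y) = ip (fun y => r y - w y) (fun y => r y - w y)).
{ apply ip_ext; intros; unfold r, w; ring. }
rewrite E, (ip_minus_self r w), O by assumption. change (ip r r <= ip r r - 2 * 0 + ip w w).
pose proof (ip_self_nonneg w Cw). lra.
Qed.

(** ** Polynomial approximation *)

(** The Bernstein operator on [-1,1]: the expectation of [phi (k + X)], where [X] counts the
    successes among [n] independent trials of probability [(1+y)/2]. *)
Fixpoint bern (n : nat) (phi : nat -> R) (k : nat) (y : R) : R :=
  match n with
  | O => phi k
  | S m => (1 + y) / 2 * bern m phi (S k) y + (1 - y) / 2 * bern m phi k y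
  end.

Lemma in_span_bern n phi k : in_span n (bern n phi k).
Proof.
revert k; induction n as [|n IH]; intros k; simpl.
- apply (span_ext _ (fun y => phi k * legendre 0 y)); [intros; simpl; ring |].
  now apply span_scal, span_leg.
- apply (span_ext _ (fun y => / 2 * bern n phi (S k) y + / 2 * bern n phi k y
     + (/ 2 * (y * bern n phi (S k) y) + - / 2 * (y * bern n phi k y)))); [intros; field |].
  apply span_plus; apply span_plus; apply span_scal;
    try (apply in_span_mult_id; apply IH); apply (in_span_mono n); (lia || apply IH).
Qed.

Lemma bern_le n phi psi k y : -1 <= y <= 1 ->
  (forall j, (k <= j <= k + n)%nat -> phi j <= psi j) -> bern n phi k y <= bern n psi k y.
Proof.
intros Hy. revert k; induction n as [|n IH]; intros k H; simpl.
- apply H; lia.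
- apply Rplus_le_compat; (apply Rmult_le_compat_l; [lra |]); apply IH; intros; apply H; lia.
Qed.

Lemma bern_affine n phi a c k y :
  bern n (fun j => a + c * phi j) k y = a + c * bern n phi k y.
Proof.
revert k; induction n as [|n IH]; intros k; simpl; [ring |]. rewrite 2!IH. field.
Qed.

(** Squared bias plus the variance [n p (1 - p)] of the number of successes, [p = (1+y)/2]. *)
Lemma bern_variance n k y c :
  bern n (fun j => (INR j - c) ^ 2) k y
  = (INR k + INR n * ((1 + y) / 2) - c) ^ 2 + INR n * ((1 - y ^ 2) / 4).
Proof.
revert k; induction n as [|n IH]; intros k; [simpl; ring |].
rewrite (S_INR n). simpl bern. rewrite 2!IH, S_INR. field.
Qed.

(** Bernstein's proof: with high probability the proportion of successes is close to its mean.
    Uniform continuity bounds the oscillation of [g] between close points by [eps / 2], and a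
    multiple of the squared distance bounds it between the others; the expectation of the latter is
    a variance, which tends to 0. *)
Lemma weierstrass g eps : contR g -> 0 < eps ->
  exists N p, in_span N p /\ forall y, -1 <= y <= 1 -> Rabs (g y - p y) <= eps.
Proof.
intros Hg He.
assert (Hc : forall y, continuity_pt g y) by (intros y; apply continuity_pt_filterlim, Hg).
assert (He2 : 0 < eps / 2) by lra.
destruct (Heine_cor2 (f := g) (a := -1) (b := 1) (fun y _ => Hc y) (mkposreal _ He2)) as [d Hd].
destruct (continuity_ab_maj (fun y => Rabs (g y)) (-1) 1 ltac:(lra)) as [ym [Hm _]].
{ intros y _. apply continuity_pt_filterlim. apply (continuous_comp g Rabs); [apply Hg | apply continuous_Rabs]. }
set (M := Rabs (g ym)) in *.
assert (HM : 0 <= M) by apply Rabs_pos.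
pose proof (cond_pos d) as Hd0.
assert (Hloc : forall t y, -1 <= t <= 1 -> -1 <= y <= 1 ->
   Rabs (g t - g y) <= eps / 2 + 2 * M / d ^ 2 * (t - y) ^ 2).
{ intros t y Ht Hy.
  assert (0 <= 2 * M / d ^ 2) by (apply Rdiv_le_0_compat; nra).
  destruct (Rlt_dec (Rabs (t - y)) d) as [L | L].
  - specialize (Hd t y Ht Hy L). simpl in Hd. pose proof (pow2_ge_0 (t - y)). nra.
  - assert (Rabs (g t - g y) <= 2 * M).
    { eapply Rle_trans; [apply Rabs_triang |]. rewrite Rabs_Ropp.
      pose proof (Hm t Ht); pose proof (Hm y Hy); lra. }
    assert (1 * (2 * M) <= ((t - y) ^ 2 / d ^ 2) * (2 * M)).
    { apply Rmult_le_compat_r; [lra |]. apply Rle_div_r; [nra |].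
      rewrite <- (pow2_abs (t - y)). nra. }
    replace (2 * M / d ^ 2 * (t - y) ^ 2) with ((t - y) ^ 2 / d ^ 2 * (2 * M)) by (field; nra).
    lra. }
destruct (nfloor_ex (4 * M / (d ^ 2 * eps) + 1)) as [n [_ Hn]].
{ assert (0 < d ^ 2 * eps) by (apply Rmult_lt_0_compat; [nra | lra]).
  assert (0 <= 4 * M / (d ^ 2 * eps)) by (apply Rdiv_le_0_compat; lra). lra. }
rewrite <- S_INR in Hn.
assert (Hn0 : 0 < INR (S n)) by (apply lt_0_INR; lia).
set (node := fun j : nat => 2 * INR j / INR (S n) - 1).
exists (S n), (bern (S n) (fun j => g (node j)) 0). split; [apply in_span_bern |].
intros y Hy.
assert (Hnode : forall j, (0 <= j <= 0 + S n)%nat -> -1 <= node j <= 1).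
{ intros j Hj. unfold node. pose proof (pos_INR j).
  assert (INR j <= INR (S n)) by (apply le_INR; lia).
  assert (0 <= 2 * INR j / INR (S n)) by (apply Rdiv_le_0_compat; lra).
  assert (2 * INR j / INR (S n) <= 2) by (apply Rle_div_l; lra). lra. }
set (V := fun j : nat => (INR j - INR (S n) * ((1 + y) / 2)) ^ 2).
set (c := 2 * M / d ^ 2 * (4 / INR (S n) ^ 2)).
assert (Hsq : forall j, 2 * M / d ^ 2 * (node j - y) ^ 2 = c * V j).
{ intros j. unfold c, V, node. field. split; lra. }
assert (HV : c * bern (S n) V 0 y <= eps / 2).
{ unfold V. rewrite bern_variance. change (INR 0) with 0.
  replace ((0 + INR (S n) * ((1 + y) / 2) - INR (S n) * ((1 + y) / 2)) ^ 2) with 0 by ring.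
  unfold c.
  replace (2 * M / d ^ 2 * (4 / INR (S n) ^ 2) * (0 + INR (S n) * ((1 - y ^ 2) / 4)))
    with ((2 * M / d ^ 2) * (1 - y ^ 2) / INR (S n)) by (field; split; lra).
  apply Rle_div_l; [exact Hn0 |].
  assert (0 <= 2 * M / d ^ 2) by (apply Rdiv_le_0_compat; nra).
  apply Rle_trans with (2 * M / d ^ 2); [pose proof (pow2_ge_0 y); nra |].
  apply Rle_trans with (eps / 2 * (4 * M / (d ^ 2 * eps))); [right; field; split; lra |].
  apply Rmult_le_compat_l; lra. }
assert (U : bern (S n) (fun j => g (node j)) 0 y <= g y + eps / 2 + c * bern (S n) V 0 y).
{ rewrite <- bern_affine. apply bern_le; [exact Hy |]. intros j Hj.
  specialize (Hloc (node j) y (Hnode j Hj) Hy). rewrite Hsq in Hloc.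
  apply Rabs_le_between in Hloc. lra. }
assert (L : g y - eps / 2 + - c * bern (S n) V 0 y <= bern (S n) (fun j => g (node j)) 0 y).
{ rewrite <- bern_affine. apply bern_le; [exact Hy |]. intros j Hj.
  specialize (Hloc (node j) y (Hnode j Hj) Hy). rewrite Hsq in Hloc.
  apply Rabs_le_between in Hloc. lra. }
apply Rabs_le; lra.
Qed.

(** ** Uniform convergence of the Legendre series of a continuously differentiable function *)

Definition resid (g : R -> R) (N : nat) (y : R) : R := g y - lsum g N y.

Lemma cont_resid (g : R -> R) N : contR g ->
  contR (resid g N).
Proof. intros Hg; apply cont_Rminus; [exact Hg | apply cont_lsum]. Qed.

Lemma ip_le (f1 f2 g1 g2 : R -> R) :
  contR f1 -> contR f2 ->
  contR g1 -> contR g2 ->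
  (forall y, -1 <= y <= 1 -> f1 y * g1 y <= f2 y * g2 y) -> ip f1 g1 <= ip f2 g2.
Proof.
intros. apply RInt_le; [lra | | |]; try (apply ex_RInt_cont; now apply cont_Rmult).
intros; apply H3; lra.
Qed.

Lemma ip_cst c : ip (fun _ => c) (fun _ => 1) = 2 * c.
Proof.
unfold ip. rewrite RInt_const. unfold scal; simpl; unfold mult; simpl; ring.
Qed.

Lemma mean_convergence (g : R -> R) s : contR g -> 0 < s ->
  exists N0, forall N, (N0 <= N)%nat -> ip (resid g N) (resid g N) <= s ^ 2.
Proof.
intros Hg Hs. destruct (weierstrass g (s / 2) Hg ltac:(lra)) as (N0 & p & Hp & Hb).
exists N0. intros N HN.
eapply Rle_trans; [apply (lsum_best g N p Hg); now apply (in_span_mono N0) |].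
assert (Cp := in_span_cont N0 p Hp).
apply Rle_trans with (ip (fun _ => (s / 2) ^ 2) (fun _ => 1)).
- apply ip_le; try apply cont_const; try now apply cont_Rminus.
  intros y Hy. specialize (Hb y Hy). apply Rabs_le_between in Hb. nra.
- rewrite ip_cst. nra.
Qed.

(** The Cauchy-Schwarz inequality, in the form given by [0 <= ip (f - s g) (f - s g)]. *)
Lemma ip_amgm (f g : R -> R) s : contR f ->
  contR g -> 0 < s ->
  ip f f <= s ^ 2 -> ip g g <= 2 -> ip f g <= 2 * s.
Proof.
intros Hf Hg Hs H1 H2.
assert (Csg : contR (fun y : R => s * g y)) by prove_cont.
assert (P := ip_self_nonneg (fun y => f y - s * g y) ltac:(now apply cont_Rminus)).
rewrite ip_minus_self, ip_scal_r, ip_scal, ip_scal_r in P by assumption.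
assert (s * (s * ip g g) <= s * (s * 2)) by (repeat apply Rmult_le_compat_l; lra).
apply (Rmult_le_reg_l s); nra.
Qed.

Lemma ip_legendre_le n : ip (legendre n) (legendre n) <= 2.
Proof.
rewrite ip_legendre_eq. pose proof (pos_INR n). apply Rle_div_l; lra.
Qed.

Lemma ip_opp (f g : R -> R) : contR f ->
  contR g -> ip f (fun y => - g y) = - ip f g.
Proof.
intros Hf Hg. transitivity (ip f (fun y => -1 * g y)); [apply ip_ext; intros; ring |].
rewrite ip_scal_r by assumption. ring.
Qed.

(** Beyond [N] the residual has the coefficients of [g] itself, and these are bounded by its
    norm. *)
Lemma ip_legendre_small (g : R -> R) s N n : contR g -> 0 < s ->
  ip (resid g N) (resid g N) <= s ^ 2 -> (N < n)%nat -> Rabs (ip g (legendre n)) <= 2 * s.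
Proof.
intros Hg Hs Hr Hn.
assert (C := cont_legendre). assert (Cr := cont_resid g N Hg).
assert (E : ip (resid g N) (legendre n) = ip g (legendre n)).
{ transitivity (ip (fun y => g y + -1 * lsum g N y) (legendre n)).
  - apply ip_ext; intros; unfold resid; ring.
  - rewrite ip_plus by prove_cont.
    rewrite ip_scal by prove_cont. rewrite ip_lsum_gt by exact Hn. ring. }
rewrite <- E. apply Rabs_le. split.
- enough (- ip (resid g N) (legendre n) <= 2 * s) by lra.
  rewrite <- ip_opp by (assumption || apply C).
  apply ip_amgm; try assumption; [apply cont_Ropp, C |].
  apply Rle_trans with (2 := ip_legendre_le n). right. apply RInt_ext_R; intros; ring.
- apply ip_amgm; try assumption; [apply C | apply ip_legendre_le].
Qed.

(** Integration by parts against [(2n+3) P_(n+1) = (P_(n+2) - P_n)']; there are no boundary terms,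
    since [P_n] and [P_(n+2)] agree at both end points. *)
Lemma lcoef_derive (g dg : R -> R) n :
  (forall y, is_derive g y (dg y)) -> contR dg ->
  lcoef g (S n) = / 2 * (ip dg (legendre n) - ip dg (legendre (S (S n)))).
Proof.
intros Hd Hdg. assert (C := cont_legendre).
assert (Hg := cont_of_derive _ _ Hd).
set (Q := fun y => legendre (S (S n)) y + -1 * legendre n y).
assert (CQ : contR Q).
{ apply cont_Rplus; [apply C |]. prove_cont. }
assert (Csn : contR (fun y : R => (2 * INR (S n) + 1) * legendre (S n) y)) by prove_cont.
assert (DQ : forall y, is_derive Q y ((2 * INR (S n) + 1) * legendre (S n) y)).
{ intros y. rewrite <- dlegendre_diff. evar_last.
  - apply (is_derive_plus (legendre (S (S n))) (fun y => -1 * legendre n y)).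
    + apply is_derive_legendre.
    + apply (is_derive_scal (legendre n)). apply is_derive_legendre.
  - unfold plus; simpl. change (dlegendre (S (S n)) y + -1 * dlegendre n y = dlegendre (S (S n)) y - dlegendre n y). ring. }
assert (E : ip dg Q + ip g (fun y => (2 * INR (S n) + 1) * legendre (S n) y) = 0).
{ unfold ip. rewrite <- (RInt_plus (fun y => dg y * Q y)) by (apply ex_RInt_cont; prove_cont).
  rewrite (RInt_FTC (fun y => g y * Q y)); [| | prove_cont].
  - unfold Q. rewrite 2!legendre_1, 2!legendre_m1. simpl. ring.
  - intros y. apply (is_derive_mult (K := R_AbsRing) g Q); [apply Hd | apply DQ | exact Rmult_comm]. }
rewrite ip_scal_r in E by (assumption || apply C).
unfold Q in E. rewrite ip_plus_r, ip_scal_r in E by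
  first [assumption | apply C | apply cont_Rmult; [apply cont_const | apply C]].
unfold lcoef. lra.
Qed.

(** The partial sums of the derivative are, up to two boundary terms, the derivatives of the
    partial sums. *)
Lemma is_derive_lsum (g dg : R -> R) N y :
  (forall y, is_derive g y (dg y)) -> contR dg ->
  is_derive (fun y => lsum g N y + / 2 * ip dg (legendre N) * legendre (S N) y
    + / 2 * ip dg (legendre (S N)) * legendre N y) y (lsum dg N y).
Proof.
intros Hd Hdg.
assert (D : forall M z, is_derive (lsum g M) z (sum_f_R0 (fun n => lcoef g n * dlegendre n z) M)).
{ intros M z. induction M as [|M IH].
  - apply (is_derive_scal (legendre 0)). apply is_derive_legendre.
  - apply (is_derive_plus (V := R_NormedModule) (lsum g M) (fun y => lcoef g (S M) * legendre (S M) y)).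
    + exact IH.
    + apply (is_derive_scal (legendre (S M))). apply is_derive_legendre. }
evar_last.
- apply (is_derive_plus (V := R_NormedModule) (fun y => lsum g N y + / 2 * ip dg (legendre N) * legendre (S N) y)
    (fun y => / 2 * ip dg (legendre (S N)) * legendre N y)).
  + apply (is_derive_plus (V := R_NormedModule) (lsum g N) (fun y => / 2 * ip dg (legendre N) * legendre (S N) y)).
    * apply D.
    * apply (is_derive_scal (legendre (S N))). apply is_derive_legendre.
  + apply (is_derive_scal (legendre N)). apply is_derive_legendre.
- change (sum_f_R0 (fun n => lcoef g n * dlegendre n y) N + / 2 * ip dg (legendre N) * dlegendre (S N) y
     + / 2 * ip dg (legendre (S N)) * dlegendre N y = lsum dg N y).
  induction N as [|N IH].
  + unfold lsum, lcoef; simpl. field.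
  + unfold lsum. cbn [sum_f_R0]. fold (lsum dg N y). rewrite <- IH.
    rewrite (lcoef_derive g dg N Hd Hdg). unfold lcoef.
    replace ((2 * INR (S N) + 1) / 2 * ip dg (legendre (S N)) * legendre (S N) y)
     with (/ 2 * ip dg (legendre (S N)) * ((2 * INR (S N) + 1) * legendre (S N) y)) by field.
    rewrite <- dlegendre_diff. field.
Qed.

Lemma RInt_abs_le (r : R -> R) s a b : contR r -> 0 < s ->
  ip r r <= s ^ 2 -> -1 <= a -> a <= b -> b <= 1 -> Rabs (RInt r a b) <= 2 * s.
Proof.
intros Cr Hs Hr Ha Hab Hb.
assert (Ca : contR (fun y : R => Rabs (r y))).
{ apply (cont_comp Rabs r); [intros x; apply continuous_Rabs | exact Cr]. }
assert (EX : forall u v, ex_RInt (fun y => Rabs (r y)) u v) by (intros; now apply ex_RInt_cont).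
apply Rle_trans with (RInt (fun y => Rabs (r y)) a b).
{ apply abs_RInt_le; [exact Hab | now apply ex_RInt_cont]. }
apply Rle_trans with (ip (fun y => Rabs (r y)) (fun _ => 1)).
- assert (E : ip (fun y => Rabs (r y)) (fun _ => 1) = RInt (fun y => Rabs (r y)) (-1) 1).
  { apply RInt_ext_R; intros; ring. }
  rewrite E.
  rewrite <- (RInt_Chasles (fun y => Rabs (r y)) (-1) a 1) by apply EX.
  rewrite <- (RInt_Chasles (fun y => Rabs (r y)) a b 1) by apply EX.
  assert (P1 : 0 <= RInt (fun y => Rabs (r y)) (-1) a) by (apply RInt_ge_0; auto; intros; apply Rabs_pos).
  assert (P2 : 0 <= RInt (fun y => Rabs (r y)) b 1) by (apply RInt_ge_0; auto; intros; apply Rabs_pos).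
  unfold plus; simpl. lra.
- apply ip_amgm; try assumption; [apply cont_const | |].
  + eapply Rle_trans; [| exact Hr]. right. apply RInt_ext_R; intros x _.
    rewrite <- Rabs_mult. apply Rabs_pos_eq, Rle_0_sqr.
  + rewrite ip_cst. lra.
Qed.

(** The derivative of the residual of [g] is the residual of [g'] up to two boundary terms. The
    first is small in the mean and the others have small coefficients, so the residual of [g]
    oscillates little; being orthogonal to the constants, it has mean value 0, and therefore it is
    small everywhere. *)
Lemma lsum_uniform (g dg : R -> R) eps :
  (forall y, is_derive g y (dg y)) -> contR dg -> 0 < eps ->
  exists N0, forall N, (N0 <= N)%nat -> forall y, -1 <= y <= 1 -> Rabs (g y - lsum g N y) <= eps.
Proof.
intros Hd Hdg He. assert (C := cont_legendre).
assert (Hg := cont_of_derive _ _ Hd).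
set (s := eps / 6). assert (Hs : 0 < s) by (unfold s; lra).
destruct (mean_convergence dg s Hdg Hs) as [N0 H0].
exists (S N0). intros N HN.
assert (HR := H0 N ltac:(lia)).
assert (S1 := ip_legendre_small dg s N0 N Hdg Hs (H0 N0 ltac:(lia)) ltac:(lia)).
assert (S2 := ip_legendre_small dg s N0 (S N) Hdg Hs (H0 N0 ltac:(lia)) ltac:(lia)).
set (d1 := ip dg (legendre N)) in *. set (d2 := ip dg (legendre (S N))) in *.
assert (Osc : forall y z, -1 <= z -> z <= y -> y <= 1 -> Rabs (resid g N y - resid g N z) <= eps).
{ intros y z Hz Hzy Hy.
  assert (F : RInt (resid dg N) z y =
    (resid g N y - resid g N z) - / 2 * d1 * (legendre (S N) y - legendre (S N) z)
     - / 2 * d2 * (legendre N y - legendre N z)).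
  { rewrite (RInt_FTC (fun y => g y - (lsum g N y + / 2 * d1 * legendre (S N) y + / 2 * d2 * legendre N y))).
    - unfold resid, minus, plus, opp; simpl. ring.
    - intros t. apply (is_derive_minus (V := R_NormedModule) g); [apply Hd | now apply is_derive_lsum].
    - now apply cont_resid. }
  assert (B := RInt_abs_le (resid dg N) s z y (cont_resid dg N Hdg) Hs HR Hz Hzy Hy).
  assert (B1 : forall n, Rabs (legendre n y - legendre n z) <= 2).
  { intros n. eapply Rle_trans; [apply Rabs_triang |]. rewrite Rabs_Ropp.
    assert (A1 := legendre_bound n y ltac:(lra)). assert (A2 := legendre_bound n z ltac:(lra)). lra. }
  assert (B2 : forall d l, Rabs d <= 2 * s -> Rabs l <= 2 -> Rabs (/ 2 * d * l) <= 2 * s).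
  { intros d l H1 H2. rewrite 2!Rabs_mult, (Rabs_pos_eq (/ 2)) by lra.
    pose proof (Rabs_pos d); pose proof (Rabs_pos l). 
    apply Rle_trans with (/ 2 * (2 * s) * 2); [| lra].
    apply Rmult_le_compat; try lra. }
  assert (B3 := B2 _ _ S1 (B1 (S N))). assert (B4 := B2 _ _ S2 (B1 N)).
  rewrite F in B. apply Rabs_le_between in B, B3, B4. apply Rabs_le. unfold s in *. lra. }
assert (Osc2 : forall y z, -1 <= z <= 1 -> -1 <= y <= 1 -> Rabs (resid g N y - resid g N z) <= eps).
{ intros y z Hz Hy. destruct (Rle_dec z y); [apply Osc; lra |].
  rewrite Rabs_minus_sym. apply Osc; lra. }
assert (Z : ip (resid g N) (fun _ => 1) = 0).
{ rewrite <- (ip_resid g N 0) by (assumption || lia). reflexivity. }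
assert (Cr := cont_resid g N Hg).
intros y Hy. change (Rabs (resid g N y) <= eps).
apply Rabs_le. split.
- enough (ip (resid g N) (fun _ => 1) <= ip (fun _ => resid g N y + eps) (fun _ => 1)) as W
    by (rewrite Z, ip_cst in W; lra).
  apply ip_le; try apply cont_const; try assumption. intros z Hz.
  assert (O := Osc2 y z Hz Hy). apply Rabs_le_between in O. lra.
- enough (ip (fun _ => resid g N y - eps) (fun _ => 1) <= ip (resid g N) (fun _ => 1)) as W
    by (rewrite Z, ip_cst in W; lra).
  apply ip_le; try apply cont_const; try assumption. intros z Hz.
  assert (O := Osc2 y z Hz Hy). apply Rabs_le_between in O. lra.
Qed.

(** * The Gamma function at the half-integers *)

Definition gauss (x : R) : R := RInt (fun s => exp (- s ^ 2)) 0 x.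

(** A parametric integral whose derivative is opposite to that of [gauss^2], and which tends
    to 0. *)
Definition gauss_defect (x : R) : R := RInt (fun t => exp (- (x ^ 2 * (1 + t ^ 2))) / (1 + t ^ 2)) 0 1.

Lemma cont_gauss_integrand : contR (fun s : R => exp (- s ^ 2)).
Proof. apply (cont_of_ex_derive (fun s => exp (- s ^ 2))). intros x; auto_derive; trivial. Qed.

Lemma is_derive_gauss (x : R) : is_derive gauss x (exp (- x ^ 2)).
Proof.
apply (is_derive_RInt (V := R_NormedModule) (fun s => exp (- s ^ 2)) gauss 0 x).
- apply filter_forall. intros y. apply (RInt_correct (V := R_CompleteNormedModule)).
  apply ex_RInt_cont, cont_gauss_integrand.
- apply cont_gauss_integrand.
Qed.

Lemma cont_exp {T : UniformSpace} (f : T -> R) :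
  contR f -> contR (fun p => exp (f p)).
Proof. intros H; apply (cont_comp exp f); [intros x; apply continuous_exp | exact H]. Qed.

Lemma is_derive_gauss_defect (x : R) : is_derive gauss_defect x (- (2 * exp (- x ^ 2) * gauss x)).
Proof.
pose (df := fun x t : R => -2 * x * exp (- (x ^ 2 * (1 + t ^ 2)))).
assert (HE : forall p : R * R, cont (fun p : R2 => exp (- (fst p ^ 2 * (1 + snd p ^ 2))) : R_UniformSpace)).
{ intros _. apply cont_exp. apply cont_Ropp. apply cont_Rmult.
  - prove_cont.
  - prove_cont. }
evar_last.
- apply (leibniz_R (fun x t => exp (- (x ^ 2 * (1 + t ^ 2))) / (1 + t ^ 2)) df 0 (fun _ => 1) x 0).
  + intros y t. unfold df. auto_derive; [trivial |]. simpl pow; field; nra.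
  + apply cont_2d. apply cont_Rmult; [apply (HE (0, 0)) |].
    intros p. apply (continuous_comp (fun p : R2 => 1 + snd p ^ 2 : R_UniformSpace) Rinv).
    * apply (cont_Rplus (fun _ => 1) (fun p => snd p ^ 2)); [apply cont_const |].
      prove_cont.
    * apply continuous_Rinv. nra.
  + apply cont_2d. apply cont_Rmult; [| apply (HE (0, 0))].
    prove_cont.
  + apply (is_derive_const (K := R_AbsRing) (V := R_NormedModule)).
- assert (Ce : contR (fun t : R => exp (- t ^ 2))) by apply cont_gauss_integrand.
  assert (E : RInt (fun y => x * exp (- (x * y + 0) ^ 2)) 0 1 = gauss x).
  { assert (E := RInt_comp_lin (V := R_CompleteNormedModule) (fun s => exp (- s ^ 2)) x 0 0 1 (ex_RInt_cont _ _ _ Ce)).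
    replace (x * 0 + 0) with 0 in E by ring. replace (x * 1 + 0) with x in E by ring. exact E. }
  rewrite <- E.
  transitivity (RInt (df x) 0 1); [ring |].
  transitivity (-2 * exp (- x ^ 2) * RInt (fun y => x * exp (- (x * y + 0) ^ 2)) 0 1); [| ring].
  rewrite <- (RInt_scal (V := R_CompleteNormedModule) (fun y => x * exp (- (x * y + 0) ^ 2))).
  + apply RInt_ext_R. intros t _. unfold df, scal; simpl; unfold mult; simpl.
    transitivity (-2 * x * (exp (- x ^ 2) * exp (- (x * t + 0) ^ 2))); [| simpl; ring].
    rewrite <- exp_plus. f_equal. f_equal. ring.
  + apply ex_RInt_cont. apply (cont_Rmult (fun _ => x)); [apply cont_const |].
    apply (cont_of_ex_derive (fun y => exp (- (x * y + 0) ^ 2))). intros y; auto_derive; trivial.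
Qed.

Lemma gauss_sq x : gauss x ^ 2 = PI / 4 - gauss_defect x.
Proof.
assert (D : forall y, is_derive (fun x => gauss x ^ 2 + gauss_defect x) y 0).
{ intros y. evar_last.
  - apply (is_derive_plus (fun x => gauss x ^ 2) gauss_defect); [| apply is_derive_gauss_defect].
    apply (is_derive_pow gauss 2), is_derive_gauss.
  - unfold plus; simpl. ring. }
assert (E0 : gauss_defect 0 = PI / 4).
{ transitivity (atan 1 - atan 0); [| rewrite atan_0, atan_1; ring]. unfold gauss_defect.
  rewrite (RInt_ext_R _ (fun t => / (1 + t ^ 2))).
  - apply RInt_FTC.
    + intros t. replace (t ^ 2) with (Rsqr t) by (unfold Rsqr; ring). apply is_derive_atan.
    + apply (cont_of_ex_derive (fun t => / (1 + t ^ 2))). intros y; auto_derive. nra.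
  - intros t _. replace (- (0 ^ 2 * (1 + t ^ 2))) with 0 by ring. rewrite exp_0. unfold Rdiv; now rewrite Rmult_1_l. }
assert (G0 : gauss 0 = 0) by (apply (RInt_point (V := R_CompleteNormedModule))).
enough (gauss x ^ 2 + gauss_defect x = gauss 0 ^ 2 + gauss_defect 0) by (rewrite G0, E0 in H; lra).
destruct (MVT_gen (fun x => gauss x ^ 2 + gauss_defect x) 0 x (fun _ => 0)) as [c [_ E]].
- intros; apply D.
- intros t _. apply continuity_pt_filterlim.
  exact (cont_of_derive _ _ D t).
- simpl in *; lra.
Qed.

Lemma exp_le x y : x <= y -> exp x <= exp y.
Proof. intros [H | ->]; [now apply Rlt_le, exp_increasing | apply Rle_refl]. Qed.

Lemma gauss_defect_bounds x : 0 <= gauss_defect x <= exp (- x ^ 2).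
Proof.
assert (C : contR (fun t : R => exp (- (x ^ 2 * (1 + t ^ 2))) / (1 + t ^ 2))).
{ apply (cont_of_ex_derive (fun t => exp (- (x ^ 2 * (1 + t ^ 2))) / (1 + t ^ 2))).
  intros t; auto_derive. nra. }
split.
- apply RInt_ge_0; [lra | now apply ex_RInt_cont |]. intros t _.
  apply Rdiv_le_0_compat; [apply Rlt_le, exp_pos | nra].
- apply Rle_trans with (RInt (fun _ => exp (- x ^ 2)) 0 1).
  + apply RInt_le; [lra | now apply ex_RInt_cont | apply ex_RInt_const |].
    intros t _. apply Rle_div_l; [nra |].
    apply Rle_trans with (exp (- x ^ 2) * 1).
    * rewrite Rmult_1_r. apply exp_le. nra.
    * apply Rmult_le_compat_l; [apply Rlt_le, exp_pos | nra].
  + rewrite RInt_const. unfold scal; simpl; unfold mult; simpl. right; ring.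
Qed.

Lemma gauss_lim : is_lim gauss p_infty (sqrt PI / 2).
Proof.
assert (L : is_lim gauss_defect p_infty 0).
{ apply (is_lim_le_le_loc (fun _ => 0) (fun x => exp (- x))).
  - exists 1. intros x Hx. destruct (gauss_defect_bounds x) as [H1 H2]. split; [exact H1 |].
    eapply Rle_trans; [exact H2 |]. apply exp_le. nra.
  - apply is_lim_const.
  - apply (is_lim_comp exp Ropp p_infty 0 m_infty).
    + apply is_lim_exp_m.
    + apply (is_lim_opp (fun x => x) p_infty p_infty), is_lim_id.
    + exists 0; intros; discriminate. }
apply (is_lim_ext_loc (fun x => sqrt (PI / 4 - gauss_defect x))).
- exists 0. intros x Hx. rewrite <- gauss_sq. rewrite <- Rsqr_pow2. apply sqrt_Rsqr.
  apply RInt_ge_0; [lra | apply ex_RInt_cont, cont_gauss_integrand |].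
  intros; apply Rlt_le, exp_pos.
- assert (E : sqrt PI / 2 = sqrt (PI / 4 - 0)).
  { rewrite Rminus_0_r. rewrite sqrt_div by (pose proof PI_RGT_0; lra).
    replace 4 with (2 ^ 2) by ring. rewrite sqrt_pow2 by lra. reflexivity. }
  rewrite E.
  apply (filterlim_comp _ _ _ (fun x => PI / 4 - gauss_defect x) sqrt _ (locally (PI / 4 - 0))).
  + exact (is_lim_minus' (fun _ => PI / 4) gauss_defect p_infty (PI / 4) 0 (is_lim_const _ _) L).
  + apply continuous_sqrt.
Qed.

(** An antiderivative on [(0,oo)] of [t^(k - 1/2) e^(-t)]; the recursion is integration by parts. *)
Fixpoint gamma_prim (k : nat) (t : R) : R :=
  match k with
  | O => 2 * gauss (sqrt t)
  | S m => (INR m + / 2) * gamma_prim m t - t ^ m * sqrt t * exp (- t)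
  end.

Lemma is_derive_gamma_prim k (t : R) : 0 < t ->
  is_derive (gamma_prim k) t (t ^ k / sqrt t * exp (- t)).
Proof.
intros Ht. assert (Hs := sqrt_lt_R0 t Ht). assert (Hss := sqrt_sqrt t (Rlt_le _ _ Ht)).
induction k as [|k IH].
- apply (is_derive_ext (fun t => 2 * gauss (sqrt t))); [reflexivity |].
  evar_last.
  + apply is_derive_scal. apply (is_derive_comp gauss sqrt); [apply is_derive_gauss |].
    apply (is_derive_sqrt (fun t => t)); [apply (is_derive_id (K := R_AbsRing)) | exact Ht].
  + unfold scal, one; simpl; unfold mult; simpl.
    replace (sqrt t * (sqrt t * 1)) with t by lra. field. lra.
- apply (is_derive_ext (fun t => (INR k + / 2) * gamma_prim k t - t ^ k * sqrt t * exp (- t))); [reflexivity |].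
  evar_last.
  + apply (is_derive_minus (fun t => (INR k + / 2) * gamma_prim k t) (fun t => t ^ k * sqrt t * exp (- t))).
    * apply is_derive_scal. exact IH.
    * auto_derive; [exact Ht | reflexivity].
  + unfold minus, plus, opp; simpl.
    assert (E : INR k * t ^ pred k * t = INR k * t ^ k).
    { destruct k as [|k]; [simpl; ring |]. change (pred (S k)) with k. simpl pow. ring. }
    apply (Rmult_eq_reg_r (sqrt t)); [| lra].
    replace (t * t ^ k / sqrt t * exp (- t) * sqrt t) with (t * t ^ k * exp (- t)) by (field; lra).
    transitivity ((INR k + / 2) * t ^ k * exp (- t)
      - (INR k * 1 * t ^ pred k * (sqrt t * sqrt t) + / 2 * t ^ k) * exp (- t)
      + t ^ k * exp (- t) * (sqrt t * sqrt t)); [field; lra |].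
    rewrite Hss. transitivity ((INR k * t ^ k - INR k * t ^ pred k * t) * exp (- t) + t * t ^ k * exp (- t)); [field |].
    rewrite E. ring.
Qed.

Lemma gamma_prim_0 k : filterlim (gamma_prim k) (at_right 0) (locally 0).
Proof.
eapply filterlim_filter_le_1; [apply filter_le_within |].
assert (E : gamma_prim k 0 = 0 /\ continuous (gamma_prim k) 0).
{ assert (S0 : continuous sqrt 0) by apply continuous_sqrt.
  induction k as [|k [IH1 IH2]]; simpl; rewrite sqrt_0.
  - split.
    + unfold gauss. rewrite (RInt_point (V := R_CompleteNormedModule)). unfold zero; simpl; ring.
    + apply (continuous_scal_r (V := R_NormedModule) 2 (fun t => gauss (sqrt t))).
      apply (continuous_comp sqrt gauss); [exact S0 |].
      exact (cont_of_derive _ _ is_derive_gauss (sqrt 0)).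
  - rewrite IH1. split; [ring |].
    apply (continuous_minus (V := R_NormedModule) (fun t => (INR k + / 2) * gamma_prim k t) (fun t => t ^ k * sqrt t * exp (- t))).
    + now apply (continuous_scal_r (V := R_NormedModule) (INR k + / 2) (gamma_prim k)).
    + apply (continuous_mult (K := R_AbsRing) (fun t => t ^ k * sqrt t) (fun t => exp (- t))).
      * apply (continuous_mult (K := R_AbsRing) (fun t => t ^ k) sqrt); [| exact S0].
        apply (cont_of_ex_derive (fun t => t ^ k)). intros; auto_derive; trivial.
      * apply (cont_of_ex_derive (fun t => exp (- t))). intros; auto_derive; trivial. }
destruct E as [E1 E2]. unfold continuous in E2. now rewrite E1 in E2.
Qed.

Lemma gamma_prim_infty k :
  is_lim (gamma_prim (S k)) p_infty (sqrt PI * dfact k / 2 ^ (S k)).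
Proof.
assert (Z : forall m, is_lim (fun t => t ^ m * sqrt t * exp (- t)) p_infty 0).
{ intros m. apply (is_lim_le_le_loc (fun _ => 0) (fun t => INR (fact (m + 2)) * / t)).
  - exists 1. intros t Ht. split.
    + repeat apply Rmult_le_pos; [apply pow_le; lra | apply sqrt_pos | apply Rlt_le, exp_pos].
    + rewrite exp_Ropp. assert (HT := exp_ge_taylor t (m + 2) ltac:(lra)).
      assert (HS : t ^ (m + 2) / INR (fact (m + 2)) <= exp t).
      { eapply Rle_trans; [| exact HT].
        replace (m + 2)%nat with (S (m + 1)) by lia. cbn [sum_f_R0].
        assert (0 <= sum_f_R0 (fun k => t ^ k / INR (fact k)) (m + 1)); [| lra].
        apply cond_pos_sum. intros n. apply Rdiv_le_0_compat; [apply pow_le; lra | apply INR_fact_lt_0]. }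
      assert (HF := INR_fact_lt_0 (m + 2)). assert (He := exp_pos t).
      assert (Hq : sqrt t <= t).
      { rewrite <- (sqrt_Rsqr t) at 2 by lra. apply sqrt_le_1_alt. unfold Rsqr; nra. }
      apply Rle_div_l; [exact He |].
      apply Rle_trans with (INR (fact (m + 2)) * / t * (t ^ (m + 2) / INR (fact (m + 2)))).
      * replace (INR (fact (m + 2)) * / t * (t ^ (m + 2) / INR (fact (m + 2)))) with (t ^ m * t)
          by (rewrite pow_add; field; split; lra).
        apply Rmult_le_compat_l; [apply pow_le; lra | exact Hq].
      * apply Rmult_le_compat_l; [| exact HS]. apply Rmult_le_pos; [lra |].
        apply Rlt_le, Rinv_0_lt_compat; lra.
  - apply is_lim_const.
  - evar_last.
    + apply (is_lim_scal_l Rinv (INR (fact (m + 2))) p_infty 0).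
      apply (is_lim_inv (fun t => t) p_infty p_infty); [apply is_lim_id | discriminate].
    + simpl. now rewrite Rmult_0_r. }
assert (St : forall m l, is_lim (gamma_prim m) p_infty (Finite l) ->
   is_lim (gamma_prim (S m)) p_infty ((INR m + / 2) * l)).
{ intros m l H. evar_last.
  - apply (is_lim_minus' (fun t => (INR m + / 2) * gamma_prim m t) (fun t => t ^ m * sqrt t * exp (- t)) p_infty ((INR m + / 2) * l) 0).
    + apply (is_lim_scal_l (gamma_prim m) (INR m + / 2) p_infty l H).
    + apply Z.
  - f_equal. ring. }
induction k as [|k IH].
- replace (sqrt PI * dfact 0 / 2 ^ 1) with ((INR 0 + / 2) * sqrt PI) by (simpl; field).
  apply St. replace (Finite (sqrt PI)) with (Rbar_mult 2 (sqrt PI / 2)) by (simpl; f_equal; field).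
  apply (is_lim_scal_l (fun t => gauss (sqrt t)) 2 p_infty (sqrt PI / 2)).
  apply (filterlim_comp _ _ _ sqrt gauss _ (Rbar_locally p_infty)); [apply filterlim_sqrt_p | apply gauss_lim].
- replace (sqrt PI * dfact (S k) / 2 ^ S (S k)) with ((INR (S k) + / 2) * (sqrt PI * dfact k / 2 ^ S k)).
  + now apply St.
  + change (dfact (S k)) with ((2 * INR k + 3) * dfact k). rewrite S_INR. simpl pow. field. apply pow_nonzero; lra.
Qed.

Lemma is_RInt_gen_of_primitive (F f : R -> R) la lb :
  (forall t, 0 < t -> is_derive F t (f t)) -> (forall t, 0 < t -> continuous f t) ->
  filterlim F (at_right 0) (locally la) -> filterlim F (Rbar_locally p_infty) (locally lb) ->
  is_RInt_gen f (at_right 0) (Rbar_locally p_infty) (lb - la).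
Proof.
intros Hd Hc Ha Hb P HP.
assert (H1 : filter_prod (at_right 0) (Rbar_locally p_infty) (fun ab => 0 < fst ab /\ 0 < snd ab)).
{ apply (Filter_prod _ _ _ (fun a => 0 < a) (fun b => 0 < b)).
  - exists (mkposreal 1 Rlt_0_1). auto.
  - now exists 0.
  - auto. }
assert (H2 : filter_prod (at_right 0) (Rbar_locally p_infty) (fun ab => P (F (snd ab) - F (fst ab)))).
{ assert (HF : filterlim (fun ab => minus (F (snd ab)) (F (fst ab)))
    (filter_prod (at_right 0) (Rbar_locally p_infty)) (locally (minus lb la))).
  { apply (filterlim_comp_2 (F := filter_prod (at_right 0) (Rbar_locally p_infty))
      (fun ab => F (snd ab)) (fun ab => - F (fst ab)) Rplus
      (G := locally lb) (H := locally (- la))).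
    - eapply filterlim_comp; [apply filterlim_snd | exact Hb].
    - apply (filterlim_comp _ _ _ (fun ab : R * R => F (fst ab)) Ropp _ (locally la)).
      + eapply filterlim_comp; [apply filterlim_fst | exact Ha].
      + apply (filterlim_opp (V := R_NormedModule)).
    - apply (filterlim_plus (V := R_NormedModule)). }
  apply (HF P HP). }
generalize (filter_and _ _ H1 H2). unfold filtermapi. apply filter_imp. intros [a b]; simpl. intros [[Pa Pb] HPab].
exists (F b - F a). split; [| exact HPab].
apply (is_RInt_derive (V := R_CompleteNormedModule) F f); intros x Hx;
  assert (0 < x) by (revert Hx; unfold Rmin; destruct Rle_dec; lra); auto.
Qed.

Lemma Gamma_half k : Gamma (INR k + 3 / 2) = sqrt PI * dfact k / 2 ^ (S k).
Proof.
unfold Gamma. apply (is_RInt_gen_unique (V := R_CompleteNormedModule)).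
assert (E : forall t, 0 < t -> Rpower t (INR k + 3 / 2 - 1) * exp (- t) = t ^ (S k) / sqrt t * exp (- t)).
{ intros t Ht. f_equal. replace (INR k + 3 / 2 - 1) with (INR k + / 2) by field.
  rewrite Rpower_plus, Rpower_pow, Rpower_sqrt by exact Ht.
  assert (Hs := sqrt_lt_R0 t Ht). rewrite <- (sqrt_sqrt t) at 3 by lra. simpl. rewrite sqrt_sqrt by lra.
  rewrite <- (sqrt_sqrt t) at 3 by lra. field. lra. }
apply (is_RInt_gen_ext (V := R_NormedModule) (fun t => t ^ (S k) / sqrt t * exp (- t))).
- apply (Filter_prod _ _ _ (fun a => 0 < a) (fun b => 0 < b)).
  + exists (mkposreal 1 Rlt_0_1). auto.
  + now exists 0.
  + simpl. intros a b Ha Hb x Hx. symmetry; apply E.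
    revert Hx; unfold Rmin; destruct Rle_dec; lra.
- rewrite <- (Rminus_0_r (sqrt PI * dfact k / 2 ^ S k)).
  apply (is_RInt_gen_of_primitive (gamma_prim (S k))).
  + intros t Ht; now apply is_derive_gamma_prim.
  + intros t Ht. apply (ex_derive_continuous (K := R_AbsRing) (V := R_NormedModule)).
    auto_derive. repeat split; try lra. apply Rgt_not_eq, sqrt_lt_R0, Ht.
  + apply gamma_prim_0.
  + apply gamma_prim_infty.
Qed.

(** * Spherical Bessel functions *)

(** ** Complex sequences and series *)

Definition Clim (u : nat -> C) (l : C) : Prop := is_lim_seq (fun n => Cmod (u n - l)%C) 0.

Lemma Clim_bound (u : nat -> C) l (e : nat -> R) :
  (forall n, Cmod (u n - l)%C <= e n) -> is_lim_seq e 0 -> Clim u l.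
Proof.
intros H He. apply (is_lim_seq_le_le (fun _ => 0) _ e); auto.
- intros n; split; [apply Cmod_ge_0 | apply H].
- apply is_lim_seq_const.
Qed.

Lemma Cmod_le_Re_Im z : Cmod z <= Rabs (Re z) + Rabs (Im z).
Proof.
replace z with (RtoC (Re z) + Ci * RtoC (Im z))%C at 1.
- eapply Rle_trans; [apply Cmod_triangle |]. rewrite Cmod_mult, 2!Cmod_R.
  replace (Cmod Ci) with 1; [lra |]. transitivity (sqrt 1); [now rewrite sqrt_1 |].
  unfold Cmod; f_equal; simpl; ring.
- destruct z; apply injective_projections; simpl; ring.
Qed.

Lemma Clim_of_Re_Im (u : nat -> C) l :
  is_lim_seq (fun n => Re (u n)) (Re l) -> is_lim_seq (fun n => Im (u n)) (Im l) -> Clim u l.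
Proof.
intros H1 H2.
assert (D : forall v (m : R), is_lim_seq v m -> is_lim_seq (fun n => Rabs (v n - m)) 0).
{ intros v m Hv. rewrite <- Rabs_R0. apply (is_lim_seq_abs _ 0).
  rewrite <- (Rminus_diag m). apply is_lim_seq_minus'; [exact Hv | apply is_lim_seq_const]. }
apply (Clim_bound _ _ (fun n => Rabs (Re (u n) - Re l) + Rabs (Im (u n) - Im l))).
- intros n. set (z := (u n - l)%C).
  replace (Re (u n) - Re l) with (Re z) by (unfold z, Re, Im; simpl; ring).
  replace (Im (u n) - Im l) with (Im z) by (unfold z, Re, Im; simpl; ring).
  apply Cmod_le_Re_Im.
- rewrite <- (Rplus_0_r 0). apply is_lim_seq_plus'; now apply D.
Qed.

Lemma Clim_unique u l m : Clim u l -> Clim u m -> l = m.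
Proof.
intros H1 H2.
assert (L : is_lim_seq (fun n => Cmod (u n - l)%C + Cmod (u n - m)%C) (0 + 0)) by now apply is_lim_seq_plus'.
rewrite Rplus_0_r in L.
assert (E : Cmod (l - m) <= 0).
{ refine (is_lim_seq_le _ _ (Cmod (l - m)) 0 _ (is_lim_seq_const _) L). intros n.
  rewrite <- (Cmod_opp (u n - l)). replace (l - m)%C with (- (u n - l) + (u n - m))%C by ring.
  apply Cmod_triangle. }
assert (E0 : (l - m)%C = RtoC 0) by (apply Cmod_eq_0; pose proof (Cmod_ge_0 (l - m)); lra).
transitivity (l - m + m)%C; [ring | rewrite E0; ring].
Qed.

Lemma Clim_ext u v l : (forall n, u n = v n) -> Clim u l -> Clim v l.
Proof. intros E; apply is_lim_seq_ext; intros n; now rewrite E. Qed.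

Lemma Clim_scal c u l : Clim u l -> Clim (fun n => c * u n)%C (c * l)%C.
Proof.
intros H. apply (Clim_bound _ _ (fun n => Cmod c * Cmod (u n - l)%C)).
- intros n. rewrite <- Cmod_mult. right. f_equal. ring.
- replace (Finite 0) with (Rbar_mult (Cmod c) 0) by (simpl; now rewrite Rmult_0_r).
  apply is_lim_seq_scal_l, H.
Qed.

Lemma Clim_subseq u l (phi : nat -> nat) :
  Clim u l -> filterlim phi eventually eventually -> Clim (fun n => u (phi n)) l.
Proof. intros H Hp. apply (is_lim_seq_subseq _ _ phi Hp H). Qed.

Lemma Clim_Cmod_le u l B : Clim u l -> (forall n, Cmod (u n) <= B) -> Cmod l <= B.
Proof.
intros H HB.
assert (L : is_lim_seq (fun n => B + Cmod (u n - l)%C) (B + 0)).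
{ apply is_lim_seq_plus'; [apply is_lim_seq_const | exact H]. }
rewrite Rplus_0_r in L.
apply (is_lim_seq_le (fun _ => Cmod l) (fun n => B + Cmod (u n - l)%C) (Cmod l) B); auto.
- intros n. replace l with (u n + - (u n - l))%C at 1 by ring.
  eapply Rle_trans; [apply Cmod_triangle |]. rewrite Cmod_opp. specialize (HB n); lra.
- apply is_lim_seq_const.
Qed.

Lemma Csum_S (a : nat -> C) n : Csum a (S n) = (Csum a n + a (S n))%C.
Proof. apply (sum_Sn (G := C_AbelianGroup)). Qed.

Lemma Csum_O (a : nat -> C) : Csum a 0 = a 0%nat.
Proof. apply (sum_O (G := C_AbelianGroup)). Qed.

Lemma Csum_ext (a c : nat -> C) n : (forall k, (k <= n)%nat -> a k = c k) -> Csum a n = Csum c n.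
Proof. apply (sum_n_ext_loc (G := C_AbelianGroup)). Qed.

Lemma Csum_scal c (a : nat -> C) n : Csum (fun k => c * a k)%C n = (c * Csum a n)%C.
Proof. induction n as [|n IH]; rewrite ?Csum_O, ?Csum_S; [reflexivity | rewrite IH; ring]. Qed.

Lemma Csum_Re (a : nat -> C) n : Re (Csum a n) = sum_f_R0 (fun k => Re (a k)) n.
Proof. induction n as [|n IH]; [now rewrite Csum_O |]. rewrite Csum_S. simpl. now rewrite <- IH. Qed.

Lemma Csum_Im (a : nat -> C) n : Im (Csum a n) = sum_f_R0 (fun k => Im (a k)) n.
Proof. induction n as [|n IH]; [now rewrite Csum_O |]. rewrite Csum_S. simpl. now rewrite <- IH. Qed.

Lemma Csum_Cmod (a : nat -> C) (B : nat -> R) n : (forall k, (k <= n)%nat -> Cmod (a k) <= B k) ->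
  Cmod (Csum a n) <= sum_f_R0 B n.
Proof.
induction n as [|n IH]; intros H; [rewrite Csum_O; now apply H |].
rewrite Csum_S. simpl. eapply Rle_trans; [apply Cmod_triangle |].
apply Rplus_le_compat; [apply IH; intros; apply H; lia | apply H; lia].
Qed.

Lemma Cis_series_of_Clim a l : Clim (Csum a) l -> Cis_series a l.
Proof.
intros H. apply filterlim_locally. intros eps.
apply is_lim_seq_spec in H. generalize (H eps). apply filter_imp. intros n Hn.
rewrite Rminus_0_r, (Rabs_pos_eq (Cmod _)) in Hn by apply Cmod_ge_0.
apply (norm_compat1 (V := C_R_NormedModule)). rewrite norm_Cmod. exact Hn.
Qed.

Lemma Clim_CSeries (a : nat -> C) : ex_series (fun n => Cmod (a n)) -> Clim (Csum a) (CSeries a).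
Proof.
intros H.
assert (H1 : ex_series (fun n => Re (a n))).
{ apply (ex_series_le (K := R_AbsRing) (V := R_CompleteNormedModule) _ (fun n => Cmod (a n))); [| exact H].
  intros n. eapply Rle_trans; [| apply Rmax_Cmod]. apply Rmax_l. }
assert (H2 : ex_series (fun n => Im (a n))).
{ apply (ex_series_le (K := R_AbsRing) (V := R_CompleteNormedModule) _ (fun n => Cmod (a n))); [| exact H].
  intros n. eapply Rle_trans; [| apply Rmax_Cmod]. apply Rmax_r. }
apply Clim_of_Re_Im.
- apply (is_lim_seq_ext (sum_n (fun n => Re (a n)))).
  + intros n. now rewrite Csum_Re, sum_n_Reals.
  + apply (Series_correct _ H1).
- apply (is_lim_seq_ext (sum_n (fun n => Im (a n)))).
  + intros n. now rewrite Csum_Im, sum_n_Reals.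
  + apply (Series_correct _ H2).
Qed.

Lemma Csum_even (g : nat -> C) N : (forall n, g (2 * n + 1)%nat = RtoC 0) ->
  Csum g N = Csum (fun n => g (2 * n)%nat) (N / 2).
Proof.
intros H.
assert (P : forall M, Csum g (2 * M) = Csum (fun n => g (2 * n)%nat) M
  /\ Csum g (2 * M + 1) = Csum (fun n => g (2 * n)%nat) M).
{ assert (S1 : forall M, Csum g (2 * M + 1) = Csum g (2 * M)).
  { intros M. assert (E := H M). rewrite Nat.add_1_r in E |- *. rewrite Csum_S, E. ring. }
  intros M. rewrite S1. enough (Csum g (2 * M) = Csum (fun n => g (2 * n)%nat) M) by tauto.
  induction M as [|M IH]; [now rewrite 2!Csum_O |].
  rewrite (Csum_S (fun n => g (2 * n)%nat) M), <- IH, <- (S1 M).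
  replace (2 * S M)%nat with (S (2 * M + 1)) by lia. now rewrite Csum_S. }
assert (D := Nat.div_mod_eq N 2). assert (B := Nat.mod_upper_bound N 2 ltac:(lia)).
destruct (P (N / 2)%nat) as [P1 P2]. 
destruct (N mod 2) as [|[|r]]; [| | lia].
- replace N with (2 * (N / 2))%nat at 1 by lia. exact P1.
- replace N with (2 * (N / 2) + 1)%nat at 1 by lia. exact P2.
Qed.

Lemma Csum_odd (g : nat -> C) M : (forall n, g (2 * n)%nat = RtoC 0) ->
  Csum g (S M) = Csum (fun n => g (2 * n + 1)%nat) (M / 2).
Proof.
intros H.
assert (E : Csum g (S M) = Csum (fun n => g (S n)) M).
{ induction M as [|M IH].
  - rewrite Csum_S, 2!Csum_O. rewrite (H 0%nat : g 0%nat = _). ring.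
  - now rewrite (Csum_S g), IH, (Csum_S (fun n => g (S n))). }
rewrite E, (Csum_even (fun n => g (S n))).
- apply Csum_ext. intros k _. now rewrite Nat.add_1_r.
- intros n. replace (S (2 * n + 1)) with (2 * (n + 1))%nat by lia. apply H.
Qed.

Lemma weierstrass_test {A : Type} (D : A -> Prop) (u : nat -> A -> C) (l : A -> C) (B : nat -> R) :
  ex_series B -> (forall n p, D p -> Cmod (u n p) <= B n) ->
  (forall p, D p -> Clim (Csum (fun n => u n p)) (l p)) -> series_converges_uniformly D u l.
Proof.
intros HB Hu Hl eps He.
assert (L : is_lim_seq (sum_f_R0 B) (Series B)).
{ apply (is_lim_seq_ext (sum_n B)); [intros; apply sum_n_Reals |]. apply (Series_correct _ HB). }
assert (He2 : 0 < eps / 2) by lra.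
destruct (proj2 (is_lim_seq_spec _ _) L (mkposreal _ He2)) as [N HN].
exists N. intros n Hn p Hp. specialize (HN n Hn). simpl in HN.
assert (T : forall m, Cmod (Csum (fun k => u k p) (n + m) - Csum (fun k => u k p) n)%C
   <= sum_f_R0 B (n + m) - sum_f_R0 B n).
{ induction m as [|m IH].
  - rewrite Nat.add_0_r. replace (_ - _)%C with (RtoC 0) by ring. rewrite Cmod_0. lra.
  - rewrite Nat.add_succ_r, Csum_S. simpl sum_f_R0.
    replace (_ - _)%C with (Csum (fun k => u k p) (n + m) - Csum (fun k => u k p) n + u (S (n + m)) p)%C by ring.
    eapply Rle_trans; [apply Cmod_triangle |]. specialize (Hu (S (n + m)) p Hp). lra. }
assert (B0 : forall k, 0 <= B k) by (intros k; eapply Rle_trans; [apply Cmod_ge_0 | apply (Hu k p Hp)]).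
assert (Tail : forall m, sum_f_R0 B (n + m) <= Series B).
{ intros m. apply (is_lim_seq_incr_compare (sum_f_R0 B) (Series B) L). intros k. simpl. specialize (B0 (S k)). lra. }
apply Rle_lt_trans with (eps / 2); [| lra].
rewrite <- Cmod_opp. replace (- _)%C with (l p - Csum (fun k => u k p) n)%C by ring.
apply (Clim_Cmod_le (fun m => Csum (fun k => u k p) (n + m) - Csum (fun k => u k p) n)%C).
- assert (S1 := Clim_subseq _ _ (fun m => (n + m)%nat) (Hl p Hp)).
  apply (Clim_bound _ _ (fun m => Cmod (Csum (fun k => u k p) (n + m) - l p)%C)).
  + intros m. right. f_equal. ring.
  + apply S1. intros P [M HM]. exists M. intros j Hj. apply HM. lia.
- intros m. eapply Rle_trans; [apply T |]. specialize (Tail m).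
  apply Rabs_def2 in HN. lra.
Qed.

Lemma CSeries_ext a c : (forall n, a n = c n) -> CSeries a = CSeries c.
Proof. intros H. unfold CSeries. f_equal; apply Series_ext; intros n; now rewrite H. Qed.

Lemma CSeries_scal (r : R) a : CSeries (fun n => RtoC r * a n)%C = (RtoC r * CSeries a)%C.
Proof.
unfold CSeries. apply injective_projections; simpl.
- rewrite (Series_ext _ (fun n => r * Re (a n))) by (intros; unfold Re; simpl; ring).
  rewrite Series_scal_l. ring.
- rewrite (Series_ext _ (fun n => r * Im (a n))) by (intros; unfold Im; simpl; ring).
  rewrite Series_scal_l. ring.
Qed.

(** ** Exponential and powers *)

Lemma Cexp_plus z w : Cexp (z + w) = (Cexp z * Cexp w)%C.
Proof.
unfold Cexp, Re, Im. apply injective_projections; simpl; rewrite exp_plus, ?cos_plus, ?sin_plus; ring.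
Qed.

Lemma Cexp_nz z : Cexp z <> RtoC 0.
Proof.
intros E. assert (E2 : (Cexp z * Cexp (- z) = 1)%C).
{ rewrite <- Cexp_plus. replace (z + - z)%C with (RtoC 0) by ring.
  unfold Cexp; simpl. rewrite exp_0, cos_0, sin_0. apply injective_projections; simpl; ring. }
rewrite E, Cmult_0_l in E2. injection E2; lra.
Qed.

Lemma Cexp_real_mult (n : nat) z : Cexp (INR n * z)%C = (Cexp z ^ n)%C.
Proof.
induction n as [|n IH].
- simpl. replace (RtoC 0 * z)%C with (RtoC 0) by ring.
  unfold Cexp; simpl. rewrite exp_0, cos_0, sin_0. apply injective_projections; simpl; ring.
- rewrite S_INR, RtoC_plus. replace ((INR n + 1) * z)%C with (z + INR n * z)%C by ring.
  rewrite Cexp_plus, IH. reflexivity.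
Qed.

Lemma Cexp_Clog z : z <> RtoC 0 -> Cexp (Clog z) = z.
Proof.
intros Hz. assert (Hm := Cmod_gt_0 z). assert (Hp : 0 < Cmod z) by now apply Hm.
unfold Cexp, Clog; simpl. rewrite exp_ln by exact Hp.
destruct z as [x y]. set (r := Cmod (x, y)) in *.
assert (Hr : r * r = x * x + y * y).
{ unfold r, Cmod; simpl. rewrite sqrt_sqrt by nra. ring. }
assert (Hx : -1 <= x / r <= 1).
{ split; [apply Rle_div_r; nra | apply Rle_div_l; nra]. }
unfold Carg; simpl. fold r.
assert (Hs : sin (acos (x / r)) = Rabs y / r).
{ rewrite sin_acos by exact Hx.
  assert (Hsq : 1 - (x / r)² = (Rabs y / r)²).
  { unfold Rsqr. replace (Rabs y / r * (Rabs y / r)) with (Rabs y * Rabs y / (r * r)) by (field; lra).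
    rewrite <- Rabs_mult, (Rabs_pos_eq (y * y)) by nra.
    replace (y * y) with (r * r - x * x) by lra. field; lra. }
  rewrite Hsq, sqrt_Rsqr; [reflexivity |]. apply Rdiv_le_0_compat; [apply Rabs_pos | exact Hp]. }
destruct (Rlt_dec y 0) as [L | L].
- rewrite cos_neg, sin_neg, cos_acos, Hs by exact Hx. rewrite Rabs_left by exact L.
  apply injective_projections; simpl; field; lra.
- rewrite cos_acos, Hs by exact Hx. rewrite Rabs_pos_eq by lra.
  apply injective_projections; simpl; field; lra.
Qed.

(** A positive factor leaves the argument unchanged, so no multiple of [2 i PI] appears. *)
Lemma Clog_half z : z <> RtoC 0 -> Clog (z / 2) = (Clog z - RtoC (ln 2))%C.
Proof.
intros Hz. assert (Hp : 0 < Cmod z) by now apply Cmod_gt_0.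
assert (Hm : Cmod (z / 2) = Cmod z / 2).
{ rewrite Cmod_div by (intros E; injection E; lra). rewrite Cmod_R, Rabs_pos_eq by lra. reflexivity. }
assert (H1 : Re (z / 2) = Re z / 2) by (simpl; unfold Re; field).
assert (H2 : Im (z / 2) = Im z / 2) by (simpl; unfold Im; field).
unfold Clog. rewrite Hm. unfold Carg. rewrite Hm, H1, H2.
replace (Re z / 2 / (Cmod z / 2)) with (Re z / Cmod z) by (field; lra).
rewrite ln_div by lra.
apply injective_projections; simpl; [reflexivity |].
destruct (Rlt_dec (Im z / 2) 0), (Rlt_dec (Im z) 0); lra.
Qed.

(** ** The power series of the spherical Bessel functions *)

(** The coefficients of [j_k(z) = z^k sum_m sph_coef k m z^(2m)]. *)
Definition sph_coef (k m : nat) : R := (-1) ^ m / (2 ^ m * INR (fact m) * dfact (k + m)).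

Definition sph_term (k : nat) (z : C) (m : nat) : C := (RtoC (sph_coef k m) * (z * z) ^ m)%C.

Lemma dfact_le k m : dfact k <= dfact (k + m).
Proof.
induction m as [|m IH]; [rewrite Nat.add_0_r; lra |].
rewrite Nat.add_succ_r. simpl. pose proof (pos_INR (k + m)). pose proof (dfact_pos (k + m)). nra.
Qed.

Lemma sph_term_bound k z m :
  Cmod (sph_term k z m) <= / dfact k * ((Cmod z ^ 2 / 2) ^ m / INR (fact m)).
Proof.
unfold sph_term, sph_coef. rewrite Cmod_mult, Cmod_R.
assert (E : Cmod ((z * z) ^ m) = (Cmod z ^ 2) ^ m).
{ rewrite Cmod_pow, Cmod_mult. f_equal; ring. }
rewrite E. unfold Rdiv at 1. rewrite Rabs_mult, pow_1_abs, Rmult_1_l.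
assert (P1 := dfact_pos k). assert (P2 := dfact_pos (k + m)). assert (P3 := dfact_le k m).
assert (P4 := pow_lt 2 m ltac:(lra)). assert (P5 := INR_fact_lt_0 m).
assert (P6 : 0 < 2 ^ m * INR (fact m)) by (apply Rmult_lt_0_compat; lra).
assert (P7 : 0 < 2 ^ m * INR (fact m) * dfact (k + m)) by (apply Rmult_lt_0_compat; lra).
rewrite Rabs_inv, (Rabs_pos_eq (_ * _)) by lra.
unfold Rdiv. rewrite Rpow_mult_distr, pow_inv.
replace (/ dfact k * ((Cmod z ^ 2) ^ m * / 2 ^ m * / INR (fact m))) with
  (/ (2 ^ m * INR (fact m)) * / dfact k * (Cmod z ^ 2) ^ m) by (field; lra).
apply Rmult_le_compat_r; [apply pow_le, pow_le, Cmod_ge_0 |].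
rewrite Rinv_mult. apply Rmult_le_compat_l; [apply Rlt_le, Rinv_0_lt_compat; lra |].
apply Rinv_le_contravar; lra.
Qed.

Lemma is_series_exp_fact x : is_series (fun m => x ^ m / INR (fact m)) (exp x).
Proof.
apply (is_series_ext (fun m => scal (pow_n x m) (/ INR (fact m)))).
- intros n. rewrite pow_n_pow. reflexivity.
- apply is_exp_Reals.
Qed.

Lemma Clim_sph k z : Clim (Csum (sph_term k z)) (CSeries (sph_term k z)).
Proof.
apply Clim_CSeries.
apply (ex_series_le (K := R_AbsRing) (V := R_CompleteNormedModule) _
  (fun m => / dfact k * ((Cmod z ^ 2 / 2) ^ m / INR (fact m)))).
- intros n. unfold norm; simpl. unfold abs; simpl. rewrite Rabs_pos_eq by apply Cmod_ge_0.
  apply sph_term_bound.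
- apply (ex_series_scal (K := R_AbsRing) (V := R_NormedModule) (/ dfact k) (fun m => (Cmod z ^ 2 / 2) ^ m / INR (fact m))).
  eexists. apply is_series_exp_fact.
Qed.

Lemma sph_series_bound k z : Cmod (CSeries (sph_term k z)) <= / dfact k * exp (Cmod z ^ 2 / 2).
Proof.
apply (Clim_Cmod_le _ _ _ (Clim_sph k z)). intros n.
eapply Rle_trans; [apply Csum_Cmod; intros; apply sph_term_bound |].
assert (P := dfact_pos k).
apply Rle_trans with (/ dfact k * sum_f_R0 (fun m => (Cmod z ^ 2 / 2) ^ m / INR (fact m)) n).
- right. rewrite scal_sum. apply sum_eq. intros; ring.
- apply Rmult_le_compat_l; [apply Rlt_le, Rinv_0_lt_compat, P |].
  apply exp_ge_taylor. assert (0 <= Cmod z ^ 2) by apply pow2_ge_0. lra.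
Qed.

Lemma bessel_half k z :
  bessel_J (INR k + 1 / 2) z =
  (Cpower (z / 2) (INR k + 1 / 2) * (RtoC (2 ^ S k / sqrt PI) * CSeries (sph_term k z)))%C.
Proof.
unfold bessel_J. f_equal. rewrite <- CSeries_scal. apply CSeries_ext. intros m.
replace (INR m + (INR k + 1 / 2) + 1) with (INR (k + m) + 3 / 2) by (rewrite plus_INR; field).
rewrite Gamma_half. unfold sph_term, sph_coef.
replace (z / 2 * (z / 2))%C with (RtoC (/ 4) * (z * z))%C by
  (rewrite RtoC_inv by lra; field).
rewrite Cpow_mult_l, <- RtoC_pow, !Cmult_assoc, <- !RtoC_mult. f_equal. f_equal.
assert (HP := sqrt_lt_R0 PI PI_RGT_0). assert (P2 := dfact_pos (k + m)).
assert (P5 := INR_fact_lt_0 m). assert (Q1 := pow_lt 2 m ltac:(lra)). assert (Q2 := pow_lt 2 k ltac:(lra)).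
rewrite pow_inv. replace (4 ^ m) with (2 ^ m * 2 ^ m) by (rewrite <- Rpow_mult_distr; f_equal; ring).
simpl pow. rewrite pow_add. field. repeat split; lra.
Qed.

(** The half-integral powers of [z] in [sqrt_quot] and in [bessel_J] are built on the same
    logarithm, so that their product is the ordinary power [z^k], on the branch cut as elsewhere. *)
Lemma sph_bessel_eq k z : sph_bessel k z = (z ^ k * CSeries (sph_term k z))%C.
Proof.
unfold sph_bessel. destruct (Req_EM_T (Cmod z) 0) as [E | E].
- assert (Z : z = RtoC 0) by now apply Cmod_eq_0. subst z.
  destruct k as [|k]; simpl Nat.eqb; cbv iota; [| simpl; ring].
  assert (L : CSeries (sph_term 0 0) = RtoC 1).
  { apply (Clim_unique _ _ _ (Clim_sph 0 0)).
    apply (Clim_ext (fun _ => RtoC 1)).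
    - intros n. induction n as [|n IH].
      + rewrite Csum_O. unfold sph_term, sph_coef; simpl.
        apply injective_projections; simpl; field.
      + rewrite Csum_S, <- IH. unfold sph_term; simpl. ring.
    - apply (Clim_bound _ _ (fun _ => 0)); [| apply is_lim_seq_const].
      intros _. replace (1 - 1)%C with (RtoC 0) by ring. rewrite Cmod_0. lra. }
  rewrite L. simpl; ring.
- assert (Hz : z <> RtoC 0) by (intros Z; apply E; rewrite Z; apply Cmod_0).
  rewrite bessel_half. unfold sqrt_quot, Cpower. rewrite Clog_half by exact Hz.
  set (L := Clog z).
  assert (HP := PI_RGT_0). assert (HS := sqrt_lt_R0 PI PI_RGT_0).
  transitivity (RtoC (sqrt (PI / 2)) * RtoC (2 ^ S k / sqrt PI) *
    (Cexp (RtoC (- (1 / 2)) * L) * Cexp (RtoC (INR k + 1 / 2) * (L - RtoC (ln 2)))) * CSeries (sph_term k z))%C; [ring |].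
  rewrite <- Cexp_plus.
  replace (RtoC (- (1 / 2)) * L + RtoC (INR k + 1 / 2) * (L - RtoC (ln 2)))%C
    with (INR k * L + RtoC (- ((INR k + 1 / 2) * ln 2)))%C
    by (rewrite RtoC_opp, RtoC_mult, RtoC_opp, !RtoC_plus; ring).
  rewrite Cexp_plus, Cexp_real_mult. unfold L. rewrite Cexp_Clog by exact Hz.
  assert (ER : Cexp (RtoC (- ((INR k + 1 / 2) * ln 2))) = RtoC (/ (2 ^ k * sqrt 2))).
  { unfold Cexp; simpl. rewrite cos_0, sin_0. rewrite exp_Ropp.
    replace (exp ((INR k + 1 / 2) * ln 2)) with (2 ^ k * sqrt 2).
    - apply injective_projections; simpl; ring.
    - rewrite <- Rpower_pow, <- Rpower_sqrt by lra. rewrite <- Rpower_plus. unfold Rpower.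
      f_equal; f_equal; field. }
  rewrite ER.
  transitivity (RtoC (sqrt (PI / 2) * (2 ^ S k / sqrt PI) * / (2 ^ k * sqrt 2)) * (z ^ k * CSeries (sph_term k z)))%C.
  { rewrite 2!RtoC_mult. ring. }
  replace (sqrt (PI / 2) * (2 ^ S k / sqrt PI) * / (2 ^ k * sqrt 2)) with 1; [ring |].
  rewrite sqrt_div by lra. assert (H2 := sqrt_lt_R0 2 ltac:(lra)). assert (Q := pow_lt 2 k ltac:(lra)).
  simpl pow. apply (Rmult_eq_reg_r (sqrt 2 * sqrt 2)); [| nra]. rewrite sqrt_sqrt at 1 by lra.
  field. repeat split; lra.
Qed.

(** The decay in [k] is uniform for bounded [z]: it carries the uniform convergence of the
    expansions. *)
Lemma sph_bessel_bound k z : Cmod (sph_bessel k z) <= Cmod z ^ k / dfact k * exp (Cmod z ^ 2 / 2).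
Proof.
rewrite sph_bessel_eq, Cmod_mult, Cmod_pow. unfold Rdiv at 1. rewrite Rmult_assoc.
apply Rmult_le_compat_l; [apply pow_le, Cmod_ge_0 | apply sph_series_bound].
Qed.

Lemma sqrt_quot_nz c z : 0 < c -> sqrt_quot c z <> RtoC 0.
Proof.
intros Hc. apply Cmult_neq_0; [| apply Cexp_nz].
intros E; apply RtoC_inj in E. assert (P := sqrt_lt_R0 c Hc). lra.
Qed.

Lemma sqrt_quot_4 z : sqrt_quot (2 * PI) z = (2 * sqrt_quot (PI / 2) z)%C.
Proof.
unfold sqrt_quot. rewrite Cmult_assoc, <- RtoC_mult. f_equal. f_equal.
assert (HP := PI_RGT_0). replace (2 * PI) with (2 ^ 2 * (PI / 2)) by field.
rewrite sqrt_mult by lra. rewrite sqrt_pow2 by lra. reflexivity.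
Qed.

Lemma sph_bessel_J k z : z <> RtoC 0 ->
  bessel_J (INR k + 1 / 2) z = (/ sqrt_quot (PI / 2) z * sph_bessel k z)%C.
Proof.
intros Hz. unfold sph_bessel. destruct (Req_EM_T (Cmod z) 0) as [E | _].
- elim Hz. now apply Cmod_eq_0.
- field. apply sqrt_quot_nz. pose proof PI_RGT_0; lra.
Qed.

Lemma c_term_J_eq f om (x : R) n : (om * x)%C <> RtoC 0 ->
  c_term_J f om x n = (/ sqrt_quot (PI / 2) (om * x) * c_term f om x n)%C.
Proof. intros Hz. unfold c_term_J, c_term. rewrite sph_bessel_J by exact Hz. ring. Qed.

Lemma s_term_J_eq f om (x : R) n : (om * x)%C <> RtoC 0 ->
  s_term_J f om x n = (/ sqrt_quot (PI / 2) (om * x) * s_term f om x n)%C.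
Proof.
intros Hz. unfold s_term_J, s_term.
replace (INR (2 * n) + 3 / 2) with (INR (2 * n + 1) + 1 / 2) by (rewrite (plus_INR (2 * n)); simpl; field).
rewrite sph_bessel_J by exact Hz. ring.
Qed.

(** For fixed [z] the series in [J] and in [j] are proportional, the factor being
    [sqrt (PI / (2 z))]. *)
Lemma bessel_series (a aJ : nat -> C) (z D : C) : z <> RtoC 0 ->
  (forall n, aJ n = / sqrt_quot (PI / 2) z * a n)%C -> Clim (Csum a) (D / 2)%C ->
  exists S, Cis_series aJ S /\ D = (sqrt_quot (2 * PI) z * S)%C.
Proof.
intros Hz Ha HL.
assert (Hsq : sqrt_quot (PI / 2) z <> RtoC 0) by (apply sqrt_quot_nz; pose proof PI_RGT_0; lra).
exists (/ sqrt_quot (PI / 2) z * (D / 2))%C. split.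
- apply Cis_series_of_Clim.
  apply (Clim_ext (fun n => / sqrt_quot (PI / 2) z * Csum a n)%C).
  + intros n. rewrite <- Csum_scal. apply Csum_ext. intros k _. now rewrite Ha.
  + now apply Clim_scal.
- rewrite sqrt_quot_4. field. exact Hsq.
Qed.

(** ** The integral representation of the spherical Bessel functions *)

Lemma Cder_Cexp (w : C) (x : R) : Cder (fun t : R => Cexp (w * t)) x (w * Cexp (w * x))%C.
Proof.
destruct w as [a c].
apply (Cder_ext (fun t : R => (exp (a * t) * cos (c * t), exp (a * t) * sin (c * t)))).
{ intros t. unfold Cexp, Re, Im; simpl. now rewrite !Rmult_0_r, Rminus_0_r, Rplus_0_l. }
unfold Cexp, Re, Im; simpl. rewrite !Rmult_0_r, Rminus_0_r, Rplus_0_l.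
apply Cder_intro; simpl; auto_derive; trivial; ring.
Qed.

Lemma cont_Cexp (w : C) : contC (fun t : R_UniformSpace => Cexp (w * RtoC t)).
Proof. intros t. eapply Cder_continuous, Cder_Cexp. Qed.
#[global] Hint Resolve cont_Cexp : cont.

Definition exp_taylor (w : C) (M : nat) (y : R) : C :=
  Csum (fun m => w ^ m / INR (fact m) * RtoC y ^ m)%C M.

Lemma Cder_exp_taylor w M y : Cder (exp_taylor w (S M)) y (w * exp_taylor w M y)%C.
Proof.
induction M as [|M IH].
- apply (Cder_ext (fun t : R => 1 + w * RtoC t ^ 1)%C).
  { intros t. unfold exp_taylor. rewrite Csum_S, Csum_O. simpl. field. }
  eapply Cder_eq; [apply Cder_plus; [apply Cder_const | apply Cder_scal, Cder_pow] |].
  unfold exp_taylor. rewrite Csum_O. simpl. field.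
- apply (Cder_ext (fun t : R => exp_taylor w (S M) t + w ^ (S (S M)) / INR (fact (S (S M))) * RtoC t ^ (S (S M)))%C).
  { intros t. unfold exp_taylor. now rewrite (Csum_S _ (S M)). }
  eapply Cder_eq; [apply Cder_plus; [apply IH | apply Cder_scal, Cder_pow] |].
  unfold exp_taylor. rewrite (Csum_S _ M). change (pred (S (S M))) with (S M).
  replace (INR (fact (S (S M)))) with (INR (S (S M)) * INR (fact (S M))) by
    (rewrite (fact_simpl (S M)), mult_INR; reflexivity).
  rewrite RtoC_mult.
  assert (Z1 : RtoC (INR (S (S M))) <> RtoC 0).
  { intros E; apply RtoC_inj in E. now apply (not_0_INR (S (S M))). }
  assert (Z2 : RtoC (INR (fact (S M))) <> RtoC 0).
  { intros E; apply RtoC_inj in E. now apply (INR_fact_neq_0 (S M)). }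
  rewrite (Cpow_S w (S M)). field. now split.
Qed.

Lemma exp_taylor_0 w M : exp_taylor w M 0 = RtoC 1.
Proof.
induction M as [|M IH]; unfold exp_taylor in *.
- rewrite Csum_O. simpl. field.
- rewrite Csum_S, IH. simpl. ring.
Qed.

Lemma Cexp_0 : Cexp 0 = RtoC 1.
Proof. unfold Cexp; simpl. rewrite exp_0, cos_0, sin_0. apply injective_projections; simpl; ring. Qed.

Lemma Cmod_Cexp z : Cmod (Cexp z) = exp (Re z).
Proof.
unfold Cexp, Cmod; simpl.
replace (_ + _) with (Rsqr (exp (Re z)) * (Rsqr (sin (Im z)) + Rsqr (cos (Im z)))) by (unfold Rsqr; ring).
rewrite sin2_cos2, Rmult_1_r. apply sqrt_Rsqr, Rlt_le, exp_pos.
Qed.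

Lemma Re_le_Cmod z : Re z <= Cmod z.
Proof. eapply Rle_trans; [apply Rle_abs | eapply Rle_trans; [apply Rmax_l | apply Rmax_Cmod]]. Qed.

(** The remainder [r_M] satisfies [r_(M+1)' = w r_M], whence the bound by iterated integration. *)
Lemma exp_remainder_pos w M y : 0 <= y <= 1 ->
  Cmod (Cexp (w * y) - exp_taylor w M y)%C
  <= exp (Cmod w) * Cmod w ^ (S M) / INR (fact (S M)) * y ^ (S M).
Proof.
assert (Hw := Cmod_ge_0 w).
assert (Step : forall (F S0 : R -> C) (B : R) (k : nat) (t : R),
  (forall s, Cder F s (w * S0 s)%C) -> contC S0 -> F 0 = RtoC 0 ->
  (forall s, 0 <= s <= t -> Cmod (S0 s) <= B * s ^ k) -> 0 <= t ->
  Cmod (F t) <= Cmod w * B / INR (S k) * t ^ (S k)).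
{ intros F S0 B k t Hd Hc H0 HB Ht.
  assert (E : F t = CInt (fun s => w * S0 s)%C 0 t).
  { assert (Cs : contC (fun s => w * S0 s)%C) by prove_cont.
    assert (D : forall s, Cder (fun s => F s - CInt (fun s => w * S0 s) 0 s)%C s (RtoC 0)).
    { intros s. eapply Cder_eq; [apply Cder_minus; [apply Hd | now apply Cder_CInt] | ring]. }
    assert (K0 := constant_of_derive t _ (fun s => Cder_continuous _ _ _ (D s)) (fun s _ => D s) t ltac:(lra)).
    simpl in K0. rewrite H0, CInt_point in K0.
    transitivity (F t - CInt (fun s => w * S0 s) 0 t + CInt (fun s => w * S0 s) 0 t)%C; [ring | rewrite K0; ring]. }
  rewrite E.
  replace (Cmod w * B / INR (S k) * t ^ S k) with (RInt (fun s => Cmod w * (B * s ^ k)) 0 t).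
  - apply CInt_norm_le; [exact Ht | prove_cont | apply ex_RInt_cont; prove_cont |].
    intros s Hs. rewrite Cmod_mult. apply Rmult_le_compat_l; [exact Hw | now apply HB].
  - rewrite (RInt_FTC (fun s => Cmod w * B / INR (S k) * s ^ S k)); [rewrite pow_i by lia; unfold Rdiv; lra | | prove_cont].
    intros s. auto_derive; [trivial |]. change (pred (S k)) with k. field. apply (not_0_INR (S k)); lia. }
assert (CE : contC (fun s : R => Cexp (w * s))) by prove_cont.
revert y; induction M as [|M IH]; intros y Hy.
- eapply Rle_trans.
  + apply (Step (fun s : R => Cexp (w * s) - exp_taylor w 0 s)%C (fun s : R => Cexp (w * s)) (exp (Cmod w)) 0%nat y).
    * intros s. apply (Cder_ext (fun s : R => Cexp (w * s) - 1)%C).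
      { intros u. unfold exp_taylor. rewrite Csum_O. simpl. f_equal. field. }
      eapply Cder_eq; [apply Cder_minus; [apply Cder_Cexp | apply Cder_const] | ring].
    * exact CE.
    * rewrite exp_taylor_0, Cmult_0_r, Cexp_0. ring.
    * intros s Hs. rewrite Cmod_Cexp. simpl pow. rewrite Rmult_1_r. apply exp_le.
      eapply Rle_trans; [apply Re_le_Cmod |]. rewrite Cmod_mult, Cmod_R, Rabs_pos_eq by lra. nra.
    * lra.
  + right. simpl. field.
- eapply Rle_trans.
  + apply (Step (fun s : R => Cexp (w * s) - exp_taylor w (S M) s)%C
     (fun s : R => Cexp (w * s) - exp_taylor w M s)%C (exp (Cmod w) * Cmod w ^ (S M) / INR (fact (S M))) (S M) y).
    * intros s. eapply Cder_eq; [apply Cder_minus; [apply Cder_Cexp | apply Cder_exp_taylor] | ring].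
    * apply cont_Cminus; [exact CE |].
      destruct M as [|M].
      -- apply (cont_ext (V := C_UniformSpace) (fun _ => RtoC 1)); [| apply cont_const].
         intros s. unfold exp_taylor. rewrite Csum_O. simpl. field.
      -- intros s. eapply Cder_continuous, Cder_exp_taylor.
    * rewrite exp_taylor_0, Cmult_0_r, Cexp_0. ring.
    * intros s Hs. apply IH. lra.
    * lra.
  + right. rewrite (fact_simpl (S M)), mult_INR. simpl pow. field.
    split; [apply INR_fact_neq_0 | apply (not_0_INR (S (S M))); lia].
Qed.

Lemma exp_remainder w M y : -1 <= y <= 1 ->
  Cmod (Cexp (w * y) - exp_taylor w M y)%C <= exp (Cmod w) * (Cmod w ^ (S M) / INR (fact (S M))).
Proof.
assert (Hpos : forall v t, 0 <= t <= 1 ->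
  Cmod (Cexp (v * t) - exp_taylor v M t)%C <= exp (Cmod v) * (Cmod v ^ (S M) / INR (fact (S M)))).
{ intros v t Ht. eapply Rle_trans; [now apply exp_remainder_pos |].
  set (B := exp (Cmod v) * Cmod v ^ S M / INR (fact (S M))).
  replace (exp (Cmod v) * (Cmod v ^ S M / INR (fact (S M)))) with (B * 1) by (unfold B, Rdiv; ring).
  apply Rmult_le_compat_l.
  - unfold B. apply Rdiv_le_0_compat; [| apply INR_fact_lt_0].
    apply Rmult_le_pos; [apply Rlt_le, exp_pos | apply pow_le, Cmod_ge_0].
  - rewrite <- (pow1 (S M)). apply pow_incr. lra. }
intros Hy. destruct (Rle_dec 0 y) as [L | L]; [apply Hpos; lra |].
rewrite <- (Cmod_opp w). replace (w * y)%C with (- w * (- y)%R)%C by (rewrite RtoC_opp; ring).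
replace (exp_taylor w M y) with (exp_taylor (- w) M (- y)).
- apply Hpos; lra.
- unfold exp_taylor. apply Csum_ext. intros k _. rewrite RtoC_opp.
  transitivity ((- w * - RtoC y) ^ k / INR (fact k))%C; [rewrite Cpow_mult_l; unfold Cdiv; ring |].
  replace (- w * - RtoC y)%C with (w * RtoC y)%C by ring. rewrite Cpow_mult_l; unfold Cdiv; ring.
Qed.

Lemma CInt_RtoC (g : R -> R) a b : contR g ->
  CInt (fun t => RtoC (g t)) a b = RtoC (RInt g a b).
Proof.
intros Hg. rewrite CInt_pair by prove_cont.
apply injective_projections; simpl; [reflexivity |].
rewrite RInt_const. unfold scal; simpl; unfold mult; simpl; ring.
Qed.

Lemma cont_legendre_C n : contC (fun y : R_UniformSpace => RtoC (legendre n y)).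
Proof. prove_cont. Qed.
#[global] Hint Resolve cont_legendre_C : cont.

Lemma CInt_lsum (F : R -> C) g N : contC F ->
  CInt (fun y => F y * RtoC (lsum g N y))%C (-1) 1
  = Csum (fun j => RtoC (lcoef g j) * CInt (fun y => F y * RtoC (legendre j y)) (-1) 1)%C N.
Proof.
intros HF.
assert (CT : forall j, contC (fun y : R => F y * RtoC (legendre j y))%C).
{ intros j; prove_cont. }
assert (CS : forall M, contC (fun y : R => F y * RtoC (lsum g M y))%C).
{ intros j; prove_cont. }
induction N as [|N IH].
- rewrite Csum_O, <- (CInt_scal _ _ _ _ (CT 0%nat)). apply CInt_ext. intros y _.
  unfold lsum. cbn [sum_f_R0]. rewrite RtoC_mult. ring.
- rewrite Csum_S, <- IH, <- (CInt_scal _ _ _ _ (CT (S N))), <- CInt_plus.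
  + apply CInt_ext. intros y _. unfold lsum. cbn [sum_f_R0]. rewrite RtoC_plus, RtoC_mult. ring.
  + apply CS.
  + prove_cont.
Qed.

Lemma CInt_legendre_pair (F : R -> C) j : contC F ->
  CInt (fun y => F y * RtoC (legendre j y))%C (-1) 1
  = (ip (fun y => Re (F y)) (legendre j), ip (fun y => Im (F y)) (legendre j)).
Proof.
intros HF. rewrite CInt_pair by prove_cont.
apply injective_projections; apply RInt_ext_R; intros y _; unfold Re, Im; simpl; ring.
Qed.

Lemma CInt_legendre_pow n m :
  CInt (fun y => RtoC (legendre n y) * RtoC y ^ m)%C (-1) 1 = RtoC (p_coef n m).
Proof.
unfold p_coef. rewrite <- CInt_RtoC.
- apply CInt_ext. intros y _. now rewrite RtoC_mult, RtoC_pow.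
- apply cont_Rmult; [apply cont_legendre |].
  prove_cont.
Qed.

Lemma cont_exp_taylor w M : contC (fun y : R_UniformSpace => exp_taylor w M y).
Proof.
unfold exp_taylor. induction M as [|M IH].
- apply (cont_ext (V := C_UniformSpace) (fun y : R_UniformSpace => w ^ 0 / INR (fact 0) * RtoC y ^ 0)%C).
  { intros y. now rewrite Csum_O. }
  prove_cont.
- apply (cont_ext (V := C_UniformSpace) (fun y : R_UniformSpace =>
    Csum (fun m => w ^ m / INR (fact m) * RtoC y ^ m) M + w ^ S M / INR (fact (S M)) * RtoC y ^ S M)%C).
  { intros y. now rewrite Csum_S. }
  prove_cont.
Qed.

Lemma CInt_legendre_taylor n w M :
  CInt (fun y => RtoC (legendre n y) * exp_taylor w M y)%C (-1) 1
  = Csum (fun m => w ^ m / INR (fact m) * RtoC (p_coef n m))%C M.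
Proof.
assert (T : forall m, CInt (fun y => w ^ m / INR (fact m) * (RtoC (legendre n y) * RtoC y ^ m))%C (-1) 1
   = (w ^ m / INR (fact m) * RtoC (p_coef n m))%C).
{ intros m. rewrite CInt_scal, CInt_legendre_pow; [reflexivity |].
  prove_cont. }
induction M as [|M IH].
- rewrite Csum_O, <- T. apply CInt_ext. intros y _. unfold exp_taylor. rewrite Csum_O. ring.
- rewrite Csum_S, <- T, <- IH, <- CInt_plus.
  + apply CInt_ext. intros y _. unfold exp_taylor. rewrite Csum_S. ring.
  + apply cont_Cmult; [apply cont_legendre_C | apply cont_exp_taylor].
  + prove_cont.
Qed.

Lemma Clim_CInt_legendre n w :
  Clim (Csum (fun m => w ^ m / INR (fact m) * RtoC (p_coef n m))%C)
    (CInt (fun y => RtoC (legendre n y) * Cexp (w * y))%C (-1) 1).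
Proof.
apply (Clim_bound _ _ (fun M => 2 * (exp (Cmod w) * (Cmod w ^ (S M) / INR (fact (S M)))))).
- intros M.
  assert (C1 : contC (fun y : R => RtoC (legendre n y) * exp_taylor w M y)%C).
  { apply cont_Cmult; [apply cont_legendre_C | apply cont_exp_taylor]. }
  assert (C2 : contC (fun y : R => RtoC (legendre n y) * Cexp (w * y))%C) by prove_cont.
  rewrite <- CInt_legendre_taylor, <- (CInt_minus _ _ _ _ C1 C2).
  replace (2 * (exp (Cmod w) * (Cmod w ^ S M / INR (fact (S M)))))
    with (Rabs (1 - -1) * (exp (Cmod w) * (Cmod w ^ S M / INR (fact (S M)))))
    by (rewrite Rabs_pos_eq by lra; ring).
  apply CInt_norm_le_const.
  + prove_cont.
  + intros y. rewrite Rmin_left, Rmax_right by lra. intros Hy.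
    replace (RtoC (legendre n y) * exp_taylor w M y - RtoC (legendre n y) * Cexp (w * y))%C
     with (- (RtoC (legendre n y) * (Cexp (w * y) - exp_taylor w M y)))%C by ring.
    rewrite Cmod_opp, Cmod_mult, Cmod_R.
    rewrite <- (Rmult_1_l (exp _ * _)).
    apply Rmult_le_compat; [apply Rabs_pos | apply Cmod_ge_0 | now apply legendre_bound | now apply exp_remainder].
- assert (L : is_lim_seq (fun M => Cmod w ^ (S M) / INR (fact (S M))) 0).
  { apply (is_lim_seq_incr_1 (fun M => Cmod w ^ M / INR (fact M))).
    apply is_lim_seq_Reals, cv_speed_pow_fact. }
  replace (Finite 0) with (Rbar_mult (2 * exp (Cmod w)) 0) by (simpl; now rewrite Rmult_0_r).
  apply (is_lim_seq_ext (fun M => 2 * exp (Cmod w) * (Cmod w ^ S M / INR (fact (S M))))); [intros; ring |].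
  apply is_lim_seq_scal_l, L.
Qed.

(** The moments vanish below [n] and at the orders [n + 1, n + 3, ...]; the others turn the Taylor
    series of the exponential into the power series of [j_n]. *)
Lemma sph_partial_sums n z L :
  Csum (fun m => (Ci * z) ^ m / INR (fact m) * RtoC (p_coef n m))%C (n + 2 * L)
  = (2 * (Ci * z) ^ n * Csum (sph_term n z) L)%C.
Proof.
destruct (p_coef_eval n) as (A & B & C0).
set (a := fun m => ((Ci * z) ^ m / INR (fact m) * RtoC (p_coef n m))%C).
assert (T : forall l, a (n + 2 * l)%nat = (2 * (Ci * z) ^ n * sph_term n z l)%C).
{ intros l. unfold a. rewrite A. unfold moment, sph_term, sph_coef.
  rewrite Cpow_add_r, Cpow_mult_r.
  replace ((Ci * z) ^ 2)%C with (RtoC (-1) * (z * z))%C by (apply injective_projections; simpl; ring).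
  rewrite (Cpow_mult_l (RtoC (-1))), <- RtoC_pow.
  set (F := INR (fact (n + 2 * l))). assert (HF : F <> 0) by apply INR_fact_neq_0.
  assert (P2 := dfact_pos (n + l)). assert (P5 := INR_fact_lt_0 l). assert (P6 := pow_lt 2 l ltac:(lra)).
  transitivity (RtoC (/ F * (-1) ^ l * (2 * F / (2 ^ l * INR (fact l) * dfact (n + l)))) * ((Ci * z) ^ n * (z * z) ^ l))%C.
  { rewrite 2!RtoC_mult, RtoC_inv by exact HF. unfold Cdiv. ring. }
  transitivity (RtoC (2 * ((-1) ^ l / (2 ^ l * INR (fact l) * dfact (n + l)))) * ((Ci * z) ^ n * (z * z) ^ l))%C.
  - f_equal. f_equal. field. repeat split; lra.
  - rewrite RtoC_mult. ring. }
assert (Z : forall m, (m < n)%nat -> a m = RtoC 0).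
{ intros m Hm. unfold a. rewrite C0 by exact Hm. ring. }
assert (ZS : forall m, (m < n)%nat -> Csum a m = RtoC 0).
{ induction m as [|m IHm]; intros Hm; [rewrite Csum_O; now apply Z |].
  rewrite Csum_S, IHm, Z by lia. ring. }
change (Csum a (n + 2 * L) = (2 * (Ci * z) ^ n * Csum (sph_term n z) L)%C).
induction L as [|L IH].
- rewrite Csum_O, <- T. replace (n + 2 * 0)%nat with n by lia.
  destruct n as [|n]; [now rewrite Csum_O |]. rewrite Csum_S, ZS by lia. ring.
- replace (n + 2 * S L)%nat with (S (S (n + 2 * L))) by lia.
  rewrite 2!Csum_S, IH. rewrite (Csum_S (sph_term n z)).
  replace (S (S (n + 2 * L))) with (n + 2 * S L)%nat by lia. rewrite T.
  assert (O : a (S (n + 2 * L)) = RtoC 0).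
  { unfold a. replace (S (n + 2 * L)) with (n + 2 * L + 1)%nat by lia. rewrite B. ring. }
  rewrite O. ring.
Qed.

(** Termwise integration of the exponential series. *)
Lemma CInt_legendre_Cexp n z :
  CInt (fun y => RtoC (legendre n y) * Cexp (Ci * z * y))%C (-1) 1 = (2 * Ci ^ n * sph_bessel n z)%C.
Proof.
rewrite sph_bessel_eq.
transitivity (2 * (Ci * z) ^ n * CSeries (sph_term n z))%C; [| rewrite Cpow_mult_l; ring].
apply (Clim_unique (fun L => Csum (fun m => (Ci * z) ^ m / INR (fact m) * RtoC (p_coef n m))%C (n + 2 * L))).
- apply (Clim_subseq _ _ (fun L => (n + 2 * L)%nat) (Clim_CInt_legendre n (Ci * z))).
  intros P [N HN]. exists N. intros m Hm. apply HN. lia.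
- apply (Clim_ext (fun L => 2 * (Ci * z) ^ n * Csum (sph_term n z) L)%C).
  + intros L. symmetry; apply sph_partial_sums.
  + apply Clim_scal, Clim_sph.
Qed.

Lemma sph_bessel_opp n z : sph_bessel n (- z) = (RtoC ((-1) ^ n) * sph_bessel n z)%C.
Proof.
rewrite 2!sph_bessel_eq.
rewrite (CSeries_ext (sph_term n (- z)) (sph_term n z)).
- replace (- z)%C with (RtoC (-1) * z)%C by (apply injective_projections; simpl; ring).
  rewrite Cpow_mult_l, RtoC_pow. ring.
- intros m. unfold sph_term. now replace (- z * - z)%C with (z * z)%C by ring.
Qed.

Lemma Ci_pow_even n : (Ci ^ (2 * n))%C = RtoC ((-1) ^ n).
Proof.
rewrite Cpow_mult_r. replace (Ci ^ 2)%C with (RtoC (-1)) by (apply injective_projections; simpl; ring).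
now rewrite RtoC_pow.
Qed.

Lemma cont_Ccos z : contC (fun y : R_UniformSpace => Ccos (z * RtoC y)).
Proof.
unfold Ccos. apply cont_Cmult; [| apply cont_const].
apply cont_Cplus.
- apply (cont_ext (V := C_UniformSpace) (fun y : R_UniformSpace => Cexp (Ci * z * RtoC y))); [intros; f_equal; ring | apply cont_Cexp].
- apply (cont_ext (V := C_UniformSpace) (fun y : R_UniformSpace => Cexp (Ci * (- z) * RtoC y))); [intros; f_equal; ring | apply cont_Cexp].
Qed.

Lemma cont_Csin z : contC (fun y : R_UniformSpace => Csin (z * RtoC y)).
Proof.
unfold Csin. apply cont_Cmult; [| apply cont_const].
apply cont_Cminus.
- apply (cont_ext (V := C_UniformSpace) (fun y : R_UniformSpace => Cexp (Ci * z * RtoC y))); [intros; f_equal; ring | apply cont_Cexp].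
- apply (cont_ext (V := C_UniformSpace) (fun y : R_UniformSpace => Cexp (Ci * (- z) * RtoC y))); [intros; f_equal; ring | apply cont_Cexp].
Qed.

Lemma CInt_legendre_Ccos n z :
  CInt (fun y => RtoC (legendre n y) * Ccos (z * y))%C (-1) 1
  = (Ci ^ n * (1 + RtoC ((-1) ^ n)) * sph_bessel n z)%C.
Proof.
transitivity (/ 2 * (CInt (fun y => RtoC (legendre n y) * Cexp (Ci * z * y))%C (-1) 1
   + CInt (fun y => RtoC (legendre n y) * Cexp (Ci * (- z) * y))%C (-1) 1))%C.
- rewrite <- CInt_plus, <- CInt_scal.
  + apply CInt_ext. intros y _. unfold Ccos.
    replace (Ci * (z * y))%C with (Ci * z * y)%C by ring.
    replace (- (Ci * z * y))%C with (Ci * - z * y)%C by ring. field.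
  + prove_cont.
  + prove_cont.
  + prove_cont.
- rewrite 2!CInt_legendre_Cexp, sph_bessel_opp. field.
Qed.

Lemma CInt_legendre_Csin n z :
  CInt (fun y => RtoC (legendre n y) * Csin (z * y))%C (-1) 1
  = (Ci ^ n * (1 - RtoC ((-1) ^ n)) / Ci * sph_bessel n z)%C.
Proof.
assert (HCi : Ci <> RtoC 0) by (intros E; injection E; lra).
transitivity (/ (2 * Ci) * (CInt (fun y => RtoC (legendre n y) * Cexp (Ci * z * y))%C (-1) 1
   - CInt (fun y => RtoC (legendre n y) * Cexp (Ci * (- z) * y))%C (-1) 1))%C.
- rewrite <- CInt_minus, <- CInt_scal.
  + apply CInt_ext. intros y _. unfold Csin.
    replace (Ci * (z * y))%C with (Ci * z * y)%C by ring.
    replace (- (Ci * z * y))%C with (Ci * - z * y)%C by ring. field. exact HCi.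
  + prove_cont.
  + prove_cont.
  + prove_cont.
- rewrite 2!CInt_legendre_Cexp, sph_bessel_opp. field. exact HCi.
Qed.

Lemma Cder_Ccos om x : Cder (fun t : R => Ccos (om * t)) x (- om * Csin (om * x))%C.
Proof.
assert (HCi : Ci <> RtoC 0) by (intros E; injection E; lra).
apply (Cder_ext (fun t : R => / 2 * (Cexp (Ci * om * t) + Cexp (- (Ci * om) * t)))%C).
{ intros t. unfold Ccos. replace (Ci * (om * t))%C with (Ci * om * t)%C by ring.
  replace (- (Ci * om * t))%C with (- (Ci * om) * t)%C by ring. field. }
eapply Cder_eq; [apply Cder_scal, Cder_plus; apply Cder_Cexp |].
unfold Csin. replace (Ci * (om * x))%C with (Ci * om * x)%C by ring.
replace (- (Ci * om * x))%C with (- (Ci * om) * x)%C by ring.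
assert (C2 : (Ci * Ci = -1)%C) by (apply injective_projections; simpl; ring).
transitivity (om * (Ci * Ci) * (Cexp (Ci * om * x) - Cexp (- (Ci * om) * x)) / (2 * Ci))%C; [field; exact HCi |].
rewrite C2. field. exact HCi.
Qed.

Lemma Cder_Csin om x : Cder (fun t : R => Csin (om * t)) x (om * Ccos (om * x))%C.
Proof.
assert (HCi : Ci <> RtoC 0) by (intros E; injection E; lra).
apply (Cder_ext (fun t : R => / (2 * Ci) * (Cexp (Ci * om * t) - Cexp (- (Ci * om) * t)))%C).
{ intros t. unfold Csin. replace (Ci * (om * t))%C with (Ci * om * t)%C by ring.
  replace (- (Ci * om * t))%C with (- (Ci * om) * t)%C by ring. field. exact HCi. }
eapply Cder_eq; [apply Cder_scal, Cder_minus; apply Cder_Cexp |].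
unfold Ccos. replace (Ci * (om * x))%C with (Ci * om * x)%C by ring.
replace (- (Ci * om * x))%C with (- (Ci * om) * x)%C by ring. field. exact HCi.
Qed.

Lemma cosh_abs u : cosh (Rabs u) = cosh u.
Proof. unfold Rabs; destruct Rcase_abs; [| reflexivity]. unfold cosh. rewrite Ropp_involutive. field. Qed.

Lemma cosh_le u v : Rabs u <= v -> cosh u <= cosh v.
Proof.
intros H. rewrite <- cosh_abs. set (w := Rabs u) in *. assert (Hw : 0 <= w) by apply Rabs_pos.
unfold cosh. rewrite 2!exp_Ropp.
assert (A : 1 <= exp w) by (rewrite <- exp_0; now apply exp_le).
assert (B : exp w <= exp v) by now apply exp_le.
set (p := exp w) in *. set (r := exp v) in *.
assert (F : r + / r - (p + / p) = (r - p) * (1 - / (r * p))) by (field; lra).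
assert (G : / (r * p) <= 1) by (rewrite <- Rinv_1; apply Rinv_le_contravar; nra).
assert (0 <= (r - p) * (1 - / (r * p))) by (apply Rmult_le_pos; lra). lra.
Qed.

Lemma Cmod_Ccos z : Cmod (Ccos z) <= cosh (Im z).
Proof.
unfold Ccos. rewrite Cmod_div by (intros E; apply RtoC_inj in E; lra). rewrite Cmod_R, Rabs_pos_eq by lra.
apply Rmult_le_compat_r; [lra |]. eapply Rle_trans; [apply Cmod_triangle |].
rewrite 2!Cmod_Cexp. destruct z as [x y]; simpl.
replace (0 * x - 1 * y) with (- y) by ring. rewrite Ropp_involutive. lra.
Qed.

Lemma Cmod_Csin z : Cmod (Csin z) <= cosh (Im z).
Proof.
assert (HCi : Cmod (2 * Ci) = 2).
{ rewrite Cmod_mult, Cmod_R, Rabs_pos_eq by lra. replace (Cmod Ci) with 1; [ring |].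
  transitivity (sqrt 1); [now rewrite sqrt_1 |]. unfold Cmod; f_equal; simpl; ring. }
unfold Csin. rewrite Cmod_div by (intros E; rewrite E, Cmod_0 in HCi; lra). rewrite HCi.
apply Rmult_le_compat_r; [lra |]. eapply Rle_trans; [apply Cmod_triangle |].
rewrite Cmod_opp, 2!Cmod_Cexp. destruct z as [x y]; simpl.
replace (0 * x - 1 * y) with (- y) by ring. rewrite Ropp_involutive. lra.
Qed.

(** The two kernels of interest, [cos] and [sin], enter only through continuity and the bound
    [|T w| <= cosh (Im w)]. *)
Definition trig_like (T : C -> C) : Prop :=
  (forall z, contC (fun y : R_UniformSpace => T (z * RtoC y)%C)) /\
  (forall w, Cmod (T w) <= cosh (Im w)).

Lemma trig_like_Ccos : trig_like Ccos.
Proof. split; [intros z; apply cont_Ccos | apply Cmod_Ccos]. Qed.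

Lemma trig_like_Csin : trig_like Csin.
Proof. split; [intros z; apply cont_Csin | apply Cmod_Csin]. Qed.

Lemma RInt_cosh c x : 0 <= c -> 0 < x ->
  ex_RInt (fun y => cosh (c * x * y)) (-1) 1 /\
  x * RInt (fun y => cosh (c * x * y)) (-1) 1 = 2 * sinh_quot c x.
Proof.
intros Hc Hx.
assert (C : cont (fun y : R_UniformSpace => cosh (c * x * y) : R_UniformSpace)).
{ unfold cosh. apply (cont_of_ex_derive (fun y => (exp (c * x * y) + exp (- (c * x * y))) / 2)).
  intros; auto_derive; trivial. }
split; [now apply ex_RInt_cont |].
unfold sinh_quot. destruct (Req_EM_T c 0) as [-> | Hc0].
- rewrite (RInt_ext_R _ (fun _ => 1)).
  + rewrite RInt_const. unfold scal; simpl; unfold mult; simpl. ring.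
  + intros y _. replace (0 * x * y) with 0 by ring. apply cosh_0.
- assert (Hcx : 0 < c * x) by (apply Rmult_lt_0_compat; lra).
  rewrite (RInt_FTC (fun y => sinh (c * x * y) / (c * x))); [| | exact C].
  + replace (c * x * 1) with (c * x) by ring. replace (c * x * -1) with (- (c * x)) by ring.
    unfold sinh. rewrite Ropp_involutive. field; lra.
  + intros y. unfold sinh, cosh. auto_derive; [trivial |]. field; lra.
Qed.

(** * The transmutation operator in characteristic coordinates *)

(** In the characteristic coordinates [p = (x+t)/2], [v = (x-t)/2] the equation of the kernel reads
    [H_(pv) = Phi], and two integrations solve it: [charH] is the solution equal to [g] on the axis
    [v = 0] and constant on the axis [p = 0]; [charG] is its derivative in [v]. *)
Definition charG (Phi : R -> R -> C) (p v : R) : C := CInt (fun a => Phi a v) 0 p.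

Definition charH (g : R -> C) (Phi : R -> R -> C) (p v : R) : C :=
  (g p + CInt (fun a => CInt (Phi a) 0 v) 0 p)%C.

(** Half of the integral over [|t| <= x] of [A u(t)], where [t = 2 p - x]. *)
Definition charV (A : R -> R -> C) (u : R -> C) (x : R) : C :=
  CInt (fun p => A p (x - p)%R * u (2 * p - x)%R)%C 0 x.

Definition transmute (g : R -> C) (Phi : R -> R -> C) (u : R -> C) (x : R) : C :=
  (u x + 2 * charV (charH g Phi) u x)%C.

Lemma cont2_swap F : cont2 F -> cont2 (fun x y => F y x).
Proof. intros H. apply (cont2_comp F (fun p => snd p) (fun p => fst p) H); [apply cont_snd | apply cont_fst]. Qed.

Lemma cont2_l F y : cont2 F -> contC (fun x => F x y).
Proof.
intros H; apply (cont2_comp F (fun t : R_UniformSpace => t) (fun _ => y) H);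
  [apply cont_id | apply cont_const].
Qed.

Lemma cont2_r F x : cont2 F -> contC (fun y => F x y).
Proof. intros H; apply (cont2_l (fun a b => F b a)), cont2_swap, H. Qed.

Lemma cont2_charG Phi : cont2 Phi -> cont2 (charG Phi).
Proof. apply cont2_CInt_param. Qed.

Lemma cont2_CInt_inner Phi : cont2 Phi -> cont2 (fun a v => CInt (Phi a) 0 v).
Proof.
intros H. apply (cont2_swap (fun v a => CInt (fun t => Phi a t) 0 v)).
apply (cont2_CInt_param (fun t y => Phi y t)). now apply cont2_swap.
Qed.

Lemma cont2_charH g Phi : contC g -> cont2 Phi -> cont2 (charH g Phi).
Proof.
intros Hg H. apply cont_Cplus.
- apply (cont_comp g); [exact Hg | apply cont_fst].
- apply (cont2_CInt_param (fun a v => CInt (Phi a) 0 v)). now apply cont2_CInt_inner.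
Qed.

Lemma Cder_charH_r g Phi p v :
  cont2 Phi -> Cder (fun v => charH g Phi p v) v (charG Phi p v).
Proof.
intros H. eapply Cder_eq.
- apply Cder_plus; [apply Cder_const |].
  apply (leibniz (fun v a => CInt (Phi a) 0 v) (fun v a => Phi a v) 0 (fun _ => p) v 0).
  + intros y t. apply Cder_CInt. now apply cont2_r.
  + apply (cont2_swap (fun a v => CInt (Phi a) 0 v)). now apply cont2_CInt_inner.
  + now apply cont2_swap.
  + apply (is_derive_const (K := R_AbsRing) (V := R_NormedModule)).
- unfold charG. ring.
Qed.

Lemma Cder_charG_l Phi p v :
  cont2 Phi -> Cder (fun p => charG Phi p v) p (Phi p v).
Proof. intros H. apply (Cder_CInt (fun a => Phi a v)). now apply cont2_l. Qed.

Lemma Cder_lin (F : R -> C) (dF : C) c d x :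
  Cder F (c * x + d) dF -> Cder (fun t => F (c * t + d)%R) x (c * dF)%C.
Proof.
intros H. apply (Cder_comp F (fun t => c * t + d)); [exact H |].
auto_derive; [trivial | ring].
Qed.

Lemma cont2_conv A (u : R -> C) :
  cont2 A -> contC u ->
  cont2 (fun x p => A p (x - p)%R * u (2 * p - x)%R)%C.
Proof.
intros HA Hu. apply cont_Cmult.
- apply (cont2_comp A (fun q : R2 => snd q) (fun q => fst q - snd q) HA); [apply cont_snd |].
  prove_cont.
- apply (cont_comp u); [exact Hu |].
  prove_cont.
Qed.

Lemma cont2_conv' A (u : R -> C) :
  cont2 A -> contC u ->
  cont2 (fun x r => A (x - r)%R r * u (x - 2 * r)%R)%C.
Proof.
intros HA Hu. apply cont_Cmult.
- apply (cont2_comp A (fun q : R2 => fst q - snd q) (fun q => snd q) HA); [| apply cont_snd].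
  prove_cont.
- apply (cont_comp u); [exact Hu |].
  prove_cont.
Qed.

(** In [charV] the variable [x] moves the second argument of [A]; after this reversal it moves the
    first one. The kernel is differentiated in the first form and its derivative [charG] in the
    second: in this way [Phi] itself is never differentiated. *)
Lemma charV_reverse A u x :
  cont2 A -> contC u ->
  charV A u x = CInt (fun r => A (x - r)%R r * u (x - 2 * r)%R)%C 0 x.
Proof.
intros HA Hu. unfold charV.
pose (F := fun p : R => (A p (x - p)%R * u (2 * p - x)%R)%C).
assert (HF : contC F).
{ apply (cont2_r (fun x p => A p (x - p)%R * u (2 * p - x)%R)%C x). now apply cont2_conv. }
change (CInt F 0 x = CInt (fun r => A (x - r)%R r * u (x - 2 * r)%R)%C 0 x).
assert (E := CInt_comp_lin F (-1) x 0 x HF).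
replace (-1 * 0 + x) with x in E by ring. replace (-1 * x + x) with 0 in E by ring.
rewrite (CInt_swap F 0 x HF) in E.
transitivity (- - CInt F 0 x)%C; [ring | rewrite E].
transitivity (CInt (fun s => F (-1 * s + x)%R) 0 x).
{ apply injective_projections; simpl; ring. }
apply CInt_ext; intros r _. unfold F.
replace (-1 * r + x) with (x - r) by ring.
replace (x - (x - r)) with r by ring. now replace (2 * (x - r) - x) with (x - 2 * r) by ring.
Qed.

Lemma Cder_charV_H g Phi (u du : R -> C) x :
  contC g -> cont2 Phi ->
  (forall t, Cder u t (du t)) -> contC du ->
  Cder (charV (charH g Phi) u) x
    (charH g Phi x 0 * u x + charV (charG Phi) u x - charV (charH g Phi) du x)%C.
Proof.
intros Hg HP Hu Hdu.
assert (Hcu : contC u) by (intros t; eapply Cder_continuous, Hu).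
assert (HH := cont2_charH g Phi Hg HP). assert (HG := cont2_charG Phi HP).
eapply Cder_eq.
- apply (leibniz (fun x p => charH g Phi p (x - p)%R * u (2 * p - x)%R)%C
   (fun x p => charG Phi p (x - p)%R * u (2 * p - x)%R - charH g Phi p (x - p)%R * du (2 * p - x)%R)%C
   0 (fun x => x) x 1).
  + intros y t. eapply Cder_eq.
    * apply Cder_mult.
      -- apply (Cder_ext (fun s => charH g Phi t (1 * s + (- t))%R)); [intros s; f_equal; ring |].
         apply Cder_lin. apply Cder_charH_r, HP.
      -- apply (Cder_ext (fun s => u (-1 * s + 2 * t)%R)); [intros s; f_equal; ring |].
         apply Cder_lin. apply Hu.
    * simpl. replace (1 * y + - t) with (y - t) by ring.
      replace (-1 * y + 2 * t) with (2 * t - y) by ring.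
      replace (RtoC (-1)) with (- RtoC 1)%C by (apply injective_projections; simpl; ring). ring.
  + now apply cont2_conv.
  + apply cont_Cminus; now apply (cont2_conv _ _).
  + apply (is_derive_id (K := R_AbsRing)).
- unfold charV. rewrite CInt_minus by (apply (cont2_r (fun x p => _ p (x - p)%R * _ (2 * p - x)%R)%C x); now apply cont2_conv).
  replace (x - x) with 0 by ring. replace (2 * x - x) with x by ring. ring.
Qed.

Lemma Cder_charV_G Phi (u du : R -> C) x :
  cont2 Phi -> (forall t, Cder u t (du t)) -> contC du ->
  Cder (charV (charG Phi) u) x (charV Phi u x + charV (charG Phi) du x)%C.
Proof.
intros HP Hu Hdu.
assert (Hcu : contC u) by (intros t; eapply Cder_continuous, Hu).
assert (HG := cont2_charG Phi HP).
apply (Cder_ext (fun x => CInt (fun r => charG Phi (x - r)%R r * u (x - 2 * r)%R)%C 0 x)).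
{ intros t. symmetry. now apply charV_reverse. }
rewrite 2!charV_reverse by assumption.
eapply Cder_eq.
- apply (leibniz (fun x r => charG Phi (x - r)%R r * u (x - 2 * r)%R)%C
   (fun x r => Phi (x - r)%R r * u (x - 2 * r)%R + charG Phi (x - r)%R r * du (x - 2 * r)%R)%C
   0 (fun x => x) x 1).
  + intros y t. eapply Cder_eq.
    * apply Cder_mult.
      -- apply (Cder_ext (fun s => charG Phi (1 * s + (- t))%R t)); [intros s; f_equal; ring |].
         apply (Cder_lin (fun s => charG Phi s t)). apply Cder_charG_l, HP.
      -- apply (Cder_ext (fun s => u (1 * s + (- (2 * t)))%R)); [intros s; f_equal; ring |].
         apply Cder_lin. apply Hu.
    * simpl. replace (1 * y + - t) with (y - t) by ring.
      replace (1 * y + - (2 * t)) with (y - 2 * t) by ring. ring.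
  + now apply cont2_conv'.
  + apply cont_Cplus; now apply (cont2_conv' _ _).
  + apply (is_derive_id (K := R_AbsRing)).
- rewrite CInt_plus by (apply (cont2_r (fun x r => _ (x - r)%R r * _ (x - 2 * r)%R)%C x); now apply cont2_conv').
  replace (x - x) with 0 by ring. replace (charG Phi 0 x) with (RtoC 0) by (symmetry; apply CInt_point). ring.
Qed.

Lemma charH_axis g Phi p : charH g Phi p 0 = g p.
Proof.
unfold charH. rewrite (CInt_ext _ (fun _ => RtoC 0)) by (intros; apply CInt_point).
rewrite CInt_const. ring.
Qed.

Definition transmute' (g : R -> C) (Phi : R -> R -> C) (u du : R -> C) (x : R) : C :=
  (du x + 2 * (g x * u x + charV (charG Phi) u x - charV (charH g Phi) du x))%C.

Lemma Cder_transmute g Phi (u du : R -> C) x :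
  contC g -> cont2 Phi ->
  (forall t, Cder u t (du t)) -> contC du ->
  Cder (transmute g Phi u) x (transmute' g Phi u du x).
Proof.
intros Hg HP Hu Hdu. apply Cder_plus; [apply Hu |].
apply Cder_scal. rewrite <- (charH_axis g Phi x). now apply Cder_charV_H.
Qed.

(** The terms with [charG] cancel, so that no second derivative of the kernel is needed. *)
Lemma Cder_transmute' g dg Phi (u du ddu : R -> C) x :
  (forall t, Cder g t (dg t)) -> cont2 Phi ->
  (forall t, Cder u t (du t)) -> (forall t, Cder du t (ddu t)) ->
  contC ddu ->
  Cder (transmute' g Phi u du) x
    (transmute g Phi ddu x + 2 * dg x * u x + 2 * charV Phi u x)%C.
Proof.
intros Hg HP Hu Hdu Hddu.
assert (Hcd : contC du) by (intros t; eapply Cder_continuous, Hdu).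
assert (Hcg : contC g) by (intros t; eapply Cder_continuous, Hg).
eapply Cder_eq.
- apply Cder_plus; [apply Hdu |]. apply Cder_scal. apply Cder_minus.
  + apply Cder_plus; [apply Cder_mult; [apply Hg | apply Hu] |].
    apply Cder_charV_G; eassumption.
  + apply Cder_charV_H; eassumption.
- unfold transmute. rewrite charH_axis. ring.
Qed.

(** For fixed [x = p + v] the kernel is continuously differentiable in [t], although [Phi] is only
    continuous. *)
Lemma Cder_charH_antidiag g dg Phi x s :
  (forall t, Cder g t (dg t)) -> cont2 Phi ->
  Cder (fun s => charH g Phi s (x - s)) s (dg s + (CInt (Phi s) 0 (x - s) - charG Phi s (x - s)))%C.
Proof.
intros Hg HP. apply Cder_plus; [apply Hg |].
assert (HI := cont2_CInt_inner Phi HP).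
eapply Cder_eq.
- apply (leibniz (fun s a => CInt (Phi a) 0 (x - s)) (fun s a => (- Phi a (x - s)%R)%C) 0 (fun s => s) s 1).
  + intros y t. eapply Cder_eq.
    * apply (Cder_ext (fun s => CInt (Phi t) 0 (-1 * s + x))); [intros; f_equal; ring |].
      apply (Cder_lin (fun v => CInt (Phi t) 0 v)). apply Cder_CInt. now apply cont2_r.
    * simpl. replace (-1 * y + x) with (x - y) by ring. apply injective_projections; simpl; ring.
  + apply (cont2_comp (fun a v => CInt (Phi a) 0 v) (fun p : R2 => snd p) (fun p => x - fst p) HI);
     [apply cont_snd | apply cont_Rminus; [apply cont_const | apply cont_fst]].
  + apply cont_Copp. apply (cont2_comp Phi (fun p : R2 => snd p) (fun p => x - fst p) HP);
     [apply cont_snd | apply cont_Rminus; [apply cont_const | apply cont_fst]].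
  + apply (is_derive_id (K := R_AbsRing)).
- assert (CP : contC (fun t => Phi t (x - s))) by (now apply cont2_l).
  rewrite (CInt_ext (fun a => (- Phi a (x - s)%R)%C) (fun a => (RtoC (-1) * Phi a (x - s)%R)%C)) by
    (intros; apply injective_projections; simpl; ring).
  rewrite CInt_scal by exact CP. unfold charG. apply injective_projections; simpl; ring.
Qed.

(** * One-sided derivatives and extension beyond the interval *)

(** A retraction of the line onto [0,b]: composition with it turns continuity relative to the
    interval into continuity on the whole line. *)
Definition clamp (b x : R) : R := Rmax 0 (Rmin x b).

Lemma clamp_id b x : 0 <= x <= b -> clamp b x = x.
Proof. intros H; unfold clamp. rewrite Rmin_left by lra. now rewrite Rmax_right by lra. Qed.

Lemma clamp_Icc b x : 0 <= b -> Icc 0 b (clamp b x).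
Proof.
intros H; unfold clamp, Icc. split; [apply Rmax_l |].
apply Rmax_lub; [exact H | apply Rmin_r].
Qed.

Lemma cont_Rabs {T : UniformSpace} (a : T -> R) :
  contR a -> contR (fun p => Rabs (a p)).
Proof. intros H; apply (cont_comp Rabs a); [intros x; apply continuous_Rabs | exact H]. Qed.

Lemma cont_Rmax {T : UniformSpace} (a b : T -> R) :
  contR a -> contR b ->
  contR (fun p => Rmax (a p) (b p)).
Proof.
intros Ha Hb. apply (cont_ext (V := R_UniformSpace) (fun p => / 2 * (a p + b p + Rabs (a p - b p)))).
{ intros p; unfold Rmax, Rabs; destruct Rle_dec, Rcase_abs; lra. }
apply cont_Rmult; [apply cont_const |].
apply cont_Rplus; [now apply cont_Rplus |]. now apply cont_Rabs, cont_Rminus.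
Qed.

Lemma cont_Rmin {T : UniformSpace} (a b : T -> R) :
  contR a -> contR b ->
  contR (fun p => Rmin (a p) (b p)).
Proof.
intros Ha Hb. apply (cont_ext (V := R_UniformSpace) (fun p => / 2 * (a p + b p - Rabs (a p - b p)))).
{ intros p; unfold Rmin, Rabs; destruct Rle_dec, Rcase_abs; lra. }
apply cont_Rmult; [apply cont_const |].
apply cont_Rminus; [now apply cont_Rplus |]. now apply cont_Rabs, cont_Rminus.
Qed.

Lemma cont_clamp {T : UniformSpace} b (a : T -> R) :
  contR a -> contR (fun p => clamp b (a p)).
Proof.
intros Ha. apply cont_Rmax; [apply cont_const |]. apply cont_Rmin; [exact Ha | apply cont_const].
Qed.

Lemma cont_retract {T U V : UniformSpace} (D : U -> Prop) (F : U -> V) (r : T -> U) :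
  continuous_on D F -> cont r -> (forall p, D (r p)) -> cont (fun p => F (r p)).
Proof.
intros HF Hr HD p. 
apply (filterlim_comp T U V r F (locally p) (within D (locally (r p)))).
- intros P HP. generalize (Hr p _ HP). unfold filtermap. apply filter_imp. intros x Hx. exact (Hx (HD x)).
- exact (HF (r p) (HD p)).
Qed.

(** ** Derivatives relative to a set *)

Lemma is_derive_within_continuous_on D (y y1 : R -> C) :
  (forall x, D x -> is_derive_within D y x (y1 x)) -> Ccontinuous_on D y.
Proof.
intros H x Hx.
apply (filterdiff_continuous_aux (K := R_AbsRing) (U := R_NormedModule) (V := C_R_NormedModule) y
  (F := within D (locally x))).
- eexists; apply (H x Hx).
- intros P HP. now apply (filter_le_within (F := locally x)).
Qed.

Lemma is_derive_within_interior (D : R -> Prop) (y : R -> C) x l :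
  locally x D -> is_derive_within D y x l -> Cder y x l.
Proof.
intros HD [Hl H]. split; [exact Hl |].
intros x' Hx' eps.
assert (Hx2 : is_filter_lim (within D (locally x)) x').
{ intros P HP. apply (filter_le_within (F := locally x)). now apply Hx'. }
generalize (filter_and _ _ HD (H x' Hx2 eps)). apply filter_imp. tauto.
Qed.

Lemma is_derive_within_intro (D : R -> Prop) (y w : R -> C) x l :
  locally x D -> (forall t, D t -> y t = w t) -> Cder w x l -> is_derive_within D y x l.
Proof.
intros HD E H.
assert (PF : ProperFilter (within D (locally x))).
{ split; [| apply within_filter, locally_filter].
  intros P HP. destruct (filter_ex (F := locally x) _ (filter_and _ _ HD HP)) as [t [H1 H2]].
  exists t; now apply H2. }
assert (HL : is_filter_lim (within D (locally x)) x).
{ intros P HP. now apply (filter_le_within (F := locally x)). }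
apply (filterdiff_ext_loc (K := R_AbsRing) (U := R_NormedModule) (V := C_R_NormedModule) w).
- unfold within; apply filter_forall; intros t Ht. symmetry; now apply E.
- intros x' Hx'.
  rewrite (is_filter_lim_unique (K := R_AbsRing) (V := R_NormedModule) x' x Hx' HL).
  symmetry; apply E. now apply (locally_singleton (T := R_UniformSpace)).
- now apply (filterdiff_locally (K := R_AbsRing) (U := R_NormedModule) (V := C_R_NormedModule) w x).
Qed.

Lemma is_derive_within_unique b (y : R -> C) l1 l2 :
  0 < b -> is_derive_within (Icc 0 b) y 0 l1 -> is_derive_within (Icc 0 b) y 0 l2 -> l1 = l2.
Proof.
intros Hb [_ H1] [_ H2].
assert (HL : is_filter_lim (within (Icc 0 b) (locally 0)) 0).
{ intros P HP. now apply (filter_le_within (F := locally 0)). }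
destruct (Ceq_dec l1 l2) as [E|E]; [exact E | exfalso].
assert (Hm : 0 < Cmod (l1 - l2)).
{ apply Cmod_gt_0. intros E2; apply E. replace l1 with (l1 - l2 + l2)%C by ring. rewrite E2; ring. }
assert (He : 0 < Cmod (l1 - l2) / 3) by lra.
destruct (filter_and _ _ (H1 0 HL (mkposreal _ He)) (H2 0 HL (mkposreal _ He))) as [d Hd].
pose (t := Rmin (d / 2) b).
assert (Ht : 0 < t) by (apply Rmin_glb_lt; [pose proof (cond_pos d); lra | lra]).
destruct (Hd t) as [A1 A2].
{ unfold ball; simpl; unfold AbsRing_ball, abs, minus, plus, opp; simpl.
  rewrite Rabs_pos_eq by lra. assert (t <= d / 2) by apply Rmin_l. pose proof (cond_pos d); lra. }
{ split; [lra | apply Rmin_r]. }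
simpl in A1, A2.
assert (N : norm (V := R_NormedModule) (minus (G := R_NormedModule) t 0) = t).
{ unfold norm, minus, plus, opp; simpl. unfold abs; simpl. rewrite Rabs_pos_eq; lra. }
rewrite N in A1, A2.
assert (S : forall l : C, minus (G := C_R_NormedModule) (minus (G := C_R_NormedModule) (y t) (y 0))
   (scal (V := C_R_NormedModule) (minus (G := R_NormedModule) t 0) l) = (y t - y 0 - t * l)%C).
{ intros l. unfold minus, plus, opp, scal; simpl; unfold prod_plus, prod_opp, prod_scal, plus, opp, scal; simpl; unfold mult; simpl.
  apply injective_projections; simpl; ring. }
rewrite norm_Cmod, S in A1, A2.
assert (T : t * Cmod (l1 - l2) <= Cmod (l1 - l2) / 3 * t + Cmod (l1 - l2) / 3 * t).
{ eapply Rle_trans; [| apply Rplus_le_compat; [exact A2 | exact A1]].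
  rewrite <- (Cmod_opp (y t - y 0 - t * l1)).
  eapply Rle_trans; [| apply Cmod_triangle].
  right. rewrite <- (Rabs_pos_eq t) at 1 by lra. rewrite <- Cmod_R, <- Cmod_mult. f_equal. ring. }
nra.
Qed.

Definition fext (b : R) (f : R -> C) (x : R) : C := f (clamp b x).

Lemma fext_id b f x : 0 <= x <= b -> fext b f x = f x.
Proof. intros H; unfold fext; now rewrite clamp_id. Qed.

Lemma locally_Ioo b x : 0 < x < b -> locally x (Ioo 0 b).
Proof.
intros Hx. apply (filter_and (F := locally x) (fun t => 0 < t) (fun t => t < b)).
- apply (open_gt 0 x). apply Hx.
- apply (open_lt b x). apply Hx.
Qed.

Lemma Cder_fext b f x l : 0 < x < b -> Cder f x l -> Cder (fext b f) x l.
Proof.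
intros Hx H. apply (is_derive_ext_loc (K := R_AbsRing) (V := C_R_NormedModule) f); [| exact H].
generalize (locally_Ioo b x Hx). apply filter_imp. intros t [H1 H2].
symmetry; apply fext_id; lra.
Qed.

Lemma Cder_on_Icc b (y y1 : R -> C) :
  0 < b -> (forall x, Icc 0 b x -> is_derive_within (Icc 0 b) y x (y1 x)) ->
  contC (fext b y) /\
  forall x, 0 < x < b -> Cder (fext b y) x (y1 x).
Proof.
intros Hb H. split.
- apply (cont_retract (T := R_UniformSpace) (U := R_UniformSpace) (V := C_UniformSpace) (Icc 0 b) y (clamp b)).
  + now apply (is_derive_within_continuous_on _ _ y1).
  + apply cont_clamp, cont_id.
  + intros p; apply clamp_Icc; lra.
- intros x Hx. apply Cder_fext; [exact Hx |].
  apply (is_derive_within_interior (Icc 0 b)); [| apply H; split; lra].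
  generalize (locally_Ioo b x Hx). apply filter_imp. unfold Ioo, Icc; intros; lra.
Qed.

(** * Reduction of order and formal powers *)

(** Reduction of order: if [f] is a solution of the homogeneous equation, then
    [(y / f)' = (y' f - y f') / f^2] and [(y' f - y f')' = r f]. *)
Lemma reduction_of_order b (q f f1 y y1 r A B : R -> C) :
  contC f -> contC f1 -> (forall x, f x <> RtoC 0) ->
  contC y -> contC y1 ->
  contC A -> contC B ->
  (forall x, 0 < x < b -> Cder f x (f1 x) /\ Cder f1 x (q x * f x)%C) ->
  (forall x, 0 < x < b -> Cder y x (y1 x) /\ Cder y1 x (q x * y x + r x)%C) ->
  (forall x, 0 < x < b -> Cder A x (r x * f x)%C /\ Cder B x (A x / (f x * f x))%C) ->
  f 0 = RtoC 1 -> A 0 = (y1 0 - y 0 * f1 0)%C -> B 0 = y 0 ->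
  forall x, 0 <= x <= b -> y x = (f x * B x)%C.
Proof.
intros Cf Cf1 Hz Cy Cy1 CA CB Hf Hy HA Hf0 HA0 HB0 x Hx.
assert (W : forall t, 0 <= t <= b -> (y1 t * f t - y t * f1 t - A t = 0)%C).
{ intros t Ht.
  assert (Cst := constant_of_derive b (fun t => y1 t * f t - y t * f1 t - A t)%C).
  rewrite Cst with (x := t); [| | | exact Ht].
  - rewrite HA0, Hf0. ring.
  - prove_cont.
  - intros s Hs; destruct (Hf s Hs), (Hy s Hs), (HA s Hs).
    eapply Cder_eq.
    + apply Cder_minus; [apply Cder_minus; apply Cder_mult |]; eassumption.
    + ring. }
assert (V : (y x * / f x - B x = 0)%C).
{ rewrite (constant_of_derive b (fun t => y t * / f t - B t)%C) with (x := x); try exact Hx.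
  - rewrite Hf0, HB0. field.
  - apply cont_Cminus; [apply cont_Cmult; [exact Cy | now apply cont_Cinv] | exact CB].
  - intros s Hs. destruct (Hf s Hs), (Hy s Hs), (HA s Hs).
    eapply Cder_eq.
    + apply Cder_minus; [apply Cder_mult; [eassumption | apply Cder_inv; [apply Hz | eassumption]] | eassumption].
    + assert (E := W s ltac:(lra)).
      transitivity ((y1 s * f s - y s * f1 s - A s) / (f s * f s))%C.
      * field. apply Hz.
      * rewrite E. field. apply Hz. }
transitivity (f x * (y x * / f x - B x + B x))%C; [field; apply Hz | rewrite V; ring].
Qed.

Lemma cont_f2_alt f n : contC f -> (forall x, f x <> RtoC 0) ->
  contC (f2_alt f n).
Proof.
intros Hf Hz. unfold f2_alt; destruct (Nat.even n); [now apply cont_Cpow |].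
apply cont_Cinv; [now apply cont_Cpow |]. intros p. now apply Cpow_nz.
Qed.

Lemma cont_formal_X f n : contC f -> (forall x, f x <> RtoC 0) ->
  contC (formal_X f n).
Proof.
intros Hf Hz; induction n as [|n IH]; [apply cont_const |].
apply cont_Cmult; [apply cont_const |]. apply cont_CInt.
apply cont_Cmult; [exact IH | now apply cont_f2_alt].
Qed.

Lemma cont_formal_Xt f n : contC f -> (forall x, f x <> RtoC 0) ->
  contC (formal_Xt f n).
Proof.
intros Hf Hz; induction n as [|n IH]; [apply cont_const |].
apply cont_Cmult; [apply cont_const |]. apply cont_CInt.
apply cont_Cmult; [exact IH | now apply cont_f2_alt].
Qed.

Lemma Cder_formal_X f n x : contC f -> (forall x, f x <> RtoC 0) ->
  Cder (formal_X f (S n)) x (INR (S n) * (formal_X f n x * f2_alt f (S n) x))%C.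
Proof.
intros Hf Hz. apply Cder_scal. apply (Cder_CInt (fun s => formal_X f n s * f2_alt f (S n) s)%C).
apply cont_Cmult; [now apply cont_formal_X | now apply cont_f2_alt].
Qed.

Lemma Cder_formal_Xt f n x : contC f -> (forall x, f x <> RtoC 0) ->
  Cder (formal_Xt f (S n)) x (INR (S n) * (formal_Xt f n x * f2_alt f n x))%C.
Proof.
intros Hf Hz. apply Cder_scal. apply (Cder_CInt (fun s => formal_Xt f n s * f2_alt f n s)%C).
apply cont_Cmult; [now apply cont_formal_Xt | now apply cont_f2_alt].
Qed.

Definition formal_power (f : R -> C) (k : nat) (x : R) : C :=
  if Nat.odd k then formal_X f k x else formal_Xt f k x.

Lemma cont_formal_power f k : contC f -> (forall x, f x <> RtoC 0) -> contC (formal_power f k).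
Proof.
intros Hf Hz. unfold formal_power. destruct (Nat.odd k); [now apply cont_formal_X | now apply cont_formal_Xt].
Qed.

Lemma formal_power_fext b f n x : 0 <= x <= b -> formal_power f n x = formal_power (fext b f) n x.
Proof.
assert (E : forall i, (0 <= x <= b -> formal_X f i x = formal_X (fext b f) i x) /\
  (0 <= x <= b -> formal_Xt f i x = formal_Xt (fext b f) i x)).
{ intros i. revert x. induction i as [|i IH]; intros x; [now split |].
  split; intros Hx; simpl; f_equal; apply CInt_ext; intros s Hs; rewrite Rmin_left, Rmax_right in Hs by lra;
    rewrite (proj1 (IH s)) || rewrite (proj2 (IH s)); try lra;
    unfold f2_alt, fext; now rewrite clamp_id by lra. }
intros Hx. unfold formal_power. now rewrite (proj1 (E n)), (proj2 (E n)).
Qed.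

Lemma formal_power_0 f n : formal_power f (S n) 0 = RtoC 0.
Proof. unfold formal_power. destruct (Nat.odd (S n)); simpl; rewrite CInt_point; ring. Qed.

(** Two integrations lead from one formal power to the next one of the same parity; they pass
    through a power [Q] of the other family. *)
Lemma formal_power_step f m : contC f -> (forall x, f x <> RtoC 0) ->
  exists Q, contC Q /\ Q 0 = RtoC 0 /\ forall x,
    Cder Q x (INR (S m) * (formal_power f m x * f x ^ 2))%C /\
    Cder (formal_power f (S (S m))) x (INR (S (S m)) * (Q x / (f x * f x)))%C.
Proof.
intros Hf Hz. unfold formal_power. change (Nat.odd (S (S m))) with (Nat.odd m).
assert (I : forall x, (/ f x ^ 2 = / (f x * f x))%C) by (intros x; f_equal; ring).
assert (Ev := Nat.negb_odd m). destruct (Nat.odd m) eqn:Om; simpl in Ev.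
- exists (formal_X f (S m)). split; [now apply cont_formal_X |]. split; [simpl; rewrite CInt_point; ring |].
  intros x. split.
  + eapply Cder_eq; [now apply Cder_formal_X |]. unfold f2_alt. now rewrite Nat.even_succ, Om.
  + eapply Cder_eq; [now apply Cder_formal_X |]. unfold f2_alt.
    change (Nat.even (S (S m))) with (Nat.even m). now rewrite <- Ev, I.
- exists (formal_Xt f (S m)). split; [now apply cont_formal_Xt |]. split; [simpl; rewrite CInt_point; ring |].
  intros x. split.
  + eapply Cder_eq; [now apply Cder_formal_Xt |]. unfold f2_alt. now rewrite <- Ev.
  + eapply Cder_eq; [now apply Cder_formal_Xt |]. unfold f2_alt. now rewrite Nat.even_succ, Om, I.
Qed.

(** * Compact sets of complex numbers *)

Lemma Ccompact_bounded S : Ccompact S -> exists r, forall z, S z -> Cmod z <= r.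
Proof.
intros HS.
destruct (HS nat (fun n z => Cmod z < INR n)) as [l Hl].
- intros n z Hz.
  assert (Hd : 0 < INR n - Cmod z) by lra.
  assert (Hc : continuous (T := C_UniformSpace) (fun z : C => norm (z : C_R_NormedModule)) z).
  { apply (filterlim_norm (V := C_R_NormedModule)). }
  generalize (proj1 (filterlim_locally _ _) Hc (mkposreal _ Hd)). apply filter_imp.
  intros w Hw. unfold ball in Hw; simpl in Hw; unfold AbsRing_ball, abs, minus, plus, opp in Hw; simpl in Hw.
  rewrite 2!norm_Cmod in Hw. apply Rabs_def2 in Hw. lra.
- intros z _. destruct (nfloor_ex (Cmod z) (Cmod_ge_0 z)) as [n [_ Hn]].
  exists (Datatypes.S n). rewrite S_INR. exact Hn.
- exists (fold_right Rmax 0 (map INR l)). intros z Hz. destruct (Hl z Hz) as (n & Hin & Hn).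
  apply Rlt_le in Hn. apply Rle_trans with (1 := Hn). clear -Hin.
  induction l as [|m l IH]; [destruct Hin |]. simpl. destruct Hin as [-> | Hin]; [apply Rmax_l |].
  eapply Rle_trans; [now apply IH | apply Rmax_r].
Qed.

(** * The transmutation operator and its kernel *)

Section Transmutation.

Context (b : R) (q f : R -> C) (h : C) (K : R -> R -> C).
Context (hb : 0 < b) (hq : Ccontinuous_on (Icc 0 b) q).
Context (hK : is_transmutation_kernel b q h K).

(** ** Extension of the data to the whole plane *)

Definition qext (x : R) : C := q (clamp b x).

(** In the coordinates [a = (x+t)/2], [c = (x-t)/2] the kernel lives on the triangle
    [0 <= a], [0 <= c], [a + c <= b]. Retracting the plane onto this triangle makes the
    double integrand [q(a+c) K(a+c,a-c)] a continuous function of the plane, so that no boundary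
    has to be watched when its integrals are differentiated. *)
Definition source (a c : R) : C :=
  let a' := clamp b a in
  let c' := clamp (b - a') c in
  (qext (a + c) * K (a' + c')%R (a' - c')%R)%C.

(** The values of the kernel on the characteristic [t = x]. *)
Definition trace (x : R) : C := (h / 2 + / 2 * CInt qext 0 x)%C.

Definition Kext (x t : R) : C := charH trace source ((x + t) / 2) ((x - t) / 2).

Lemma cont_qext : contC qext.
Proof.
apply (cont_retract (T := R_UniformSpace) (U := R_UniformSpace) (V := C_UniformSpace) (Icc 0 b) q (clamp b)).
- exact hq.
- apply cont_clamp, cont_id.
- intros p; apply clamp_Icc; lra.
Qed.

Lemma qext_id x : 0 <= x <= b -> qext x = q x.
Proof. intros H; unfold qext; now rewrite clamp_id. Qed.

Lemma cont2_source : cont2 source.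
Proof.
destruct hK as [HK _]. apply cont_Cmult.
- apply (cont_comp qext); [exact cont_qext | prove_cont].
- assert (Ha : contR (fun p : R2 => clamp b (fst p))) by apply cont_clamp, cont_fst.
  assert (Hc : contR (fun p : R2 => clamp (b - clamp b (fst p)) (snd p))).
  { apply cont_Rmax; [apply cont_const |]. apply cont_Rmin; prove_cont. }
  apply (cont_retract (T := R2) (U := R2) (V := C_UniformSpace) (triangle b)
    (fun p => K (fst p) (snd p))
    (fun p => let a' := clamp b (fst p) in let c' := clamp (b - a') (snd p) in (a' + c', a' - c'))).
  + exact HK.
  + apply (cont_comp2 (U := R_UniformSpace) (V := R_UniformSpace) (W := R2) (fun u v => (u, v)));
      [| prove_cont | prove_cont].
    apply (cont_ext (fun p => p)); [now intros [] | apply cont_id].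
  + intros [x y]; unfold triangle; simpl.
    destruct (clamp_Icc b x ltac:(lra)) as [H1 H2].
    destruct (clamp_Icc (b - clamp b x) y ltac:(lra)) as [H3 H4].
    split; [lra |]. apply Rabs_le; lra.
Qed.

Lemma Kext_eq x t : 0 <= x <= b -> Rabs t <= x -> K x t = Kext x t.
Proof.
intros Hx Ht. rewrite (proj2 hK) by (split; assumption).
apply Rabs_le_between in Ht.
unfold Kext, charH, trace. f_equal; [f_equal; f_equal |].
- apply CInt_ext. intros s Hs. rewrite Rmin_left, Rmax_right in Hs by lra.
  symmetry; apply qext_id; lra.
- apply CInt_ext. intros a Ha. rewrite Rmin_left, Rmax_right in Ha by lra.
  apply CInt_ext. intros c Hc. rewrite Rmin_left, Rmax_right in Hc by lra.
  unfold source. now rewrite qext_id, (clamp_id b), clamp_id by lra.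
Qed.

Lemma source_eq a c : 0 <= a -> 0 <= c -> a + c <= b ->
  source a c = (q (a + c)%R * charH trace source a c)%C.
Proof.
intros Ha Hc Hac. unfold source at 1.
rewrite qext_id, (clamp_id b), clamp_id by lra.
f_equal. rewrite Kext_eq by (try apply Rabs_le; lra).
unfold Kext. f_equal; field.
Qed.

Lemma Cder_trace x : Cder trace x (/ 2 * qext x)%C.
Proof.
eapply Cder_eq.
- apply Cder_plus; [apply Cder_const |]. apply Cder_scal, Cder_CInt, cont_qext.
- ring.
Qed.

Lemma cont2_kernel : cont2 (charH trace source).
Proof. apply cont2_charH; [exact (Cder_cont _ _ Cder_trace) | exact cont2_source]. Qed.

Lemma cont2_Kext : cont2 Kext.
Proof.
apply (cont2_comp _ (fun p : R2 => (fst p + snd p) / 2) (fun p => (fst p - snd p) / 2) cont2_kernel); prove_cont.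
Qed.

(** ** The transmutation operator on twice differentiable functions *)

Definition Tr (u : R -> C) : R -> C := transmute trace source u.

Definition Tr' (u du : R -> C) : R -> C := transmute' trace source u du.

Lemma Tr_eq (u : R -> C) x : contC u ->
  Tr u x = (u x + CInt (fun t => Kext x t * u t)%C (- x) x)%C.
Proof.
intros Hu. unfold Tr, transmute. f_equal. unfold charV.
assert (Hc : contC (fun t : R => Kext x t * u t)%C) by (apply cont_Cmult; [exact (cont2_r _ x cont2_Kext) | exact Hu]).
assert (E := CInt_comp_lin (fun t : R => Kext x t * u t)%C 2 (- x) 0 x Hc).
replace (2 * 0 + - x) with (- x) in E by ring. replace (2 * x + - x) with x in E by ring.
rewrite E. f_equal. apply CInt_ext; intros p _. unfold Kext.
replace ((x + (2 * p + - x)) / 2) with p by field.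
now replace ((x - (2 * p + - x)) / 2) with (x - p) by field.
Qed.

Lemma Tr_kernel (u : R -> C) x : contC u -> 0 <= x <= b ->
  Tr u x = (u x + CInt (fun t => K x t * u t)%C (- x) x)%C.
Proof.
intros Hu Hx. rewrite Tr_eq by exact Hu. f_equal. apply CInt_ext.
intros t. rewrite Rmin_left, Rmax_right by lra. intros Ht.
f_equal. symmetry. apply Kext_eq; [exact Hx | apply Rabs_le; lra].
Qed.

Lemma Cder_Tr (u du : R -> C) x : (forall t, Cder u t (du t)) -> contC du ->
  Cder (Tr u) x (Tr' u du x).
Proof. exact (Cder_transmute trace source u du x (Cder_cont _ _ Cder_trace) cont2_source). Qed.

Lemma Cder_Tr'_ext (u du ddu : R -> C) x :
  (forall t, Cder u t (du t)) -> (forall t, Cder du t (ddu t)) -> contC ddu ->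
  Cder (Tr' u du) x (Tr ddu x + 2 * (/ 2 * qext x) * u x + 2 * charV source u x)%C.
Proof. exact (Cder_transmute' trace (fun t => / 2 * qext t)%C source u du ddu x Cder_trace cont2_source). Qed.

(** [T] intertwines [- d^2/dx^2] with [- d^2/dx^2 + q]: on [0,b] the source along the segment
    [a + c = x] is [q(x)] times the kernel. *)
Lemma Cder_Tr' (u du ddu : R -> C) x :
  (forall t, Cder u t (du t)) -> (forall t, Cder du t (ddu t)) -> contC ddu -> 0 <= x <= b ->
  Cder (Tr' u du) x (q x * Tr u x + Tr ddu x)%C.
Proof.
intros Hu Hdu Hddu Hx. eapply Cder_eq; [now apply Cder_Tr'_ext |].
assert (E : charV source u x = (q x * charV (charH trace source) u x)%C).
{ unfold charV. rewrite <- CInt_scal.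
  - apply CInt_ext. intros p Hp. rewrite Rmin_left, Rmax_right in Hp by lra.
    rewrite source_eq by lra. replace (p + (x - p)) with x by ring. ring.
  - apply (cont2_r (fun x p => _ p (x - p)%R * _ (2 * p - x)%R)%C x).
    apply cont2_conv; [exact cont2_kernel | exact (Cder_cont _ _ Hu)]. }
rewrite E, qext_id by exact Hx. unfold Tr, transmute. field.
Qed.

Lemma Tr_0 u : Tr u 0 = u 0.
Proof. unfold Tr, transmute, charV. rewrite CInt_point. ring. Qed.

Lemma Tr'_0 u du : Tr' u du 0 = (du 0 + h * u 0)%C.
Proof. unfold Tr', transmute', charV, trace. rewrite !CInt_point. field. Qed.

Lemma Tr_ext (u v : R -> C) x : (forall t, u t = v t) -> Tr u x = Tr v x.
Proof.
intros E. unfold Tr, transmute, charV. rewrite E. f_equal. f_equal.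
apply CInt_ext; intros t _. now rewrite E.
Qed.

Lemma Tr_scal c (u : R -> C) x : contC u -> Tr (fun t => c * u t)%C x = (c * Tr u x)%C.
Proof.
intros Hu. rewrite 2!Tr_eq by prove_cont.
transitivity (c * u x + CInt (fun t => c * (Kext x t * u t))%C (- x) x)%C.
- f_equal. apply CInt_ext; intros; ring.
- rewrite CInt_scal; [ring |]. apply cont_Cmult; [exact (cont2_r _ x cont2_Kext) | exact Hu].
Qed.

Lemma Tr_solution (u du : R -> C) lam y :
  (forall t, Cder u t (du t)) -> (forall t, Cder du t (- lam * u t)%C) ->
  (forall x, 0 <= x <= b -> y x = Tr u x) -> schrodinger_solution (Ioo 0 b) q lam y.
Proof.
intros Hu Hdu Hy.
assert (Cu := Cder_cont _ _ Hu). assert (Cdu := Cder_cont _ _ Hdu).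
exists (Tr' u du), (fun x => q x * Tr u x + Tr (fun t => - lam * u t) x)%C.
intros x Hx. assert (HL := locally_Ioo b x Hx). destruct Hx as [Hx0 Hxb]. split; [| split].
- apply (is_derive_within_intro _ _ (Tr u)); [exact HL | | now apply Cder_Tr].
  intros t [Ht0 Htb]. apply Hy; lra.
- apply (is_derive_within_intro _ _ (Tr' u du)); [exact HL | reflexivity |].
  apply Cder_Tr'; auto; [prove_cont | lra].
- rewrite Tr_scal, Hy by (assumption || lra). ring.
Qed.

(** ** Images of the powers *)

Context (hf : schrodinger_solution (Icc 0 b) q (RtoC 0) f).
Context (hf_nz : forall x : R, Icc 0 b x -> f x <> RtoC 0).
Context (hf0 : f 0 = RtoC 1) (hh : is_derive_within (Icc 0 b) f 0 h).

(** The image of [t^k] solves [y'' - q y = k (k-1) T(t^(k-2))] with the initial values of [t^k]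
    (perturbed by [h] when [k = 0]); the reduction of order integrates this equation exactly as
    the recursion of the formal powers does. *)
Lemma Tr_pow k : forall x, 0 <= x <= b -> Tr (fun t => RtoC t ^ k)%C x = phi f k x.
Proof.
destruct hf as (f1 & f2 & Hf).
assert (Hf1 : f1 0 = h).
{ apply (is_derive_within_unique b f); auto. apply Hf. split; lra. }
assert (Hq2 : forall x, Icc 0 b x -> f2 x = (q x * f x)%C).
{ intros x Hx. destruct (Hf x Hx) as (_ & _ & E).
  transitivity (- (- f2 x + q x * f x) + q x * f x)%C; [ring | rewrite E; ring]. }
destruct (Cder_on_Icc b f f1 hb) as [CF DF]; [intros; now apply Hf |].
destruct (Cder_on_Icc b f1 f2 hb) as [CF1 DF1]; [intros; now apply Hf |].
set (F := fext b f) in *.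
assert (Hz : forall x, F x <> RtoC 0) by (intros x; apply hf_nz, clamp_Icc; lra).
assert (Step : forall (j : nat) (A B r : R -> C), contC A -> contC B ->
  (forall x, 0 < x < b -> Cder A x (r x * F x)%C /\ Cder B x (A x / (F x * F x))%C) ->
  (forall x, 0 < x < b -> Tr (fun t => INR j * (INR (pred j) * RtoC t ^ pred (pred j)))%C x = r x) ->
  A 0 = (INR j * RtoC 0 ^ pred j)%C -> B 0 = (RtoC 0 ^ j)%C ->
  forall x, 0 <= x <= b -> Tr (fun t => RtoC t ^ j)%C x = (f x * B x)%C).
{ intros j A B r CA CB HA Hr HA0 HB0 x Hx.
  set (u := fun t : R => (RtoC t ^ j)%C). set (du := fun t : R => (INR j * RtoC t ^ pred j)%C).
  set (ddu := fun t : R => (INR j * (INR (pred j) * RtoC t ^ pred (pred j)))%C).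
  assert (Du : forall t : R, Cder u t (du t)) by (intros t; apply Cder_pow).
  assert (Ddu : forall t : R, Cder du t (ddu t)) by (intros t; apply Cder_scal, Cder_pow).
  assert (Cdu := Cder_cont _ _ Ddu). assert (Cddu : contC ddu) by (unfold ddu; prove_cont).
  rewrite <- (fext_id b f x Hx).
  refine (reduction_of_order b q F (fext b f1) (Tr u) (Tr' u du) r A B CF CF1 Hz _ _ CA CB _ _ HA _ _ _ x Hx).
  - apply (Cder_cont _ (Tr' u du)). intros t; now apply Cder_Tr.
  - apply (Cder_cont _ _ (fun t => Cder_Tr'_ext u du ddu t Du Ddu Cddu)).
  - intros t Ht. unfold F. split.
    + rewrite fext_id by lra. now apply DF.
    + rewrite fext_id, <- Hq2 by (unfold Icc; lra). now apply DF1.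
  - intros t Ht. split; [now apply Cder_Tr |]. rewrite <- (Hr t Ht).
    apply Cder_Tr'; auto; lra.
  - unfold F. rewrite fext_id by lra. exact hf0.
  - rewrite Tr'_0, Tr_0, fext_id, HA0, Hf1 by lra. unfold u, du. ring.
  - now rewrite Tr_0, HB0. }
assert (T0 : forall c (u : R -> C) x, c = RtoC 0 -> contC u -> Tr (fun t => c * u t)%C x = RtoC 0).
{ intros c u x -> Hu. rewrite Tr_scal by assumption. ring. }
induction k as [k IH] using (well_founded_induction lt_wf). intros x Hx.
destruct k as [|[|m]]; unfold phi.
- apply (Step 0%nat (fun _ => RtoC 0) (fun _ => RtoC 1) (fun _ => RtoC 0)); try apply cont_const; trivial.
  + intros t Ht. split; (eapply Cder_eq; [apply Cder_const |]); [ring | field; apply Hz].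
  + intros t Ht. apply (T0 _ (fun t => INR 0 * RtoC t ^ 0)%C); [reflexivity | prove_cont].
  + simpl; ring.
- change (Tr (fun t => RtoC t ^ 1)%C x = (f x * formal_power f 1 x)%C).
  rewrite (formal_power_fext b) by exact Hx. fold F.
  apply (Step 1%nat (fun _ => RtoC 1) (formal_power F 1) (fun _ => RtoC 0)); trivial.
  + apply cont_const.
  + now apply cont_formal_power.
  + intros t Ht. split.
    * eapply Cder_eq; [apply Cder_const | ring].
    * eapply Cder_eq; [now apply (Cder_formal_X F 0 t) |].
      unfold f2_alt; simpl. field. apply Hz.
  + intros t Ht. transitivity (Tr (fun t => RtoC 0 * (INR 1 * RtoC t ^ 0))%C t).
    * apply Tr_ext. intros; simpl; ring.
    * apply (T0 _ (fun t => INR 1 * RtoC t ^ 0)%C); [reflexivity | prove_cont].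
  + simpl; ring.
  + rewrite formal_power_0. simpl; ring.
- assert (Hr : forall t, 0 < t < b ->
    Tr (fun t => INR (S (S m)) * (INR (pred (S (S m))) * RtoC t ^ pred (pred (S (S m)))))%C t
    = (INR (S (S m)) * (INR (S m) * phi f m t))%C).
  { intros t Ht. simpl pred.
    rewrite (Tr_scal _ (fun t => INR (S m) * RtoC t ^ m)%C) by prove_cont.
    rewrite (Tr_scal _ (fun t => RtoC t ^ m)%C) by prove_cont.
    rewrite IH by (lia || lra). reflexivity. }
  change (Tr (fun t => RtoC t ^ S (S m))%C x = (f x * formal_power f (S (S m)) x)%C).
  rewrite (formal_power_fext b) by exact Hx. fold F.
  destruct (formal_power_step F m CF Hz) as (Q & CQ & Q0 & DQ).
  apply (Step (S (S m)) (fun t => INR (S (S m)) * Q t)%C (formal_power F (S (S m))) _) with (4 := Hr); try exact Hx.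
  + prove_cont.
  + now apply cont_formal_power.
  + intros t Ht. destruct (DQ t) as [D1 D2]. split.
    * eapply Cder_eq; [apply Cder_scal, D1 |].
      change (phi f m t) with (f t * formal_power f m t)%C.
      unfold F. rewrite <- formal_power_fext, fext_id by lra. simpl; ring.
    * eapply Cder_eq; [exact D2 |]. unfold Cdiv; ring.
  + rewrite Q0. simpl; ring.
  + rewrite formal_power_0. simpl; ring.
Qed.

(** ** Legendre coefficients of the kernel *)

(** The kernel on the segment [|t| <= x], rescaled to [-1,1]. *)
Definition kslice (x y : R) : C := Kext x (x * y).

Definition kcoef (x : R) (j : nat) : C :=
  (RtoC ((2 * INR j + 1) / 2) * CInt (fun y => kslice x y * legendre j y) (-1) 1)%C.

Definition kpartial (x : R) (N : nat) (y : R) : C :=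
  Csum (fun j => kcoef x j * RtoC (legendre j y))%C N.

Lemma cont_kslice x : contC (kslice x).
Proof. apply (cont_comp (Kext x) (fun y : R_UniformSpace => x * y)); [exact (cont2_r _ x cont2_Kext) | prove_cont]. Qed.

Lemma cont_kpartial x N : contC (fun y : R => kpartial x N y).
Proof.
unfold kpartial. induction N as [|N IH].
- apply (cont_ext (V := C_UniformSpace) (fun y : R => kcoef x 0 * RtoC (legendre 0 y))%C); [| prove_cont].
  intros y. now rewrite Csum_O.
- apply (cont_ext (V := C_UniformSpace) (fun y : R =>
    Csum (fun j => kcoef x j * RtoC (legendre j y)) N + kcoef x (S N) * RtoC (legendre (S N) y))%C); [| prove_cont].
  intros y. now rewrite Csum_S.
Qed.

Lemma kslice_bounded :
  exists M, 0 <= M /\ forall x y, 0 <= x <= b -> -1 <= y <= 1 -> Cmod (kslice x y) <= M.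
Proof.
destruct (bounded_2d (fun x t => Re (Kext x t)) b hb) as [M1 H1].
{ apply cont_2d, (cont_Re _ cont2_Kext). }
destruct (bounded_2d (fun x t => Im (Kext x t)) b hb) as [M2 H2].
{ apply cont_2d, (cont_Im _ cont2_Kext). }
assert (B : forall x y, 0 <= x <= b -> -1 <= y <= 1 -> Cmod (kslice x y) <= M1 + M2).
{ intros x y Hx Hy. eapply Rle_trans; [apply Cmod_le_Re_Im |].
  assert (-b <= x * y <= b) by nra.
  apply Rplus_le_compat; [apply H1 | apply H2]; lra. }
exists (M1 + M2). split; [| exact B].
eapply Rle_trans; [apply Cmod_ge_0 | apply (B 0 0); lra].
Qed.

Lemma kcoef_bound M x j : 0 <= x <= b ->
  (forall x y, 0 <= x <= b -> -1 <= y <= 1 -> Cmod (kslice x y) <= M) ->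
  Cmod (kcoef x j) <= (2 * INR j + 1) * M.
Proof.
intros Hx HM. unfold kcoef. rewrite Cmod_mult, Cmod_R.
assert (Hj := pos_INR j). rewrite Rabs_pos_eq by lra.
assert (B : Cmod (CInt (fun y => kslice x y * legendre j y)%C (-1) 1) <= Rabs (1 - -1) * M).
{ apply CInt_norm_le_const.
  - apply cont_Cmult; [apply cont_kslice | apply cont_legendre_C].
  - intros y. rewrite Rmin_left, Rmax_right by lra. intros Hy. rewrite Cmod_mult, Cmod_R.
    rewrite <- (Rmult_1_r M). apply Rmult_le_compat; [apply Cmod_ge_0 | apply Rabs_pos | now apply HM | now apply legendre_bound]. }
rewrite Rabs_pos_eq in B by lra.
apply Rle_trans with ((2 * INR j + 1) / 2 * ((1 - -1) * M)); [apply Rmult_le_compat_l; lra | lra].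
Qed.

(** The formula [T(t^n) = phi_n], read on the rescaled segment. *)
Lemma kernel_moment x n : 0 < x <= b ->
  (x * CInt (fun y => kslice x y * RtoC y ^ n) (-1) 1)%C = (phi f n x / x ^ n - 1)%C.
Proof.
intros Hx.
assert (Hx0 : RtoC x <> RtoC 0) by (intros E; apply RtoC_inj in E; lra).
assert (CK := cont2_r _ x cont2_Kext).
rewrite <- Tr_pow, Tr_eq by (prove_cont || lra).
rewrite CInt_rescale by prove_cont.
transitivity (RtoC x * (RtoC x ^ n * CInt (fun y => kslice x y * RtoC y ^ n) (-1) 1) / RtoC x ^ n)%C.
- field. now apply Cpow_nz.
- rewrite <- CInt_scal by (apply cont_Cmult; [apply cont_kslice | apply cont_pow]).
  rewrite (CInt_ext (fun y => RtoC x ^ n * (kslice x y * RtoC y ^ n))%C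
    (fun y => Kext x (x * y) * RtoC (x * y) ^ n)%C).
  + field. now apply Cpow_nz.
  + intros y _. rewrite RtoC_mult, Cpow_mult_l. unfold kslice. ring.
Qed.

(** Expanding [y^k] in Legendre polynomials expresses the moments through the coefficients. This
    triangular system is the one solved by the recursion of the [beta_k]. *)
Lemma kernel_moment_coef x k :
  CInt (fun y => kslice x y * RtoC y ^ k)%C (-1) 1 = Csum (fun j => p_coef j k * kcoef x j)%C k.
Proof.
rewrite (CInt_ext _ (fun y => kslice x y * RtoC (lsum (fun y => y ^ k)%R k y))%C).
- rewrite CInt_lsum by apply cont_kslice. apply Csum_ext. intros j _.
  unfold kcoef, lcoef. replace (ip (fun y => y ^ k) (legendre j)) with (p_coef j k).
  + rewrite RtoC_mult. ring.
  + apply RInt_ext_R. intros; ring.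
- intros y _. rewrite in_span_lsum_id by apply in_span_monomial. now rewrite RtoC_pow.
Qed.

Lemma beta_eq_pos x k : 0 < x <= b -> beta f k x = (x * kcoef x k)%C.
Proof.
intros Hx.
assert (Hx0 : RtoC x <> RtoC 0) by (intros E; apply RtoC_inj in E; lra).
induction k as [k IH] using (well_founded_induction lt_wf).
rewrite beta_rec by lra.
assert (M := kernel_moment x k Hx). rewrite kernel_moment_coef in M.
destruct k as [|[|m]]; unfold beta_step.
- rewrite Csum_O in M. unfold phi in M; simpl in M.
  assert (E : p_coef 0 0 = 2) by (rewrite p_coef_0; simpl; field).
  rewrite E in M.
  transitivity (RtoC x * (2 * kcoef x 0) / 2)%C; [rewrite M |]; field.
- rewrite Csum_S, Csum_O in M.
  assert (E : p_coef 0 1 = 0) by (apply p_coef_parity; [lia | reflexivity]).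
  assert (E1 : p_coef 1 1 = 2 / 3) by (rewrite p_coef_1, p_coef_0; simpl; field).
  rewrite E, E1 in M. simpl (RtoC x ^ 1)%C in M.
  transitivity (3 / 2 * (phi f 1 x / (x * 1) - 1))%C; [field; exact Hx0 |].
  rewrite <- M. rewrite RtoC_div by lra. field.
- rewrite 2!Csum_S in M.
  rewrite (p_coef_parity (S m)) in M.
  2: lia.
  2: { rewrite Nat.even_succ, <- Nat.negb_even. change (Nat.even (S (S m))) with (Nat.even m). now destruct (Nat.even m). }
  rewrite <- M.
  rewrite (Csum_ext (fun j => if Bool.eqb (Nat.even j) (Nat.even (S (S m)))
                         then p_coef j (S (S m)) * beta f j x else 0)%C
    (fun j => RtoC x * (p_coef j (S (S m)) * kcoef x j))%C).
  + rewrite Csum_scal. field. intros E; apply RtoC_inj in E. now apply (p_coef_diag (S (S m))).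
  + intros j Hj. destruct (Bool.eqb (Nat.even j) (Nat.even (S (S m)))) eqn:Ep.
    * rewrite IH by lia. ring.
    * rewrite (p_coef_parity j) by (lia || exact Ep). ring.
Qed.

(** At the origin both sides vanish, since the coefficients of the slices stay bounded. *)
Lemma beta_eq x k : 0 <= x <= b -> beta f k x = (x * kcoef x k)%C.
Proof.
intros Hx. destruct (Req_dec x 0) as [-> | Hx0]; [| apply beta_eq_pos; lra].
rewrite Cmult_0_l. unfold beta. destruct (Req_EM_T 0 0) as [_ | E]; [| now elim E].
apply (iota_filterlim_locally (V := C_R_CompleteNormedModule) (F := at_right 0)).
destruct kslice_bounded as (M & HM0 & HM).
set (B := (2 * INR k + 1) * M + 1).
assert (HB : 0 < B) by (pose proof (pos_INR k); unfold B; nra).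
apply (filterlim_locally (U := C_UniformSpace)). intros eps.
assert (Hd : 0 < Rmin b (eps / B)) by (apply Rmin_glb_lt; [exact hb | apply Rdiv_lt_0_compat; [apply cond_pos | exact HB]]).
exists (mkposreal _ Hd). intros y Hy Hy0.
assert (Hy1 : y < Rmin b (eps / B)).
{ unfold ball in Hy; simpl in Hy; unfold AbsRing_ball, abs, minus, plus, opp in Hy; simpl in Hy.
  apply Rabs_def2 in Hy. lra. }
assert (Hyb := Rmin_l b (eps / B)). assert (Hye := Rmin_r b (eps / B)).
apply (norm_compat1 (V := C_R_NormedModule)). rewrite norm_Cmod.
change (Cmod (beta_pos f k y - 0)%C < eps).
assert (E : beta_pos f k y = (y * kcoef y k)%C).
{ rewrite <- beta_eq_pos by lra. unfold beta. destruct (Req_EM_T y 0); [lra | reflexivity]. }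
replace (beta_pos f k y - 0)%C with (y * kcoef y k)%C by (rewrite E; ring).
rewrite Cmod_mult, Cmod_R, Rabs_pos_eq by lra.
assert (Bk := kcoef_bound M y k ltac:(lra) HM).
apply Rle_lt_trans with (y * B); [apply Rmult_le_compat_l; unfold B; lra |].
apply Rlt_div_r; lra.
Qed.

(** ** Uniform convergence of the expansion *)

(** The uniform convergence theorem is about real functions; it is applied to both
    components. *)
Lemma kpartial_eq x N y :
  kpartial x N y = (lsum (fun y => Re (kslice x y)) N y, lsum (fun y => Im (kslice x y)) N y).
Proof.
assert (E : forall j, kcoef x j =
  (lcoef (fun y => Re (kslice x y)) j, lcoef (fun y => Im (kslice x y)) j)).
{ intros j. unfold kcoef. rewrite CInt_legendre_pair by apply cont_kslice.
  unfold lcoef. apply injective_projections; simpl; ring. }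
apply injective_projections.
- change (Re (kpartial x N y) = lsum (fun y => Re (kslice x y)) N y).
  unfold kpartial. rewrite Csum_Re. apply sum_eq. intros j _. rewrite E. simpl; ring.
- change (Im (kpartial x N y) = lsum (fun y => Im (kslice x y)) N y).
  unfold kpartial. rewrite Csum_Im. apply sum_eq. intros j _. rewrite E. simpl; ring.
Qed.

Lemma K_trunc_eq x N y : 0 < x <= b -> K_trunc f N x (x * y) = kpartial x N y.
Proof.
intros Hx. unfold K_trunc, kpartial. apply Csum_ext. intros j _.
rewrite beta_eq by lra. replace (x * y / x) with y by (field; lra). field.
intros E; apply RtoC_inj in E; lra.
Qed.

Lemma Cder_kslice x : exists dk, contC dk /\ forall y, Cder (kslice x) y (dk y).
Proof.
set (D := fun s : R => (/ 2 * qext s + (CInt (source s) 0 (x - s) - charG source s (x - s)))%C).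
assert (HD : contC D).
{ assert (Cxs : contR (fun s : R => x - s)) by prove_cont.
  assert (C1 := cont2_comp _ (fun s : R_UniformSpace => s) (fun s => x - s) (cont2_CInt_inner _ cont2_source) cont_id Cxs).
  assert (C2 := cont2_comp _ (fun s : R_UniformSpace => s) (fun s => x - s) (cont2_charG _ cont2_source) cont_id Cxs).
  assert (C3 := cont_qext). unfold D. prove_cont. }
exists (fun y => RtoC (x / 2) * D (x / 2 * y + x / 2)%R)%C. split.
- apply cont_Cmult; [apply cont_const |].
  apply (cont_comp D (fun y : R_UniformSpace => x / 2 * y + x / 2)); [exact HD | prove_cont].
- intros y.
  apply (Cder_ext (fun y => charH trace source (x / 2 * y + x / 2) (x - (x / 2 * y + x / 2)))).
  + intros t. unfold kslice, Kext. f_equal; field.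
  + apply (Cder_lin (fun s => charH trace source s (x - s))).
    exact (Cder_charH_antidiag trace (fun t => / 2 * qext t)%C source x _ Cder_trace cont2_source).
Qed.

Lemma kpartial_uniform x eps : 0 < eps ->
  exists N0, forall N, (N0 <= N)%nat -> forall y, -1 <= y <= 1 ->
    Cmod (kslice x y - kpartial x N y)%C <= eps.
Proof.
intros He. destruct (Cder_kslice x) as (dk & Hc & Hd).
destruct (lsum_uniform (fun y => Re (kslice x y)) (fun y => Re (dk y)) (eps / 2)) as [N1 H1].
{ intros y; apply Cder_Re, Hd. } { now apply cont_Re. } { lra. }
destruct (lsum_uniform (fun y => Im (kslice x y)) (fun y => Im (dk y)) (eps / 2)) as [N2 H2].
{ intros y; apply Cder_Im, Hd. } { now apply cont_Im. } { lra. }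
exists (max N1 N2). intros N HN y Hy.
specialize (H1 N ltac:(lia) y Hy). specialize (H2 N ltac:(lia) y Hy).
rewrite kpartial_eq.
eapply Rle_trans; [apply Cmod_le_Re_Im |]. unfold Re, Im in *; simpl in *. unfold Rminus in *. lra.
Qed.

(** The least admissible error bound. *)
Definition kernel_dist (N : nat) (x : R) : R :=
  real (Lub_Rbar (fun r => exists t, Rabs t <= x /\ r = Cmod (K x t - K_trunc f N x t)%C)).

Lemma kernel_dist_lub N x : 0 < x <= b ->
  0 <= kernel_dist N x /\
  (forall t, Rabs t <= x -> Cmod (K x t - K_trunc f N x t)%C <= kernel_dist N x) /\
  (forall e, (forall y, -1 <= y <= 1 -> Cmod (kslice x y - kpartial x N y)%C <= e) ->
     kernel_dist N x <= e).
Proof.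
intros Hx.
set (E := fun r => exists t, Rabs t <= x /\ r = Cmod (K x t - K_trunc f N x t)%C).
assert (U : forall e, (forall y, -1 <= y <= 1 -> Cmod (kslice x y - kpartial x N y)%C <= e) -> is_ub_Rbar E e).
{ intros e He r [t [Ht ->]].
  assert (Ht' := Ht). apply Rabs_le_between in Ht'.
  assert (Hy : -1 <= t / x <= 1) by (split; [apply Rle_div_r | apply Rle_div_l]; lra).
  specialize (He (t / x) Hy). rewrite Kext_eq by (lra || exact Ht).
  replace t with (x * (t / x)) by (field; lra). rewrite K_trunc_eq by exact Hx. exact He. }
assert (B : exists M, forall y, -1 <= y <= 1 -> Cmod (kslice x y - kpartial x N y)%C <= M).
{ destruct kslice_bounded as (M & HM0 & HM).
  exists (M + sum_f_R0 (fun j => (2 * INR j + 1) * M) N). intros y Hy.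
  unfold Cminus. eapply Rle_trans; [apply Cmod_triangle |]. rewrite Cmod_opp.
  apply Rplus_le_compat; [apply HM; lra |].
  apply Csum_Cmod. intros k _. rewrite Cmod_mult, Cmod_R, <- (Rmult_1_r (_ * M)).
  apply Rmult_le_compat; [apply Cmod_ge_0 | apply Rabs_pos | apply kcoef_bound; auto; lra | now apply legendre_bound]. }
destruct B as [M HM].
destruct (Lub_Rbar_correct E) as [L1 L2].
assert (E0 : E (Cmod (K x 0 - K_trunc f N x 0)%C)) by (exists 0; split; [rewrite Rabs_R0; lra | reflexivity]).
assert (F : Lub_Rbar E = Finite (kernel_dist N x)).
{ unfold kernel_dist. fold E. generalize (L2 M (U M HM)) (L1 _ E0).
  destruct (Lub_Rbar E); simpl; tauto. }
rewrite F in L1, L2. repeat split.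
- eapply Rle_trans; [apply Cmod_ge_0 | apply (L1 _ E0)].
- intros t Ht. apply (L1 (Cmod (K x t - K_trunc f N x t)%C)). now exists t.
- intros e He. apply (L2 e (U e He)).
Qed.

Lemma kernel_dist_bound N : kernel_error_bound b f K N (kernel_dist N).
Proof. intros x Hx. destruct (kernel_dist_lub N x Hx) as (A & B & _). now split. Qed.

Lemma kernel_dist_lim x : 0 < x <= b -> is_lim_seq (fun N => kernel_dist N x) 0.
Proof.
intros Hx. apply is_lim_seq_spec. intros eps.
assert (He : 0 < eps / 2) by (pose proof (cond_pos eps); lra).
destruct (kpartial_uniform x (eps / 2) He) as [N0 H0].
exists N0. intros N HN.
destruct (kernel_dist_lub N x Hx) as (A & _ & L).
rewrite Rminus_0_r, Rabs_pos_eq by exact A. specialize (L _ (H0 N HN)). lra.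
Qed.

(** ** The solutions and their truncated expansions *)

(** [sol Ccos] and [sol Csin] are the two solutions; [cos] and [sin] are treated together. *)
Definition sol (T : C -> C) (om : C) (x : R) : C :=
  (T (om * x) + CInt (fun t => K x t * T (om * t)) (- x)%R x)%C.

Definition trunc (T : C -> C) (N : nat) (om : C) (x : R) : C :=
  (T (om * x) + x * CInt (fun y => kpartial x N y * T (om * x * y)) (-1) 1)%C.

Lemma sol_slice T om x : trig_like T -> 0 <= x <= b ->
  sol T om x = (T (om * x) + x * CInt (fun y => kslice x y * T (om * x * y)) (-1) 1)%C.
Proof.
intros [TC _] Hx.
assert (E := Tr_kernel (fun t => T (om * t)%C) x (TC om) Hx). unfold sol. rewrite <- E.
rewrite Tr_eq by apply TC. f_equal.
rewrite CInt_rescale by (apply cont_Cmult; [exact (cont2_r _ x cont2_Kext) | apply TC]).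
f_equal. apply CInt_ext. intros y _. unfold kslice. f_equal. f_equal. rewrite RtoC_mult. ring.
Qed.

Lemma sol_equation T (u' : C -> R -> C) om : trig_like T ->
  (forall t, Cder (fun t : R => T (om * t)%C) t (u' om t)) ->
  (forall t, Cder (u' om) t (- (om * om) * T (om * t))%C) ->
  schrodinger_solution (Ioo 0 b) q (om * om)%C (sol T om).
Proof.
intros [TC _] H1 H2. apply (Tr_solution (fun t => T (om * t)%C) (u' om)); auto.
intros x Hx. symmetry. now apply Tr_kernel.
Qed.

Lemma kernel_error_slice N eps x y : 0 < x <= b -> kernel_error_bound b f K N eps -> -1 <= y <= 1 ->
  Cmod (kslice x y - kpartial x N y)%C <= eps x.
Proof.
intros Hx He Hy. destruct (He x Hx) as [_ H].
assert (Ht : Rabs (x * y) <= x) by (apply Rabs_le; nra).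
specialize (H (x * y) Ht). rewrite K_trunc_eq in H by exact Hx.
rewrite Kext_eq in H by (lra || exact Ht). exact H.
Qed.

(** The difference is the integral over [|t| <= x] of [K - K_N] against [T(om t)], and
    [|T(om t)| <= cosh (c t)] in the strip. *)
Lemma trunc_error T N eps om c x : trig_like T -> 0 <= x <= b -> kernel_error_bound b f K N eps ->
  0 <= c -> Rabs (Im om) <= c ->
  Cmod (sol T om x - trunc T N om x)%C <= 2 * eps x * sinh_quot c x.
Proof.
intros HT Hx He Hc Hom. rewrite sol_slice by assumption. unfold trunc.
destruct HT as [TC TB]. assert (C3 := TC (om * x)%C).
assert (C1 := cont_kslice x). assert (C2 := cont_kpartial x N).
replace (_ - _)%C with (x * (CInt (fun y => kslice x y * T (om * x * y)) (-1) 1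
    - CInt (fun y => kpartial x N y * T (om * x * y)) (-1) 1))%C by ring.
rewrite <- CInt_minus by (apply cont_Cmult; assumption).
rewrite (CInt_ext _ (fun y => (kslice x y - kpartial x N y) * T (om * x * y))%C) by (intros; ring).
destruct (Req_dec x 0) as [Hx0 | Hx0].
{ rewrite Hx0, Cmult_0_l, Cmod_0. right. unfold sinh_quot.
  destruct (Req_EM_T c 0); [ring |]. rewrite Rmult_0_r, sinh_0. field; assumption. }
assert (Hx1 : 0 < x <= b) by lra. destruct (RInt_cosh c x Hc ltac:(lra)) as [EI I].
rewrite Cmod_mult, Cmod_R, Rabs_pos_eq by lra.
apply Rle_trans with (x * RInt (fun y => eps x * cosh (c * x * y)) (-1) 1).
- apply Rmult_le_compat_l; [lra |]. apply CInt_norm_le; [lra | | |].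
  + apply cont_Cmult; [now apply cont_Cminus | exact C3].
  + now apply (ex_RInt_scal (V := R_NormedModule)).
  + intros y Hy. rewrite Cmod_mult. apply Rmult_le_compat; try apply Cmod_ge_0; [now apply (kernel_error_slice N) |].
    eapply Rle_trans; [apply TB |].
    replace (Im (om * x * y)) with (Im om * x * y) by (destruct om; simpl; ring).
    rewrite <- (cosh_abs (c * x * y)). apply cosh_le. rewrite !Rabs_mult, (Rabs_pos_eq c) by exact Hc.
    apply Rmult_le_compat_r; [apply Rabs_pos |]. apply Rmult_le_compat_r; [apply Rabs_pos | exact Hom].
- rewrite (RInt_scal (V := R_CompleteNormedModule)) by exact EI.
  unfold scal; simpl; unfold mult; simpl. right.
  transitivity (eps x * (x * RInt (fun y => cosh (c * x * y)) (-1) 1)); [ring | rewrite I; ring].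
Qed.

Lemma trunc_eq T N om x : trig_like T ->
  trunc T N om x = (T (om * x) + Csum (fun j =>
    x * (kcoef x j * CInt (fun y => RtoC (legendre j y) * T (om * x * y)) (-1) 1)) N)%C.
Proof.
intros [TC _]. unfold trunc. f_equal. rewrite Csum_scal. f_equal.
assert (C3 := TC (om * x)%C).
assert (CT : forall j, contC (fun y : R => RtoC (legendre j y) * T (om * x * y))%C) by prove_cont.
induction N as [|N IH].
- rewrite Csum_O, <- (CInt_scal _ _ _ _ (CT 0%nat)). apply CInt_ext. intros y _.
  unfold kpartial. rewrite Csum_O. ring.
- rewrite Csum_S, <- IH, <- (CInt_scal _ _ _ _ (CT (S N))), <- CInt_plus.
  + apply CInt_ext. intros y _. unfold kpartial. rewrite Csum_S. ring.
  + apply cont_Cmult; [apply cont_kpartial | exact C3].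
  + apply cont_Cmult; [apply cont_const | apply CT].
Qed.

(** The cosine is even: only the Legendre polynomials of even degree contribute, and [i^(2n)] is the
    sign of the expansion. *)
Lemma c_trunc_eq N om x : 0 <= x <= b -> c_trunc f N om x = trunc Ccos N om x.
Proof.
intros Hx. rewrite (trunc_eq _ _ _ _ trig_like_Ccos). unfold c_trunc. f_equal.
symmetry. rewrite Csum_even.
- rewrite <- Csum_scal. apply Csum_ext. intros n _.
  rewrite CInt_legendre_Ccos, Ci_pow_even, pow_m1_even. unfold c_term.
  rewrite beta_eq by exact Hx. rewrite RtoC_pow. ring.
- intros n. rewrite CInt_legendre_Ccos, pow_add, pow_m1_even.
  replace (1 * (-1) ^ 1) with (-1) by ring.
  replace (1 + RtoC (-1))%C with (RtoC 0) by (apply injective_projections; simpl; ring). ring.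
Qed.

Lemma s_trunc_eq N om x : 0 <= x <= b -> s_trunc f N om x = trunc Csin N om x.
Proof.
intros Hx. rewrite (trunc_eq _ _ _ _ trig_like_Csin). unfold s_trunc. f_equal. symmetry.
assert (HCi : Ci <> RtoC 0) by (intros E; injection E; lra).
assert (Z : forall n, (x * (kcoef x (2 * n) * CInt (fun y => RtoC (legendre (2 * n) y) * Csin (om * x * y)) (-1) 1))%C = RtoC 0).
{ intros n. rewrite CInt_legendre_Csin, pow_m1_even.
  replace (1 - RtoC 1)%C with (RtoC 0) by ring. unfold Cdiv. ring. }
destruct N as [|M].
- rewrite Csum_O. transitivity (RtoC 0); [exact (Z 0%nat) | ring].
- rewrite Csum_odd by exact Z.
  rewrite <- Csum_scal. apply Csum_ext. intros n _.
  rewrite CInt_legendre_Csin, pow_add, pow_m1_even. unfold s_term.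
  rewrite Cpow_add_r, Ci_pow_even.
  rewrite beta_eq by exact Hx. rewrite RtoC_pow.
  replace (1 - RtoC (1 * (-1) ^ 1))%C with (RtoC 2) by (apply injective_projections; simpl; ring).
  simpl (Ci ^ 1)%C. field. exact HCi.
Qed.

(** ** Convergence of the series *)

Lemma trunc_lim T om x : trig_like T -> 0 <= x <= b -> Clim (fun N => trunc T N om x) (sol T om x).
Proof.
intros HT Hx.
set (S := sinh_quot (Rabs (Im om)) x).
apply (Clim_bound _ _ (fun N => 2 * kernel_dist N x * S)).
- intros N. rewrite <- Cmod_opp. replace (- _)%C with (sol T om x - trunc T N om x)%C by ring.
  apply trunc_error; auto; [apply kernel_dist_bound | apply Rabs_pos | lra].
- destruct (Req_dec x 0) as [E | E].
  + apply (is_lim_seq_ext (fun _ => 0)); [| apply is_lim_seq_const].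
    intros N. unfold S, sinh_quot. rewrite E.
    destruct (Req_EM_T (Rabs (Im om)) 0); [ring |]. rewrite Rmult_0_r, sinh_0. field; assumption.
  + replace (Finite 0) with (Rbar_mult (2 * S) 0) by (simpl; now rewrite Rmult_0_r).
    apply (is_lim_seq_ext (fun N => 2 * S * kernel_dist N x)); [intros; ring |].
    apply is_lim_seq_scal_l, kernel_dist_lim. lra.
Qed.

(** The partial sums of a series [2 sum term] are truncations of the solution, along a
    subsequence of orders. *)
Lemma trunc_series T (term : nat -> C) (idx : nat -> nat) om x : trig_like T -> 0 <= x <= b ->
  (forall n, (n <= idx n)%nat) -> (forall n, trunc T (idx n) om x = T (om * x) + 2 * Csum term n)%C ->
  Clim (Csum term) ((sol T om x - T (om * x)) / 2)%C.
Proof.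
intros HT Hx Hi Ht.
assert (L := Clim_subseq _ _ idx (trunc_lim T om x HT Hx)).
apply (Clim_bound _ _ (fun n => / 2 * Cmod (trunc T (idx n) om x - sol T om x)%C)).
- intros n. replace (/ 2) with (Cmod (/ 2)%R) by (rewrite Cmod_R, Rabs_pos_eq; lra).
  rewrite <- Cmod_mult, Ht. right. f_equal. rewrite RtoC_inv by lra. field.
- replace (Finite 0) with (Rbar_mult (/ 2) 0) by (simpl; now rewrite Rmult_0_r).
  apply is_lim_seq_scal_l, L. intros P [N HN]. exists N. intros m Hm. apply HN. specialize (Hi m). lia.
Qed.

Lemma c_series om x : 0 <= x <= b -> Clim (Csum (c_term f om x)) ((sol Ccos om x - Ccos (om * x)) / 2)%C.
Proof.
intros Hx. apply (trunc_series _ _ (fun n => (2 * n)%nat)); auto using trig_like_Ccos; [lia |].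
intros n. rewrite <- c_trunc_eq by exact Hx. unfold c_trunc.
now replace (2 * n / 2)%nat with n by (rewrite Nat.mul_comm, Nat.div_mul; lia).
Qed.

Lemma s_series om x : 0 <= x <= b -> Clim (Csum (s_term f om x)) ((sol Csin om x - Csin (om * x)) / 2)%C.
Proof.
intros Hx. apply (trunc_series _ _ (fun n => S (2 * n))); auto using trig_like_Csin; [lia |].
intros n. rewrite <- s_trunc_eq by exact Hx. unfold s_trunc.
now replace (2 * n / 2)%nat with n by (rewrite Nat.mul_comm, Nat.div_mul; lia).
Qed.

(** The coefficients grow at most linearly in [j], the spherical Bessel functions decay
    factorially. *)
Lemma beta_sph_bound M r om x j : 0 <= x <= b -> 0 <= M ->
  (forall x y, 0 <= x <= b -> -1 <= y <= 1 -> Cmod (kslice x y) <= M) -> Cmod om <= r ->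
  Cmod (beta f j x * sph_bessel j (om * x))%C
  <= b * M * exp ((r * b) ^ 2 / 2) * ((r * b) ^ j / INR (fact j)).
Proof.
intros Hx HM0 HM Hr.
assert (Hr0 : 0 <= r) by (eapply Rle_trans; [apply Cmod_ge_0 | exact Hr]).
assert (Hrb : 0 <= r * b) by (apply Rmult_le_pos; lra).
rewrite beta_eq by exact Hx. rewrite 2!Cmod_mult, Cmod_R, Rabs_pos_eq by lra.
assert (Z : Cmod (om * x) <= r * b).
{ rewrite Cmod_mult, Cmod_R, Rabs_pos_eq by lra. apply Rmult_le_compat; try lra. apply Cmod_ge_0. }
assert (P := dfact_pos j). assert (Hj := pos_INR j).
assert (E : Cmod (sph_bessel j (om * x)) <= (r * b) ^ j / dfact j * exp ((r * b) ^ 2 / 2)).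
{ eapply Rle_trans; [apply sph_bessel_bound |].
  assert (Z0 := Cmod_ge_0 (om * x)).
  apply Rmult_le_compat.
  - apply Rdiv_le_0_compat; [now apply pow_le | exact P].
  - apply Rlt_le, exp_pos.
  - apply Rmult_le_compat_r; [apply Rlt_le, Rinv_0_lt_compat, P | now apply pow_incr].
  - apply exp_le. assert (Cmod (om * x) ^ 2 <= (r * b) ^ 2) by now apply pow_incr. lra. }
assert (Bk := kcoef_bound M x j Hx HM).
apply Rle_trans with (b * ((2 * INR j + 1) * M) * ((r * b) ^ j / dfact j * exp ((r * b) ^ 2 / 2))).
- apply Rmult_le_compat; try apply Cmod_ge_0; try exact E.
  + apply Rmult_le_pos; [lra | apply Cmod_ge_0].
  + apply Rmult_le_compat; try lra. apply Cmod_ge_0.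
- replace (b * ((2 * INR j + 1) * M) * ((r * b) ^ j / dfact j * exp ((r * b) ^ 2 / 2)))
   with (b * M * exp ((r * b) ^ 2 / 2) * ((r * b) ^ j * ((2 * INR j + 1) / dfact j))) by (field; lra).
  apply Rmult_le_compat_l.
  + repeat apply Rmult_le_pos; try lra. apply Rlt_le, exp_pos.
  + apply Rmult_le_compat_l; [now apply pow_le | apply dfact_ge].
Qed.

Lemma uniform_series T (term : C -> R -> nat -> C) (idx : nat -> nat) Om : Ccompact Om ->
  (forall n, idx n = (2 * n)%nat \/ idx n = (2 * n + 1)%nat) ->
  (forall om x n, term om x n = (-1) ^ n * beta f (idx n) x * sph_bessel (idx n) (om * x))%C ->
  (forall om x, 0 <= x <= b -> Clim (Csum (term om x)) ((sol T om x - T (om * x)) / 2)%C) ->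
  series_converges_uniformly (fun p : C * R => Om (fst p) /\ Icc 0 b (snd p))
    (fun n p => 2 * term (fst p) (snd p) n)%C (fun p => sol T (fst p) (snd p) - T (fst p * snd p))%C.
Proof.
intros HOm Hidx Hterm Hlim. destruct (Ccompact_bounded Om HOm) as [r0 Hr0].
set (r := Rmax r0 0). assert (Hrp : 0 <= r) by apply Rmax_r.
assert (Hr : forall z, Om z -> Cmod z <= r) by (intros z Hz; eapply Rle_trans; [now apply Hr0 | apply Rmax_l]).
destruct kslice_bounded as (M & HM0 & HM).
set (A := b * M * exp ((r * b) ^ 2 / 2)).
assert (HA : 0 <= A) by (repeat apply Rmult_le_pos; try lra; apply Rlt_le, exp_pos).
assert (Hrb : 0 <= r * b) by (apply Rmult_le_pos; lra).
(* the factor [1 + r b] and [j! >= n!] make this majorant serve both parities of [idx n] *)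
apply (weierstrass_test _ _ _ (fun n => 2 * A * (1 + r * b) * (((r * b) ^ 2) ^ n / INR (fact n)))).
- apply (ex_series_scal (K := R_AbsRing) (V := R_NormedModule) (2 * A * (1 + r * b))
   (fun n => ((r * b) ^ 2) ^ n / INR (fact n))). eexists. apply is_series_exp_fact.
- intros n [om x] [Ho Hx]. simpl in Ho, Hx. cbn [fst snd]. set (j := idx n).
  apply Rle_trans with (2 * (A * ((r * b) ^ j / INR (fact j)))).
  + rewrite Hterm. fold j.
    replace ((-1) ^ n * beta f j x * sph_bessel j (om * x))%C
      with (RtoC ((-1) ^ n) * (beta f j x * sph_bessel j (om * x)))%C by (rewrite RtoC_pow; ring).
    rewrite 2!Cmod_mult, 2!Cmod_R, pow_1_abs, Rmult_1_l, Rabs_pos_eq by lra.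
    apply Rmult_le_compat_l; [lra |]. apply (beta_sph_bound M); auto.
  + assert (F1 : / INR (fact j) <= / INR (fact n)).
    { apply Rinv_le_contravar; [apply INR_fact_lt_0 |]. apply le_INR, fact_le.
      destruct (Hidx n) as [E | E]; unfold j; lia. }
    assert (F2 : 0 < / INR (fact n)) by apply Rinv_0_lt_compat, INR_fact_lt_0.
    assert (F3 : (r * b) ^ j <= (1 + r * b) * ((r * b) ^ 2) ^ n).
    { assert (0 <= ((r * b) ^ 2) ^ n) by (apply pow_le, pow2_ge_0). unfold j.
      destruct (Hidx n) as [-> | ->]; [| rewrite pow_add, pow_1]; rewrite pow_mult; nra. }
    assert (F4 : 0 <= (r * b) ^ j) by now apply pow_le.
    replace (2 * A * (1 + r * b) * (((r * b) ^ 2) ^ n / INR (fact n)))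
      with (2 * A * ((1 + r * b) * ((r * b) ^ 2) ^ n * / INR (fact n))) by (unfold Rdiv; ring).
    replace (2 * (A * ((r * b) ^ j / INR (fact j)))) with (2 * A * ((r * b) ^ j * / INR (fact j))) by (unfold Rdiv; ring).
    apply Rmult_le_compat_l; [lra |].
    apply Rmult_le_compat; try assumption. apply Rlt_le, Rinv_0_lt_compat, INR_fact_lt_0.
- intros [om x] [_ Hx]. cbn [fst snd].
  apply (Clim_ext (fun n => 2 * Csum (term om x) n)%C); [intros n; now rewrite <- Csum_scal |].
  replace (sol T om x - T (om * x))%C with (2 * ((sol T om x - T (om * x)) / 2))%C by field.
  apply Clim_scal, Hlim, Hx.
Qed.

End Transmutation.

Theorem theorem4p1 (b : R) (q f : R -> C) (h : C) (K : R -> R -> C)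
  (hb : 0 < b)
  (hq : Ccontinuous_on (Icc 0 b) q)
  (hf : schrodinger_solution (Icc 0 b) q (RtoC 0) f)
  (hf_nz : forall x : R, Icc 0 b x -> f x <> RtoC 0)
  (hf0 : f 0 = RtoC 1)
  (hh : is_derive_within (Icc 0 b) f 0 h)
  (hK : is_transmutation_kernel b q h K) :
  (* c and s are solutions *)
  (forall om : C,
     schrodinger_solution (Ioo 0 b) q (om * om)%C (c_sol K om) /\
     schrodinger_solution (Ioo 0 b) q (om * om)%C (s_sol K om)) /\
  (* representations by Bessel functions J_nu *)
  (forall (om : C) (x : R), Icc 0 b x -> (om * x)%C <> RtoC 0 ->
     (exists S : C, Cis_series (c_term_J f om x) S /\
        c_sol K om x = (Ccos (om * x) + sqrt_quot (2 * PI) (om * x) * S)%C) /\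
     (exists S : C, Cis_series (s_term_J f om x) S /\
        s_sol K om x = (Csin (om * x) + sqrt_quot (2 * PI) (om * x) * S)%C)) /\
  (* representations by spherical Bessel functions *)
  (forall (om : C) (x : R), Icc 0 b x ->
     (exists S : C, Cis_series (c_term f om x) S /\
        c_sol K om x = (Ccos (om * x) + 2 * S)%C) /\
     (exists S : C, Cis_series (s_term f om x) S /\
        s_sol K om x = (Csin (om * x) + 2 * S)%C)) /\
  (* uniform convergence for x in [0,b] and om in a compact set *)
  (forall Om : C -> Prop, Ccompact Om ->
     series_converges_uniformly
       (fun p : C * R => Om (fst p) /\ Icc 0 b (snd p))
       (fun n p => 2 * c_term f (fst p) (snd p) n)%C
       (fun p => c_sol K (fst p) (snd p) - Ccos (fst p * snd p))%C /\
     series_converges_uniformly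
       (fun p : C * R => Om (fst p) /\ Icc 0 b (snd p))
       (fun n p => 2 * s_term f (fst p) (snd p) n)%C
       (fun p => s_sol K (fst p) (snd p) - Csin (fst p * snd p))%C) /\
  (* admissible error functions exist and may be taken to tend to zero *)
  (exists eps : nat -> R -> R,
     (forall N : nat, kernel_error_bound b f K N (eps N)) /\
     (forall x : R, 0 < x <= b -> is_lim_seq (fun N => eps N x) 0)) /\
  (* error estimates *)
  (forall (N : nat) (eps : R -> R), kernel_error_bound b f K N eps ->
     (forall om x : R, om <> 0 -> Icc 0 b x ->
        Cmod (c_sol K om x - c_trunc f N om x)%C <= 2 * Rabs x * eps x /\
        Cmod (s_sol K om x - s_trunc f N om x)%C <= 2 * Rabs x * eps x) /\
     (forall (om : C) (c x : R), om <> RtoC 0 -> 0 <= c -> Rabs (Im om) <= c ->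
        Icc 0 b x ->
        Cmod (c_sol K om x - c_trunc f N om x)%C <= 2 * eps x * sinh_quot c x /\
        Cmod (s_sol K om x - s_trunc f N om x)%C <= 2 * eps x * sinh_quot c x)).
Proof.
assert (Half : forall S T : C, S = (T + 2 * ((S - T) / 2))%C) by (intros; field).
assert (HC := c_series b q f h K hb hq hK hf hf_nz hf0 hh).
assert (HS := s_series b q f h K hb hq hK hf hf_nz hf0 hh).
split; [| split; [| split; [| split; [| split]]]].
- intros om. split.
  + apply (sol_equation b q h K hb hq hK Ccos (fun om t => - om * Csin (om * t))%C); [apply trig_like_Ccos | |].
    * intros t; apply Cder_Ccos.
    * intros t. eapply Cder_eq; [apply Cder_scal, Cder_Csin | ring].
  + apply (sol_equation b q h K hb hq hK Csin (fun om t => om * Ccos (om * t))%C); [apply trig_like_Csin | |].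
    * intros t; apply Cder_Csin.
    * intros t. eapply Cder_eq; [apply Cder_scal, Cder_Ccos | ring].
- intros om x Hx Hz. split.
  + destruct (bessel_series _ (c_term_J f om x) (om * x) _ Hz (fun n => c_term_J_eq f om x n Hz) (HC om x Hx)) as (S & H1 & H2).
    exists S. split; [exact H1 |]. rewrite <- H2. unfold c_sol, sol. ring.
  + destruct (bessel_series _ (s_term_J f om x) (om * x) _ Hz (fun n => s_term_J_eq f om x n Hz) (HS om x Hx)) as (S & H1 & H2).
    exists S. split; [exact H1 |]. rewrite <- H2. unfold s_sol, sol. ring.
- intros om x Hx. split; eexists; (split; [apply Cis_series_of_Clim | apply Half]); [now apply HC | now apply HS].
- intros Om HOm. split.
  + apply (uniform_series b q f h K hb hq hK hf hf_nz hf0 hh Ccos (c_term f) (fun n => 2 * n)%nat); auto.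
  + apply (uniform_series b q f h K hb hq hK hf hf_nz hf0 hh Csin (s_term f) (fun n => 2 * n + 1)%nat); auto.
- exists (kernel_dist f K). split.
  + apply (kernel_dist_bound b q f h K hb hq hK hf hf_nz hf0 hh).
  + apply (kernel_dist_lim b q f h K hb hq hK hf hf_nz hf0 hh).
- intros N eps He.
  assert (Strip : forall (om : C) (c x : R), 0 <= c -> Rabs (Im om) <= c -> Icc 0 b x ->
    Cmod (c_sol K om x - c_trunc f N om x)%C <= 2 * eps x * sinh_quot c x /\
    Cmod (s_sol K om x - s_trunc f N om x)%C <= 2 * eps x * sinh_quot c x).
  { intros om c x Hc Hom Hx.
    assert (E := fun T HT => trunc_error b q f h K hb hq hK hf hf_nz hf0 hh T N eps om c x HT Hx He Hc Hom).
    rewrite (c_trunc_eq b q f h K hb hq hK hf hf_nz hf0 hh N om x Hx).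
    rewrite (s_trunc_eq b q f h K hb hq hK hf hf_nz hf0 hh N om x Hx).
    split; [exact (E _ trig_like_Ccos) | exact (E _ trig_like_Csin)]. }
  split.
  (* a real frequency lies in the strip of width 0, where [sinh_quot] is [x] *)
  + intros om x _ Hx. destruct (Strip om 0 x (Rle_refl 0)) as [E1 E2]; [simpl; rewrite Rabs_R0; lra | exact Hx |].
    unfold sinh_quot in E1, E2. destruct (Req_EM_T 0 0) as [_ | Z]; [| now elim Z].
    rewrite (Rabs_pos_eq x) by apply Hx.
    replace (2 * x * eps x) with (2 * eps x * x) by ring. now split.
  + intros om c x _ Hc Hom Hx. now apply Strip.
Qed.
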